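(* Let $(\mathcal{U},f,\mathfrak{I})$ be a regular lemniscate region. Given a function $w(z)$ analytic in $\mathcal{U}$, there exists a non-decreasing function $\sigma:\mathbb{R}\to\mathbb{R}$ such that $$L_w(t):=\int_{E_{\mathcal{U},f}(t)}|w(z)|^2\,|dz|=\int_{-\infty}^{+\infty}e^{xt}\,d\sigma(x),\qquad t\in\mathfrak{I},$$ and the latter integral converges for all $t\in\mathfrak{I}$.
   Context: Let $f$ be an analytic function (on an open subset of $\mathbb{C}$) and, for real $t$, let $E_f(t)=\{z:\ln|f(z)|=t\}$. A lemniscate region of $f$ is a triple $(\mathcal{U},f,\mathfrak{I})$, where $\mathfrak{I}=(a,b)$ is an open interval ($-\infty\le a<b\le+\infty$), $\mathcal{U}$ is a connected component of the set $\{z: a<\ln|f(z)|<b\}$, and for every $t\in\mathfrak{I}$ the set $E_{\mathcal{U},f}(t):=E_f(t)\cap\mathcal{U}$ is compact; this is understood in the sense that the map $\ln|f|:\mathcal{U}\to\mathfrak{I}$ is proper. The lemniscate region is called regular if $f(z)f'(z)\neq0$ for all $z\in\mathcal{U}$. $|dz|$ denotes integration with respect to arc length, and $\int e^{xt}\,d\sigma(x)$ is a Stieltjes integral. *)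

(* Defs.v *)
From HB Require Import structures.
From mathcomp Require Import all_boot all_order all_algebra.
From mathcomp Require Import complex.
From mathcomp Require Import all_classical all_reals all_analysis.

Set Implicit Arguments.
Unset Strict Implicit.
Unset Printing Implicit Defensive.

Import Order.TTheory GRing.Theory Num.Theory.
Import ComplexField.Normc numFieldNormedType.Exports.

Local Open Scope classical_set_scope.
Local Open Scope ring_scope.
Local Open Scope complex_scope.

(* The library puts a topology on every abstract numFieldType but declares no
   instance for the concrete type R[i]; this is the same structure, given by
   the modulus.  Derivatives of maps R[i] -> R[i] are then complex ones. *)
#[warnings="-redundant-canonical-projection"]
HB.instance Definition _ (R : realType) := NormedModule.copy R[i] R[i]^o.

Section Analytic.
Context {R : realType}.
Implicit Types (D U : set R[i]) (f : R[i] -> R[i]).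

Definition analytic_at f (z0 : R[i]) : Prop :=
  exists c : nat -> R[i],
    \forall z \near z0, [series c n * (z - z0) ^+ n]_n @ \oo --> f z.

Definition analytic_on D f : Prop := forall z, D z -> analytic_at f z.

(* ln|f(z)|, with the value -oo at the zeros of f (lne 0 = -oo). *)
Definition lnnorm f (z : R[i]) : \bar R := lne (normc (f z))%:E.

(* The open interval with possibly infinite endpoints, as a set of reals. *)
Definition ointerval (a b : \bar R) : set R := [set t | (a < t%:E < b)%E].

(* Functions are total, so the domain D of f appears explicitly. *)
Definition level_set D f (t : R) : set R[i] :=
  [set z | D z /\ lnnorm f z = t%:E].

Definition level_strip D f (a b : \bar R) : set R[i] :=
  [set z | D z /\ (a < lnnorm f z < b)%E].

Definition is_component (A U : set R[i]) : Prop :=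
  exists2 z, A z & U = connected_component A z.

(* The last condition is properness of ln|f| : U -> ]a, b[; K ranging over the
   singletons gives compactness of every level set in U. *)
Definition lemniscate_region D U f (a b : \bar R) : Prop :=
  [/\ open D, analytic_on D f, (a < b)%E,
      is_component (level_strip D f a b) U &
      forall K : set R, compact K -> K `<=` ointerval a b ->
        compact [set z | U z /\ exists2 t, K t & lnnorm f z = t%:E]].

Definition regular_region U f : Prop :=
  forall z, U z -> f z * derive1 f z != 0.

End Analytic.

Section ArcLength.
Context {R : realType}.
Implicit Types (gamma : R -> R[i]) (E : set R[i]).

Definition re_part gamma (s : R) : R := complex.Re (gamma s).
Definition im_part gamma (s : R) : R := complex.Im (gamma s).

Definition speed gamma (s : R) : R :=
  Num.sqrt (derive1 (re_part gamma) s ^+ 2 + derive1 (im_part gamma) s ^+ 2).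

Definition C1 (x : R -> R) : Prop :=
  (forall s, derivable x s 1) /\ continuous (derive1 x).

(* A simple closed C^1 curve with nonvanishing velocity, given as an
   l-periodic function on the whole line, so that it is also C^1 at the
   junction point. *)
Definition simple_closed_curve (l : R) gamma : Prop :=
  [/\ 0 < l, periodic gamma l, {in `[0, l[ &, injective gamma},
      C1 (re_part gamma) /\ C1 (im_part gamma) &
      forall s, speed gamma s != 0].

(* E is the disjoint union of the n closed curves gammas j, of period l j. *)
Definition parametrizes n (l : 'I_n -> R) (gammas : 'I_n -> R -> R[i]) E : Prop :=
  [/\ forall j, simple_closed_curve (l j) (gammas j),
      forall j k s s', gammas j s = gammas k s' -> j = k &
      E = \bigcup_j range (gammas j)].

Definition curves_integral n (l : 'I_n -> R) (gammas : 'I_n -> R -> R[i])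
    (g : R[i] -> R) : \bar R :=
  (\sum_(j < n) \int[lebesgue_measure]_(s in `[0%R, l j])
     (g (gammas j s) * speed (gammas j) s)%:E)%E.

(* The integral of g over E with respect to arc length exists and equals v:
   E is a finite disjoint union of smooth closed curves, and v is the value
   obtained from every such description of E. *)
Definition is_arclength_integral E (g : R[i] -> R) (v : \bar R) : Prop :=
  (exists n l gammas, @parametrizes n l gammas E) /\
  (forall n l gammas, @parametrizes n l gammas E -> curves_integral l gammas g = v).

End ArcLength.

(* Main.v *)
Require Import Defs.
From HB Require Import structures.
From mathcomp Require Import all_boot all_order all_algebra.
From mathcomp Require Import complex.
From mathcomp Require Import all_classical all_reals all_analysis.
From mathcomp Require Import measurable_realfun.
From mathcomp Require Import ring lra zify.

Set Implicit Arguments.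
Unset Strict Implicit.
Unset Printing Implicit Defensive.

Import Order.TTheory GRing.Theory Num.Theory.
Import ComplexField.Normc numFieldNormedType.Exports.

Local Open Scope classical_set_scope.
Local Open Scope ring_scope.
Local Open Scope complex_scope.

Local Notation Re := complex.Re.
Local Notation Im := complex.Im.

(** The map f makes U a finite covering of the annulus a < ln|u| < b: ln|f| is
   proper on U and f' does not vanish there.  In logarithmic coordinates this is
   a holomorphic map psi from the strip a < Re s < b onto U with f (psi s) = exp s,
   which identifies exactly the points that differ by multiples of 2 pi n i, n being
   the number of sheets (lemniscate_uniformization).  The part of the level set of
   t in U is then the single closed curve x |-> psi (t + i x), 0 <= x <= 2 pi n,
   with arc length |psi' (t + i x)| dx.  Every other parametrization is a change of
   the angle x, so that the integral does not depend on it (curve_angle,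
   one_curve_integral, level_arclength).

   As psi' has no zeros, it has a holomorphic square root H on the strip
   (strip_sqrt), which at worst changes sign over the period 2 pi n, and so has
   period 4 pi n (strip_sqrt_period).  With h = (w o psi) H, L_w(t) is one half of
   the integral of |h (t + i x)|^2 over 0 <= x <= 4 pi n.  On the line Re s = t the
   Fourier coefficients of h are c_k exp (k t / 2 n) with c_k independent of t,
   because the mean of h (s) exp (- k s / 2 n) over a vertical period is the same
   on all lines (periodic_mean_cst).  Parseval's formula (strip_parseval) gives

     L_w(t) = sum over k in Z of 2 pi n |c_k|^2 exp (k t / n),

   the Stieltjes integral of exp (x t) against the step function with jump
   2 pi n |c_k|^2 at k / n (step_stieltjes).

   Two tools carry the analysis.  Power series have strict derivatives
   (analytic_sderiv); a nonzero strict derivative gives a local inverse with an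
   explicit scale, uniform over compact sets, and this suffices to lift maps from
   star-shaped sets (star_lift): exp through f, psi' through the square.  For
   Fourier series, Chernoff's proof of pointwise convergence (fourier_pointwise) and the
   geometric decay of the coefficients of a function holomorphic on a strip
   (coef_geometric) make Parseval's formula elementary. *)

(** * The complex modulus *)

Section ComplexNorm.
Context {R : realType}.
Implicit Types (x y z : R[i]) (r : R).

(** The norm of R[i] takes its values in R[i]; the estimates are real, so they
   are stated with normc. *)
Lemma normcE z : `|z| = (normc z)%:C.
Proof. by case: z. Qed.

Lemma normc_ge0 z : 0 <= normc z.
Proof. by case: z => a b; exact: sqrtr_ge0. Qed.

Lemma ler_normcD x y : normc (x + y) <= normc x + normc y.
Proof. by have := ler_normD x y; rewrite !normcE -rmorphD lecR. Qed.

Lemma normcN z : normc (- z) = normc z.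
Proof. by case: z => a b; rewrite /= !sqrrN. Qed.

Lemma normcB x y : normc (x - y) = normc (y - x).
Proof. by rewrite -opprB normcN. Qed.

Lemma ler_normcB x y : normc (x - y) <= normc x + normc y.
Proof. by rewrite -(normcN y) ler_normcD. Qed.

Lemma ler_dist_normc x y : `|normc x - normc y| <= normc (x - y).
Proof.
rewrite ler_norml; apply/andP; split.
  by rewrite lerNl opprB lerBlDr normcB (le_trans _ (ler_normcD _ _)) ?subrK.
by rewrite lerBlDr (le_trans _ (ler_normcD _ _)) ?subrK.
Qed.

Lemma ler_normc_trans y x z : normc (x - z) <= normc (x - y) + normc (y - z).
Proof. by rewrite (le_trans _ (ler_normcD _ _)) // addrA subrK. Qed.

Lemma normc_eq0 z : (normc z == 0) = (z == 0).
Proof. by apply/eqP/eqP => [/eq0_normc|->] //; rewrite normc0. Qed.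

Lemma normc_gt0 z : (0 < normc z) = (z != 0).
Proof. by rewrite lt_neqAle eq_sym normc_eq0 normc_ge0 andbT. Qed.

Lemma normcR r : normc r%:C = `|r|.
Proof. by rewrite /= expr0n addr0 sqrtr_sqr. Qed.

Lemma normcX z n : normc (z ^+ n) = normc z ^+ n.
Proof. by elim: n => [|n IH]; rewrite ?expr0 ?normc1 // !exprS normcM IH. Qed.

Lemma normc_i : normc ('i : R[i]) = 1.
Proof. by rewrite /= expr0n expr1n add0r sqrtr1. Qed.

Lemma normc_nat n : normc (n%:R : R[i]) = n%:R.
Proof.
have -> : (n%:R : R[i]) = (n%:R)%:C by rewrite rmorph_nat.
by rewrite normcR ger0_norm.
Qed.

Lemma sqr_normc z : normc z ^+ 2 = Re z ^+ 2 + Im z ^+ 2.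
Proof. by case: z => a b; rewrite /= sqr_sqrtr // addr_ge0 ?sqr_ge0. Qed.

Lemma Re_le_normc z : `|Re z| <= normc z.
Proof.
rewrite -[leLHS]sqrtr_sqr; case: z => a b /=.
by apply: ler_wsqrtr; rewrite lerDl sqr_ge0.
Qed.

Lemma Im_le_normc z : `|Im z| <= normc z.
Proof.
rewrite -[leLHS]sqrtr_sqr; case: z => a b /=.
by apply: ler_wsqrtr; rewrite lerDr sqr_ge0.
Qed.

Lemma normc_le_ReIm z : normc z <= `|Re z| + `|Im z|.
Proof.
rewrite -(@ler_pXn2r _ 2) ?nnegrE ?normc_ge0 ?addr_ge0 //.
rewrite sqr_normc sqrrD !real_normK ?num_real // -addrA lerD2l lerDr.
by rewrite mulrn_wge0 // mulr_ge0.
Qed.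

Lemma ler_normc_sum (I : Type) (s : seq I) (P : pred I) (F : I -> R[i]) :
  normc (\sum_(i <- s | P i) F i) <= \sum_(i <- s | P i) normc (F i).
Proof.
elim/big_ind2: _ => [|x1 x2 y1 y2 h1 h2|//]; first by rewrite normc0.
by rewrite (le_trans (ler_normcD _ _)) // lerD.
Qed.

Lemma complex_ReD x y : Re (x + y) = Re x + Re y.
Proof. by case: x; case: y. Qed.
Lemma complex_ImD x y : Im (x + y) = Im x + Im y.
Proof. by case: x; case: y. Qed.
Lemma complex_ReN x : Re (- x) = - Re x.
Proof. by case: x. Qed.
Lemma complex_ImN x : Im (- x) = - Im x.
Proof. by case: x. Qed.
Lemma complex_ReB x y : Re (x - y) = Re x - Re y.
Proof. by rewrite complex_ReD complex_ReN. Qed.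
Lemma complex_ImB x y : Im (x - y) = Im x - Im y.
Proof. by rewrite complex_ImD complex_ImN. Qed.
Lemma complex_ReM x y :
  Re (x * y) = Re x * Re y - Im x * Im y.
Proof. by case: x; case: y. Qed.
Lemma complex_ImM x y :
  Im (x * y) = Re x * Im y + Im x * Re y.
Proof. by case: x; case: y. Qed.

Lemma complexP x y :
  Re x = Re y -> Im x = Im y -> x = y.
Proof. by case: x; case: y => a b c d /= -> ->. Qed.

End ComplexNorm.

(** * Topology of the complex plane *)

Section ComplexTopology.
Context {R : realType}.
Implicit Types (z : R[i]) (A U K : set R[i]).

(** Balls of R[i] have complex radii; a positive complex number is real, so
   real radii define the same neighbourhoods. *)
Lemma nbhs_normcP z A :
  nbhs z A <-> exists2 e : R, 0 < e & forall y, normc (y - z) < e -> A y.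
Proof.
split.
- move=> /nbhs_ballP [e /= e0 zA].
  have eE : e = (Re e)%:C.
    by case: e e0 {zA} => a b; rewrite ltcE /= => /andP[/eqP -> _].
  exists (Re e) => [|y yz].
    by move: e0; rewrite ltcE /= => /andP[].
  by apply: zA; rewrite -ball_normE /= normcE eE ltcR normcB.
- move=> [e e0 zA]; apply/nbhs_ballP; exists e%:C; first by rewrite /= ltcR.
  by move=> y; rewrite -ball_normE /= normcE ltcR normcB => /zA.
Qed.

Lemma open_normcP U :
  open U <-> forall z, U z ->
    exists2 e : R, 0 < e & forall y, normc (y - z) < e -> U y.
Proof.
rewrite openE; split => [h z /h /nbhs_normcP //|h z /h ?].
exact/nbhs_normcP.
Qed.

Lemma cvg_normcP {T : Type} (F : set_system T) {FF : Filter F} (f : T -> R[i]) (l : R[i]) :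
  f @ F --> l <-> forall e : R, 0 < e -> \forall x \near F, normc (f x - l) < e.
Proof.
split=> [fl e e0|h].
- have : nbhs l [set y | normc (y - l) < e] by apply/nbhs_normcP; exists e.
  by move=> /fl.
- move=> A /nbhs_normcP [e e0 eA].
  by apply: filterS (h e e0) => x /eA.
Qed.

Lemma cvg_Re {T : Type} (F : set_system T) {FF : Filter F} (f : T -> R[i]) (l : R[i]) :
  f @ F --> l -> Re (f x) @[x --> F] --> Re l.
Proof.
move=> /cvg_normcP h; apply/cvgrPdist_lt => e /h; apply: filterS => x.
by apply: le_lt_trans; rewrite distrC -complex_ReB Re_le_normc.
Qed.

Lemma cvg_Im {T : Type} (F : set_system T) {FF : Filter F} (f : T -> R[i]) (l : R[i]) :
  f @ F --> l -> Im (f x) @[x --> F] --> Im l.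
Proof.
move=> /cvg_normcP h; apply/cvgrPdist_lt => e /h; apply: filterS => x.
by apply: le_lt_trans; rewrite distrC -complex_ImB Im_le_normc.
Qed.

Lemma cvg_normc {T : Type} (F : set_system T) {FF : Filter F} (f : T -> R[i]) (l : R[i]) :
  f @ F --> l -> normc (f x) @[x --> F] --> normc l.
Proof.
move=> /cvg_normcP h; apply/cvgrPdist_lt => e /h; apply: filterS => x.
by apply: le_lt_trans; rewrite distrC ler_dist_normc.
Qed.

Lemma cvg_complex {T : Type} (F : set_system T) {FF : Filter F} (u v : T -> R)
    (a b : R) :
  u @ F --> a -> v @ F --> b -> (u x +i* v x) @[x --> F] --> (a +i* b : R[i]).
Proof.
move=> /cvgrPdist_lt ua /cvgrPdist_lt vb; apply/cvg_normcP => e e0.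
have e2 : 0 < e / 2 by rewrite divr_gt0.
apply: filterS2 (ua _ e2) (vb _ e2) => x h1 h2.
apply: (le_lt_trans (normc_le_ReIm _)).
by rewrite /= (splitr e) distrC ltrD // distrC.
Qed.

Lemma cvg_ReIm {T : Type} (F : set_system T) {FF : Filter F} (f : T -> R[i]) (l : R[i]) :
  Re (f x) @[x --> F] --> Re l ->
  Im (f x) @[x --> F] --> Im l -> f @ F --> l.
Proof.
move=> h1 h2; have := cvg_complex h1 h2.
have -> : (fun x => Re (f x) +i* Im (f x)) = f.
  by apply/funext => t; case: (f t).
by move: h1 h2; case: l => a b _ _; apply.
Qed.

Lemma cvg_cD {T : Type} (F : set_system T) {FF : Filter F} (f g : T -> R[i]) (a b : R[i]) :
  f @ F --> a -> g @ F --> b -> (fun x => f x + g x) @ F --> a + b.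
Proof. exact: cvgD. Qed.

Lemma cvg_cM {T : Type} (F : set_system T) {FF : Filter F} (f g : T -> R[i]) (a b : R[i]) :
  f @ F --> a -> g @ F --> b -> (fun x => f x * g x) @ F --> a * b.
Proof. exact: cvgM. Qed.

Lemma compact_complex_box (a b c d : R) :
  compact [set z : R[i] | a <= Re z <= b /\ c <= Im z <= d].
Proof.
have := compact_setX (@segment_compact R a b) (@segment_compact R c d).
set B := _ `*` _ => cB.
have -> : [set z : R[i] | a <= Re z <= b /\ c <= Im z <= d] =
    (fun p : R * R => (p.1 +i* p.2 : R[i])) @` B.
  apply/seteqP; split.
    move=> [x y] [/= hx hy]; exists (x, y) => //; split; by rewrite /= in_itv.
  by move=> z [[x y] [h1 h2] <-]; move: h1 h2; rewrite /= !in_itv.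
apply: continuous_compact => //; apply: continuous_subspaceT => p.
by apply: cvg_complex; [exact: cvg_fst|exact: cvg_snd].
Qed.

(** Turns a bound available near each point, at a scale d that may be decreased,
   into one scale for the whole compact set.  It yields moduli of continuity,
   radii of local inverses and derivatives of integrals with a parameter. *)
Lemma compact_uniform (T : topologicalType) (K : set T) (P : T -> R -> Prop) :
  compact K -> (forall x d d', P x d -> 0 < d' -> d' <= d -> P x d') ->
  (forall x, K x -> exists2 d : R, 0 < d & \forall y \near x, K y -> P y d) ->
  exists2 d : R, 0 < d & forall x, K x -> P x d.
Proof.
move=> /compact_near_coveringP cK mono loc.
have [] := cK R (0 : R)^'+ (fun d x => K x -> P x d) _.
- move=> x /loc [d d0 Pd]; near_simpl.
  exists ([set y | K y -> P y d], [set e : R | 0 < e <= d]) => /=.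
    split; first exact: Pd.
    near=> e; apply/andP; split=> //.
    by near: e; apply: nbhs_right_le.
  by move=> [y e] /= [h /andP[e0 ed]] Ky; exact: mono (h Ky) e0 ed.
- move=> /= e e0 h.
  exists (e / 2); first by rewrite divr_gt0.
  move=> x Kx; apply: (h (e / 2)) => //=; last by rewrite divr_gt0.
  rewrite sub0r normrN gtr0_norm ?divr_gt0 //.
  by rewrite ltr_pdivrMr // mulr_natr mulr2n ltrDl.
Unshelve. all: by end_near.
Qed.

End ComplexTopology.

(** * Strict differentiability *)

Section StrictDerivative.
Context {R : realType}.
Implicit Types (x y z a b : R[i]) (f g : R[i] -> R[i]) (U : set R[i]).

(** The neighbourhoods of (z, z), with an explicit radius. *)
Definition near2 z (P : R[i] -> R[i] -> Prop) :=
  exists2 d : R, 0 < d &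
    forall x y, normc (x - z) < d -> normc (y - z) < d -> P x y.

Lemma near2I z P Q : near2 z P -> near2 z Q -> near2 z (fun x y => P x y /\ Q x y).
Proof.
move=> [d d0 hP] [d' d'0 hQ]; exists (Num.min d d'); first by rewrite lt_min d0.
by move=> x y; rewrite !lt_min => /andP[? ?] /andP[? ?]; split; [apply: hP|apply: hQ].
Qed.

Lemma near2W z (P Q : R[i] -> R[i] -> Prop) :
  (forall x y, P x y -> Q x y) -> near2 z P -> near2 z Q.
Proof. by move=> PQ [d d0 h]; exists d => // x y *; apply/PQ/h. Qed.

Lemma near2_near z (P : R[i] -> Prop) :
  (\forall x \near z, P x) -> near2 z (fun x y => P x /\ P y).
Proof.
move=> /nbhs_normcP [d d0 h]; exists d => // x y hx hy; split; exact: h.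
Qed.

(** The strict derivative: increments are compared between two arbitrary points
   near z.  Power series have it, and as soon as it is nonzero f is injective
   and open near z, by an argument at the single point z. *)
Definition sderiv f z a :=
  forall e : R, 0 < e ->
    near2 z (fun x y => normc (f x - f y - a * (x - y)) <= e * normc (x - y)).

Lemma normc_sub0 z : normc (z - z) = 0.
Proof. by rewrite subrr normc0. Qed.

Lemma sderiv_lip f z a : sderiv f z a ->
  near2 z (fun x y => normc (f x - f y) <= (normc a + 1) * normc (x - y)).
Proof.
move=> /(_ 1 ltr01); apply: near2W => x y h.
rewrite -[f x - f y](subrK (a * (x - y))) (le_trans (ler_normcD _ _)) //.
by rewrite mulrDl addrC normcM lerD2l.
Qed.

Lemma lip_gt0 a : 0 < normc a + 1.
Proof. by rewrite ltr_wpDl ?normc_ge0. Qed.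

Lemma sderiv_cvg f z a : sderiv f z a -> f @ nbhs z --> f z.
Proof.
move=> /sderiv_lip [d d0 h]; apply/(cvg_normcP (FF := nbhs_filter z)) => e e0.
apply/nbhs_normcP.
exists (Num.min d (e / (normc a + 1))).
  by rewrite lt_min d0 divr_gt0 ?lip_gt0.
move=> y; rewrite lt_min => /andP[yd ye].
apply: le_lt_trans (h y z yd _) _; first by rewrite normc_sub0.
by rewrite mulrC -ltr_pdivlMr ?lip_gt0.
Qed.

Lemma sderiv_continuous f z a (e : R) : sderiv f z a -> 0 < e ->
  near2 z (fun x y => normc (f x - f z) < e /\ normc (f y - f z) < e).
Proof.
move=> /sderiv_cvg /(cvg_normcP (FF := nbhs_filter z)) h e0.
by apply: (near2_near (P := fun x => normc (f x - f z) < e)); apply: h.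
Qed.

Lemma sderiv_comp f g z a b : sderiv f z a -> sderiv g (f z) b ->
  sderiv (g \o f) z (b * a).
Proof.
move=> fa gb e e0.
pose K := normc a + 1; pose L := normc b + 1.
have e1 : 0 < e / (2 * K) by rewrite divr_gt0 ?mulr_gt0 ?lip_gt0.
have e2 : 0 < e / (2 * L) by rewrite divr_gt0 ?mulr_gt0 ?lip_gt0.
have [d d0 gd] := gb _ e1.
have := near2I (near2I (sderiv_lip fa) (sderiv_continuous fa d0)) (fa _ e2).
apply: near2W => x y [[hK [fx fy]] h] /=.
have -> : g (f x) - g (f y) - b * a * (x - y) =
  (g (f x) - g (f y) - b * (f x - f y)) + b * (f x - f y - a * (x - y)) by ring.
apply: (le_trans (ler_normcD _ _)); rewrite normcM (splitr e) mulrDl lerD //.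
  apply: (le_trans (gd _ _ fx fy)).
  have -> : e / 2 * normc (x - y) = e / (2 * K) * (K * normc (x - y)).
    by field; rewrite gt_eqF ?lip_gt0.
  by rewrite ler_pM2l.
have -> : e / 2 * normc (x - y) = L * (e / (2 * L) * normc (x - y)).
  by field; rewrite gt_eqF ?lip_gt0.
by rewrite ler_pM ?normc_ge0 // lerDl.
Qed.

Lemma sderivM f g z a b : sderiv f z a -> sderiv g z b ->
  sderiv (fun x => f x * g x) z (a * g z + f z * b).
Proof.
move=> fa gb e e0.
pose K := normc a + 1; pose L := normc b + 1.
pose M := normc (g z) + 1; pose N := normc (f z) + 1.
have K0 : 0 < K := lip_gt0 _. have L0 : 0 < L := lip_gt0 _.
have M0 : 0 < M := lip_gt0 _. have N0 : 0 < N := lip_gt0 _.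
have q c : 0 < c -> 0 < e / 4 / c by move=> c0; rewrite !divr_gt0.
have := near2I (near2I (fa _ (q _ M0)) (gb _ (q _ N0)))
  (near2I (near2I (sderiv_continuous fa ltr01) (sderiv_continuous fa (q _ L0)))
          (near2I (sderiv_continuous gb ltr01) (sderiv_continuous gb (q _ K0)))).
apply: near2W => x y [[h1 h2] [[[_ fy] [_ fy']] [[gx _] [gx' _]]]] /=.
have -> : f x * g x - f y * g y - (a * g z + f z * b) * (x - y) =
  (f x - f y - a * (x - y)) * g x + a * (x - y) * (g x - g z)
  + (g x - g y - b * (x - y)) * f y + b * (x - y) * (f y - f z) by ring.
have bd u v c : 0 < c -> normc u <= e / 4 / c * normc (x - y) -> normc v <= c ->
    normc (u * v) <= e / 4 * normc (x - y).
  move=> c0 hu hv; rewrite normcM.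
  have -> : e / 4 * normc (x - y) = e / 4 / c * normc (x - y) * c.
    by field; rewrite gt_eqF.
  by rewrite ler_pM ?normc_ge0.
have bd' u v c : 0 < c -> normc u + 1 = c -> normc v < e / 4 / c ->
    normc (u * (x - y) * v) <= e / 4 * normc (x - y).
  move=> c0 hu hv; rewrite !normcM.
  have -> : e / 4 * normc (x - y) = c * normc (x - y) * (e / 4 / c).
    by field; rewrite gt_eqF.
  rewrite ler_pM ?mulr_ge0 ?normc_ge0 ?ler_wpM2r ?normc_ge0 //; last exact: ltW.
  by rewrite -hu lerDl.
have nb (h : R[i] -> R[i]) u : normc (h u - h z) < 1 -> normc (h u) <= normc (h z) + 1.
  move=> hu; rewrite -[h u](subrK (h z)) (le_trans (ler_normcD _ _)) //.
  by rewrite addrC lerD2l ltW.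
have -> : e * normc (x - y) = e / 4 * normc (x - y) + e / 4 * normc (x - y)
    + e / 4 * normc (x - y) + e / 4 * normc (x - y) by field.
rewrite (le_trans (ler_normcD _ _)) // lerD ?(bd' _ _ _ L0) //.
rewrite (le_trans (ler_normcD _ _)) // lerD ?(bd _ _ _ N0) ?nb //.
rewrite (le_trans (ler_normcD _ _)) // lerD ?(bd' _ _ _ K0) //.
by rewrite (bd _ _ _ M0) ?nb.
Qed.

Lemma sderivV z : z != 0 -> sderiv (fun x => x^-1) z (- z ^- 2).
Proof.
move=> z0 e e0; have nz : 0 < normc z by rewrite normc_gt0.
pose N := normc z.
(* within N / 2 of z all moduli exceed N / 2; the second radius keeps the
   numerator below e * N ^+ 4 / 4 *)
exists (Num.min (N / 2) (e * N ^+ 3 / 10)).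
  rewrite lt_min divr_gt0 //= -/N. by rewrite divr_gt0 // mulr_gt0 // exprn_gt0.
have lb u : normc (u - z) < N / 2 -> N / 2 <= normc u.
  move=> hu; have := ler_dist_normc u z; rewrite ler_norml => /andP[h _].
  by move: h; rewrite -/N => h; lra.
move=> x y; rewrite !lt_min => /andP[xz xz'] /andP[yz yz'].
have x2 := lb x xz; have y2 := lb y yz.
have N0 : 0 < N by [].
have x0 : x != 0 by rewrite -normc_gt0 (lt_le_trans _ x2) // divr_gt0.
have y0 : y != 0 by rewrite -normc_gt0 (lt_le_trans _ y2) // divr_gt0.
have -> : x^-1 - y^-1 - - z ^- 2 * (x - y) =
   (z * (y - z) + (x - z) * y) * (x - y) / (z ^+ 2 * x * y).
  by field; rewrite x0 y0 z0.
have h1 : normc (z * (y - z) + (x - z) * y) <= e * N ^+ 4 / 4.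
  apply: (le_trans (ler_normcD _ _)); rewrite !normcM -/N.
  have yN : normc y <= 3 / 2 * N.
    rewrite -[y](subrK z) (le_trans (ler_normcD _ _)) // -/N.
    have -> : 3 / 2 * N = N / 2 + N by field.
    by rewrite lerD2r ltW.
  have -> : e * N ^+ 4 / 4 = N * (e * N ^+ 3 / 10) + (e * N ^+ 3 / 10) * (3 / 2 * N).
    by field.
  by rewrite lerD // ler_pM ?normc_ge0 // ltW.
have h2 : N ^+ 4 / 4 <= normc (z ^+ 2 * x * y).
  rewrite normcM [normc (_ * x)]normcM normcX -/N.
  have -> : N ^+ 4 / 4 = N ^+ 2 * (N / 2) * (N / 2) by field.
  have N2 : 0 <= N / 2 by rewrite divr_ge0 // ltW.
  have N22 : 0 <= N ^+ 2 by rewrite exprn_ge0 // ltW.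
  by apply: ler_pM => //; [exact: mulr_ge0|exact: ler_pM].
rewrite normcM normcV normcM mulrAC ler_wpM2r ?normc_ge0 //.
have N4 : 0 < N ^+ 4 / 4 by rewrite divr_gt0 // exprn_gt0.
rewrite ler_pdivrMr; last exact: lt_le_trans h2.
apply: (le_trans h1); rewrite -mulrA ler_wpM2l //; exact: ltW.
Qed.

End StrictDerivative.

(** * Derivatives along paths *)

Section Derivatives.
Context {R : realType}.
Implicit Types (z a b : R[i]) (f : R[i] -> R[i]) (U : set R[i]).

Lemma ball_other_point z (d : R) : 0 < d -> exists2 x, x != z & normc (x - z) < d.
Proof.
move=> d0; have d2 : 0 < d / 2 by rewrite divr_gt0.
have e : z + (d / 2)%:C - z = (d / 2)%:C by ring.
exists (z + (d / 2)%:C); last first.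
  by rewrite e normcR gtr0_norm // ltr_pdivrMr // ltr_pMr // ltr1n.
by rewrite -subr_eq0 e -normc_gt0 normcR gtr0_norm.
Qed.

Lemma sderiv_derive1 f z a : sderiv f z a -> derive1 f z = a.
Proof.
move=> fa; apply: cvg_lim; first exact: norm_hausdorff.
apply/(cvg_normcP (FF := dnbhs_filter _)) => e e0.
have [d d0 h] := fa _ (divr_gt0 e0 (ltr0n _ 2)).
apply/nbhs_normcP; exists d => // x; rewrite subr0 => xd xn0 /=.
have := h (x + z) z; rewrite addrK normc_sub0 => /(_ xd d0) hx.
have nx : 0 < normc x by rewrite normc_gt0.
have -> : x^-1 *: (f (x + z) - f z) - a = x^-1 * (f (x + z) - f z - a * x).
  by rewrite mulrBr mulrCA mulVf // mulr1.
rewrite normcM normcV mulrC ltr_pdivrMr //.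
by apply: (le_lt_trans hx); rewrite ltr_pM2r // ltr_pdivrMr // ltr_pMr // ltr1n.
Qed.

(** A pair of points close to both y and z compares the two derivatives, since
   both expansions are strict. *)
Lemma sderiv_continuous_derivative f f1 z a :
  (\forall y \near z, sderiv f y (f1 y)) -> sderiv f z a -> f1 @ nbhs z --> a.
Proof.
move=> nf fa; apply/(cvg_normcP (FF := nbhs_filter z)) => e e0.
have e3 : 0 < e / 3 by rewrite divr_gt0.
have [d d0 h] := fa _ e3.
move: nf => /nbhs_normcP[d' d'0 h'].
apply/nbhs_normcP; exists (Num.min d d'); first by rewrite lt_min d0.
move=> y; rewrite lt_min => /andP[yd yd'].
have [r r0 hr] := h' y yd' _ e3.
have dm : 0 < Num.min r (d - normc (y - z)) by rewrite lt_min r0 subr_gt0 yd.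
have [x xy] := ball_other_point y dm.
rewrite lt_min => /andP[xr xd].
have xz : normc (x - z) < d.
  by rewrite (le_lt_trans (ler_normc_trans y _ _)) // -ltrBrDr.
have nxy : 0 < normc (x - y) by rewrite normc_gt0 subr_eq0.
have h1 := h x y xz yd.
have h2 : normc (f x - f y - f1 y * (x - y)) <= e / 3 * normc (x - y).
  by apply: hr => //; rewrite normc_sub0.
rewrite -(ltr_pM2r nxy) -normcM.
have -> : (f1 y - a) * (x - y) =
   (f x - f y - a * (x - y)) - (f x - f y - f1 y * (x - y)) by ring.
apply: (le_lt_trans (ler_normcB _ _)).
by apply: (le_lt_trans (lerD h1 h2)); rewrite -mulrDl ltr_pM2r //; lra.
Qed.

(** The derivative of a path in the plane, in the same epsilon form as sderiv,
   so that the chain rule between the two is a computation. *)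
Definition pderiv (g : R -> R[i]) (s : R) (v : R[i]) :=
  forall e : R, 0 < e -> exists2 d : R, 0 < d &
    forall x, `|x - s| < d -> normc (g x - g s - v * (x - s)%:C) <= e * `|x - s|.

Lemma is_derive_epsP (f : R -> R) (s v : R) :
  is_derive s 1 f v <->
  forall e : R, 0 < e -> exists2 d : R, 0 < d &
    forall x, `|x - s| < d -> `|f x - f s - v * (x - s)| <= e * `|x - s|.
Proof.
split.
- move=> [fs fv] e e0.
  have : (fun h => h^-1 *: (f (h + s) - f s)) @ 0^' --> v.
    have -> : (fun h => h^-1 *: (f (h + s) - f s)) =
        (fun h => h^-1 *: (f (h *: (1 : R) + s) - f s)).
      by apply/funext => h; rewrite scaler1.
    by rewrite -fv; exact: fs.
  move=> /cvgrPdist_lt /(_ _ e0); rewrite near_withinE => /nbhs_ballP[d /= d0 h].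
  exists d => // x xd; have [->|xs] := eqVneq x s.
    by rewrite !subrr mulr0 subrr normr0 mulr0.
  have xs0 : x - s != 0 by rewrite subr_eq0.
  have := h (x - s); rewrite /ball /= sub0r normrN => /(_ xd xs0) /ltW.
  rewrite subrK => hh; rewrite -ler_pdivrMr ?normr_gt0 // -normfV -normrM.
  rewrite mulrBl mulfK // distrC; apply: le_trans hh.
  by rewrite /GRing.scale /= [_^-1 * _]mulrC.
- move=> h.
  have : (fun h => h^-1 *: (f (h *: 1 + s) - f s)) @ 0^' --> v.
    apply/cvgrPdist_le => e /h[d d0 hd]; rewrite near_withinE.
    apply/nbhs_ballP; exists d => // x; rewrite /ball /= sub0r normrN => xd x0.
    have := hd (x + s); rewrite addrK => /(_ xd).
    rewrite scaler1 -ler_pdivrMr ?normr_gt0 // -normfV -normrM.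
    rewrite mulrBl mulfK // distrC; apply: le_trans.
    by rewrite /GRing.scale /= [_^-1 * _]mulrC.
  move=> c; split; first by apply/cvg_ex; exists v.
  exact: (cvg_lim _ c).
Qed.

Lemma pderivP (g : R -> R[i]) (s : R) (v : R[i]) :
  pderiv g s v <-> is_derive s 1 (fun x => Re (g x)) (Re v) /\
                   is_derive s 1 (fun x => Im (g x)) (Im v).
Proof.
have eR x : Re (g x) - Re (g s) - Re v * (x - s) =
    Re (g x - g s - v * (x - s)%:C).
  by rewrite !complex_ReB complex_ReM /= mulr0 subr0.
have eI x : Im (g x) - Im (g s) - Im v * (x - s) =
    Im (g x - g s - v * (x - s)%:C).
  by rewrite !complex_ImB complex_ImM /= mulr0 add0r.
split.
- move=> h; split; apply/is_derive_epsP => e /h[d d0 hd]; exists d => // x xd.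
  + by rewrite eR (le_trans (Re_le_normc _)) ?hd.
  + by rewrite eI (le_trans (Im_le_normc _)) ?hd.
- move=> [/is_derive_epsP h1 /is_derive_epsP h2] e e0.
  have e2 : 0 < e / 2 by rewrite divr_gt0.
  have [d d0 hd] := h1 _ e2; have [d' d'0 hd'] := h2 _ e2.
  exists (Num.min d d'); first by rewrite lt_min d0.
  move=> x; rewrite lt_min => /andP[xd xd'].
  apply: (le_trans (normc_le_ReIm _)); rewrite -eR -eI (splitr e) mulrDl.
  by rewrite lerD ?hd ?hd'.
Qed.

Lemma pderiv_comp_sderiv f (g : R -> R[i]) (s : R) a v :
  sderiv f (g s) a -> pderiv g s v -> pderiv (f \o g) s (a * v).
Proof.
move=> fa gv e e0.
pose L := normc a + 1; pose K := normc v + 1.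
have L0 : 0 < L := lip_gt0 _; have K0 : 0 < K := lip_gt0 _.
have [d d0 hd] := fa _ (divr_gt0 e0 (mulr_gt0 (ltr0n _ 2) K0)).
have [d1 d10 h1] := gv _ (divr_gt0 e0 (mulr_gt0 (ltr0n _ 2) L0)).
have [d2 d20 h2] := gv 1 ltr01.
exists (Num.min d1 (Num.min d2 (d / K))).
  by rewrite !lt_min d10 d20 divr_gt0.
move=> x; rewrite !lt_min => /and3P[x1 x2 x3].
have hK : normc (g x - g s) <= K * `|x - s|.
  rewrite -[g x - g s](subrK (v * (x - s)%:C)) (le_trans (ler_normcD _ _)) //.
  by rewrite mulrDl addrC normcM normcR lerD2l h2.
have gd : normc (g x - g s) < d.
  by rewrite (le_lt_trans hK) // mulrC -ltr_pdivlMr.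
have h3 := hd (g x) (g s) gd; rewrite normc_sub0 in h3; have {}h3 := h3 d0.
rewrite /=.
have -> : f (g x) - f (g s) - a * v * (x - s)%:C =
  (f (g x) - f (g s) - a * (g x - g s)) + a * (g x - g s - v * (x - s)%:C) by ring.
apply: (le_trans (ler_normcD _ _)); rewrite normcM (splitr e) mulrDl lerD //.
  apply: (le_trans h3).
  have -> : e / 2 * `|x - s| = e / (2 * K) * (K * `|x - s|).
    by field; rewrite gt_eqF.
  by rewrite ler_pM2l ?divr_gt0 ?mulr_gt0.
have -> : e / 2 * `|x - s| = L * (e / (2 * L) * `|x - s|).
  by field; rewrite gt_eqF.
by rewrite ler_pM ?normc_ge0 ?h1 // lerDl.
Qed.

Lemma pderiv_line (p q : R[i]) (s : R) : pderiv (fun x => p + x%:C * q) s q.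
Proof.
move=> e e0; exists 1 => // x _.
have -> : p + x%:C * q - (p + s%:C * q) - q * (x - s)%:C = 0.
  by rewrite rmorphB /=; ring.
by rewrite normc0 mulr_ge0 // ltW.
Qed.

Lemma pderiv_comp (g : R -> R[i]) (u : R -> R) (s u' : R) v :
  pderiv g (u s) v -> is_derive s 1 u u' -> pderiv (g \o u) s (v * u'%:C).
Proof.
move=> /pderivP[h1 h2] hu; apply/pderivP; split.
  rewrite complex_ReM /= mulr0 subr0; exact: (is_derive1_comp h1 hu).
rewrite complex_ImM /= mulr0 add0r; exact: (is_derive1_comp h2 hu).
Qed.

Lemma pderiv_continuous (g : R -> R[i]) (s : R) v : pderiv g s v ->
  g @ nbhs s --> g s.
Proof.
move=> /pderivP[h1 h2].
apply: cvg_ReIm; apply: differentiable_continuous; apply/derivable1_diffP;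
  exact: ex_derive.
Qed.

Lemma is_derive0_cst (u : R -> R) (a b : R) : a <= b ->
  (forall s, a <= s <= b -> is_derive s 1 u 0) -> u a = u b.
Proof.
move=> ab hu; have [x| |c _] := @MVT_segment R u (fun=> 0) a b ab _ _.
- by rewrite in_itv /= => /andP[xa xb]; apply: hu; rewrite !ltW.
- apply/subspace_continuousP => x /=; rewrite in_itv /= => /hu hx.
  apply: cvg_within_filter.
  have /derivable1_diffP dx := @ex_derive _ _ _ _ _ _ _ hx.
  exact: (differentiable_continuous dx).
- by rewrite mul0r => /eqP; rewrite subr_eq0 => /eqP.
Qed.

Lemma pderiv0_cst (g : R -> R[i]) (a b : R) : a <= b ->
  (forall s, a <= s <= b -> pderiv g s 0) -> g a = g b.
Proof.
move=> ab h; apply: complexP.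
- by apply: (@is_derive0_cst (fun x => Re (g x)) _ _ ab) => s /h /pderivP[].
- by apply: (@is_derive0_cst (fun x => Im (g x)) _ _ ab) => s /h /pderivP[].
Qed.

End Derivatives.

(** * Strict differentiability of power series *)

Section PowerSeries.
Context {R : realType}.
Implicit Types (x y z : R[i]) (f : R[i] -> R[i]).

Lemma cvg_le_bound (T : Type) (F : set_system T) {FF : ProperFilter F}
    (u : T -> R) (l M : R) : u @ F --> l -> (forall n, u n <= M) -> l <= M.
Proof.
move=> ul uM; rewrite leNgt; apply/negP => Ml.
have d0 : 0 < l - M by rewrite subr_gt0.
move/cvgrPdist_lt: ul => /(_ _ d0) /filter_ex[n].
by rewrite ltr_norml => /andP[_]; rewrite ltrD2l ltrN2 ltNge uM.
Qed.

Lemma sum_half_pow_le N : \sum_(0 <= k < N) (2^-1 : R) ^+ k <= 2.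
Proof.
suff -> : \sum_(0 <= k < N) (2^-1 : R) ^+ k = 2 - 2 * 2^-1 ^+ N.
  by rewrite gerBl mulr_ge0 ?exprn_ge0 // invr_ge0.
elim: N => [|N IH]; first by rewrite big_geq // expr0 mulr1 subrr.
by rewrite big_nat_recr //= IH exprS; field.
Qed.

Lemma abs_cvg_series_half (u : nat -> R[i]) (B : R) :
  (forall n, normc (u n) <= B * 2^-1 ^+ n) ->
  exists l : R[i], [series u n]_n @ \oo --> l.
Proof.
move=> uB.
have key (v : nat -> R) : (forall n, `|v n| <= B * 2^-1 ^+ n) ->
    exists l : R, [series v n]_n @ \oo --> l.
  move=> vB; have : cvgn [normed series v]; last first.
    by move=> /normed_cvg h; exists (limn (series v)).
  apply: (@series_le_cvg R _ (geometric B 2^-1)) => [n|n|n|] /=; rewrite ?(le_trans _ (vB n)) //.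
  by apply: is_cvg_geometric_series; rewrite ger0_norm ?invr_ge0 // invf_lt1 ?ltr1n.
have [lr hr] := key (fun n => Re (u n)) (fun n => le_trans (Re_le_normc _) (uB n)).
have [li hi] := key (fun n => Im (u n)) (fun n => le_trans (Im_le_normc _) (uB n)).
exists (lr +i* li); apply: cvg_ReIm => /=.
  rewrite [X in X @ _](_ : _ = [series Re (u n)]_n) //.
  apply/funext => n; rewrite /series /=.
  by elim/big_rec2: _ => // k a b _ <-; rewrite complex_ReD.
rewrite [X in X @ _](_ : _ = [series Im (u n)]_n) //.
apply/funext => n; rewrite /series /=.
by elim/big_rec2: _ => // k a b _ <-; rewrite complex_ImD.
Qed.

(** The estimate behind termwise differentiation: summed against the
   coefficients, it bounds the defect of strict differentiability of the series.
   The factor p ^+ 2 stands for the exponent n - 2 of a second derivative. *)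
Lemma monomial_strict_bound (p D : R) x y z n : 0 <= p ->
  normc x <= p -> normc y <= p -> normc z <= p ->
  normc (x - z) <= D -> normc (y - z) <= D ->
  p ^+ 2 * normc (x ^+ n - y ^+ n - n%:R * z ^+ n.-1 * (x - y)) <=
  n%:R ^+ 2 * p ^+ n * D * normc (x - y).
Proof.
move=> p0 xp yp zp xD yD.
have D0 : 0 <= D by rewrite (le_trans _ xD) ?normc_ge0.
have zX k : normc (z ^+ k) <= p ^+ k by rewrite normcX lerXn2r ?nnegrE ?normc_ge0.
have yX k : normc (y ^+ k) <= p ^+ k by rewrite normcX lerXn2r ?nnegrE ?normc_ge0.
have nz k : p * normc (k%:R * z ^+ k.-1) <= k%:R * p ^+ k.
  case: k => [|k]; first by rewrite !mul0r normc0 mulr0.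
  by rewrite normcM normc_nat mulrCA ler_wpM2l // exprS ler_wpM2l.
have yz k : p * normc (y ^+ k - z ^+ k) <= k%:R * p ^+ k * D.
  elim: k => [|k IH]; first by rewrite !expr0 subrr normc0 mulr0 !mul0r.
  have -> : y ^+ k.+1 - z ^+ k.+1 = y * (y ^+ k - z ^+ k) + (y - z) * z ^+ k.
    by rewrite !exprS; ring.
  apply: (le_trans (ler_wpM2l p0 (ler_normcD _ _))); rewrite mulrDr !normcM.
  have -> : k.+1%:R * p ^+ k.+1 * D = p * (k%:R * p ^+ k * D) + p * (D * p ^+ k).
    by rewrite -natr1 (exprS p k); ring.
  apply: lerD.
    rewrite mulrCA; apply: ler_pM => //; first exact: normc_ge0.
    by rewrite mulr_ge0 ?normc_ge0.
  by rewrite ler_wpM2l // ler_pM ?normc_ge0.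
elim: n => [|n IH].
  by rewrite !expr0 !mul0r subrr subr0 normc0 mulr0 expr2 !mul0r.
have -> : x ^+ n.+1 - y ^+ n.+1 - n.+1%:R * z ^+ n.+1.-1 * (x - y) =
  x * (x ^+ n - y ^+ n - n%:R * z ^+ n.-1 * (x - y)) +
  n%:R * z ^+ n.-1 * (x - z) * (x - y) + (y ^+ n - z ^+ n) * (x - y).
  case: n {IH} => [|n] /=; first by rewrite !expr0 !expr1; ring.
  by rewrite -!natr1 !exprS; ring.
set N := normc (x - y).
have N0 : 0 <= N by rewrite normc_ge0.
have nn : 0 <= n%:R * p ^+ n by rewrite mulr_ge0 ?exprn_ge0.
have h1 : p ^+ 2 * normc (x * (x ^+ n - y ^+ n - n%:R * z ^+ n.-1 * (x - y))) <=
    p * (n%:R ^+ 2 * p ^+ n * D * N).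
  by rewrite normcM mulrCA ler_pM ?normc_ge0 ?mulr_ge0 ?sqr_ge0 ?normc_ge0.
have h2 : p ^+ 2 * normc (n%:R * z ^+ n.-1 * (x - z) * (x - y)) <=
    p * (n%:R * p ^+ n * D * N).
  rewrite expr2 -mulrA ler_wpM2l // [normc (_ * (x - y))]normcM normcM.
  by rewrite !mulrA ler_wpM2r // ler_pM ?mulr_ge0 ?normc_ge0.
have h3 : p ^+ 2 * normc ((y ^+ n - z ^+ n) * (x - y)) <=
    p * (n%:R * p ^+ n * D * N).
  by rewrite expr2 -mulrA ler_wpM2l // normcM !mulrA ler_wpM2r.
have p2 : 0 <= p ^+ 2 by rewrite sqr_ge0.
apply: (le_trans (ler_wpM2l p2 (ler_normcD _ _))); rewrite mulrDr.
apply: (le_trans (lerD (ler_wpM2l p2 (ler_normcD _ _)) (lexx _))); rewrite mulrDr.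
apply: (le_trans (lerD (lerD h1 h2) h3)).
have -> : n.+1%:R ^+ 2 * p ^+ n.+1 * D * N =
   p * (n%:R ^+ 2 * p ^+ n * D * N) + p * (n%:R * p ^+ n * D * N) +
   p * (n%:R * p ^+ n * D * N) + p * (p ^+ n * D * N).
  by rewrite -natr1 (exprS p n); ring.
by rewrite lerDl !mulr_ge0 ?exprn_ge0.
Qed.

Lemma sq_le_4pow n : n%:R ^+ 2 <= 4 ^+ n :> R.
Proof.
have -> : 4 ^+ n = (2 ^+ n) ^+ 2 :> R.
  by rewrite -exprM mulnC exprM expr2 -natrM.
rewrite lerXn2r ?nnegrE ?ler0n ?exprn_ge0 //.
by rewrite -natrX ler_nat ltnW // ltn_expl.
Qed.

(** The terms of a convergent series tend to 0, and the finitely many early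
   ones are bounded by their sum. *)
Lemma power_series_bound (c : nat -> R[i]) (r : R) (l : R[i]) : 0 < r ->
  [series c n * r%:C ^+ n]_n @ \oo --> l ->
  exists2 B : R, 0 < B & forall n, normc (c n) * r ^+ n <= B.
Proof.
move=> r0 /cvgP /cvg_series_cvg_0 /cvg_normcP /(_ 1 ltr01).
move=> [N _ hN]; pose t n := normc (c n) * r ^+ n.
have t0 n : 0 <= t n by rewrite mulr_ge0 ?normc_ge0 ?exprn_ge0 ?ltW.
exists (1 + \sum_(0 <= k < N) t k).
  by rewrite ltr_pwDl // sumr_ge0.
move=> n; have [Nn|nN] := leqP N n.
  have := hN n Nn; rewrite /= subr0 normcM normcX normcR gtr0_norm // => /ltW h.
  by rewrite (le_trans h) // lerDl sumr_ge0.
rewrite -/(t n) (le_trans (y := \sum_(0 <= k < N) t k)) ?lerDr //.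
by rewrite big_mkord (bigD1 (Ordinal nN)) //= lerDl sumr_ge0.
Qed.

(** Both conclusions come from monomial_strict_bound, summed on a smaller disc.
   Analyticity of the derivative makes the lemma applicable to it in turn. *)
Lemma analytic_sderiv f z0 : analytic_at f z0 ->
  exists2 f1, analytic_at f1 z0 & \forall z \near z0, sderiv f z (f1 z).
Proof.
move=> [c /nbhs_normcP[r1 r10 hc]].
pose r := r1 / 2; have r0 : 0 < r by rewrite divr_gt0.
have [B B0 hB] : exists2 B : R, 0 < B & forall n, normc (c n) * r ^+ n <= B.
  have := hc (z0 + r%:C); rewrite addrAC subrr add0r normcR gtr0_norm //.
  have rr1 : r < r1 by rewrite ltr_pdivrMr // ltr_pMr // ltr1n.
  by move=> /(_ rr1) /(power_series_bound r0).
(* 8 ^+ n is the product of 4 ^+ n, which absorbs n%:R ^+ 2, and of 2 ^+ n,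
   which leaves a geometric series *)
pose p := r / 8; have p0 : 0 < p by rewrite divr_gt0.
have pr n : p ^+ n = r ^+ n * 4^-1 ^+ n * 2^-1 ^+ n.
  by rewrite -!exprMn /p; congr (_ ^+ _); field.
have cn2 n : normc (c n) * (n%:R ^+ 2 * p ^+ n) <= B * 2^-1 ^+ n.
  have -> : normc (c n) * (n%:R ^+ 2 * p ^+ n) =
      (normc (c n) * r ^+ n) * (n%:R ^+ 2 * 4^-1 ^+ n) * 2^-1 ^+ n.
    by rewrite pr; ring.
  rewrite ler_wpM2r ?exprn_ge0 ?invr_ge0 //.
  rewrite -[leRHS]mulr1; apply: ler_pM => //.
    by rewrite mulr_ge0 ?normc_ge0 ?exprn_ge0 ?ltW.
  by rewrite exprVn ler_pdivrMr ?exprn_gt0 // mul1r sq_le_4pow.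
pose c' n := n.+1%:R * c n.+1.
have hc' z : normc z <= p -> forall n, normc (c' n * z ^+ n) <= (B / p) * 2^-1 ^+ n.
  move=> zp n; have zX : normc (z ^+ n) <= p ^+ n.
    by rewrite normcX lerXn2r ?nnegrE ?normc_ge0 // ltW.
  rewrite [leRHS]mulrAC ler_pdivlMr // !normcM normc_nat.
  have h := cn2 n.+1.
  apply: (@le_trans _ _ (normc (c n.+1) * (n.+1%:R ^+ 2 * p ^+ n.+1))).
    have -> : normc (c n.+1) * (n.+1%:R ^+ 2 * p ^+ n.+1) =
       (n.+1%:R * (n.+1%:R * normc (c n.+1)) * p ^+ n) * p.
      by rewrite (exprS p n); ring.
    rewrite ler_wpM2r ?(ltW p0) // ler_pM ?mulr_ge0 ?normc_ge0 //.
    by rewrite ler_peMl ?mulr_ge0 ?normc_ge0 // ler1n.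
  apply: (le_trans h); rewrite ler_wpM2l ?(ltW B0) //.
  by rewrite exprS ler_piMl ?exprn_ge0 ?invr_ge0 // invf_le1 // ler1n.
have /choice[f1 hf1] : forall z, exists l : R[i], normc (z - z0) <= p ->
    [series c' n * (z - z0) ^+ n]_n @ \oo --> l.
  move=> z; have [zp|_] := leP (normc (z - z0)) p; last by exists 0.
  by have [l hl] := abs_cvg_series_half (hc' _ zp); exists l.
exists f1.
  exists c'; apply/nbhs_normcP; exists p => // z /ltW; exact: hf1.
pose K := 2 * B / p ^+ 2.
have K0 : 0 < K by rewrite divr_gt0 ?exprn_gt0 ?mulr_gt0.
have pr1 : p < r1 by rewrite /p /r; lra.
have main x y z D : normc (x - z0) < p -> normc (y - z0) < p -> normc (z - z0) < p ->
    normc (x - z) <= D -> normc (y - z) <= D ->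
    normc (f x - f y - f1 z * (x - y)) <= K * D * normc (x - y).
  move=> xp yp zp xD yD.
  have hx := hc x (lt_trans xp pr1); have hy := hc y (lt_trans yp pr1).
  have hz := hf1 z (ltW zp).
  rewrite -cvg_shiftS in hx; rewrite -cvg_shiftS in hy.
  have D0 : 0 <= D by rewrite (le_trans _ xD) ?normc_ge0.
  apply: (@cvg_le_bound nat \oo _ (fun N => normc (
      [series c n * (x - z0) ^+ n]_n N.+1 - [series c n * (y - z0) ^+ n]_n N.+1 -
      [series c' n * (z - z0) ^+ n]_n N * (x - y)))) => [|N].
    apply: cvg_normc; apply: cvgB; first exact: cvgB hx hy.
    by apply: cvgM hz _; exact: cvg_cst.
  rewrite /series /=.
  have -> : \sum_(0 <= k < N.+1) c k * (x - z0) ^+ k -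
      \sum_(0 <= k < N.+1) c k * (y - z0) ^+ k -
      (\sum_(0 <= k < N) c' k * (z - z0) ^+ k) * (x - y) =
     \sum_(0 <= k < N.+1) c k * ((x - z0) ^+ k - (y - z0) ^+ k -
         k%:R * (z - z0) ^+ k.-1 * ((x - z0) - (y - z0))).
    have cancel (a A A' C : R[i]) : a + A - (a + A') - C = A - A' - C by ring.
    rewrite mulr_suml !big_nat_recl // cancel -!sumrB.
    rewrite [X in _ = X + _](_ : _ = 0); last by rewrite !expr0; ring.
    by rewrite add0r; apply: eq_bigr => k _; rewrite /c' /=; ring.
  apply: (le_trans (ler_normc_sum _ _ _)).
  have -> : K * D * normc (x - y) = (B * 2) * (D * normc (x - y) / p ^+ 2).
    by rewrite /K; ring.
  rewrite (le_trans (y := \sum_(0 <= k < N.+1)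
     (B * 2^-1 ^+ k) * (D * normc (x - y) / p ^+ 2))) //; last first.
    rewrite -mulr_suml; apply: ler_wpM2r.
      apply: divr_ge0; last exact: exprn_ge0 (ltW p0).
      by apply: mulr_ge0 => //; exact: normc_ge0.
    by rewrite -mulr_sumr; apply: ler_wpM2l (sum_half_pow_le _); exact: ltW.
  apply: ler_sum => k _; rewrite normcM.
  have e : (x - y) = (x - z0) - (y - z0) by ring.
  have := @monomial_strict_bound p D (x - z0) (y - z0) (z - z0) k (ltW p0)
     (ltW xp) (ltW yp) (ltW zp).
  have -> : x - z0 - (z - z0) = x - z by ring.
  have -> : y - z0 - (z - z0) = y - z by ring.
  move=> /(_ xD yD); rewrite -e; set X := normc _; set N' := normc (x - y) => h.
  have p20 : 0 < p ^+ 2 by rewrite exprn_gt0.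
  rewrite -(ler_pM2l p20).
  have -> : p ^+ 2 * (B * 2^-1 ^+ k * (D * N' / p ^+ 2)) = B * 2^-1 ^+ k * (D * N').
    by field; rewrite gt_eqF.
  rewrite mulrCA; apply: (le_trans (ler_wpM2l (normc_ge0 _) h)).
  have -> : normc (c k) * (k%:R ^+ 2 * p ^+ k * D * N') =
     normc (c k) * (k%:R ^+ 2 * p ^+ k) * (D * N') by ring.
  by apply: ler_wpM2r (cn2 k); rewrite mulr_ge0 ?normc_ge0.
apply/nbhs_normcP; exists p => // z zp e e0.
exists (Num.min (p - normc (z - z0)) (e / K)).
  by rewrite lt_min subr_gt0 zp divr_gt0.
move=> x y; rewrite !lt_min => /andP[xp xe] /andP[yp ye].
apply: (le_trans (main x y z (e / K) _ _ zp (ltW xe) (ltW ye))).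
- by rewrite (le_lt_trans (ler_normc_trans z _ _)) // -ltrBrDr.
- by rewrite (le_lt_trans (ler_normc_trans z _ _)) // -ltrBrDr.
- by rewrite mulrCA divff ?gt_eqF // mulr1.
Qed.

End PowerSeries.

(** * Local inverses and uniform coverings *)

Section LocalInverse.
Context {R : realType}.
Implicit Types (x y z a zeta : R[i]) (F G : R[i] -> R[i]) (U X S K J Q : set R[i]).

(** Surjectivity half of the inverse function theorem.  A minimiser of
   |F - zeta| on a box lies within eta of z, since F expands distances, and there
   a fraction of the Newton step decreases |F - zeta| unless it vanishes. *)
Lemma strict_surjective F z a (rho eta : R) zeta : a != 0 ->
  (forall x y, normc (x - z) < rho -> normc (y - z) < rho ->
     normc (F x - F y - a * (x - y)) <= normc a / 2 * normc (x - y)) ->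
  0 < eta -> 2 * eta < rho -> normc (zeta - F z) < normc a / 4 * eta ->
  exists2 y, normc (y - z) < eta & F y = zeta.
Proof.
move=> a0 hF e0 er hz.
have na : 0 < normc a by rewrite normc_gt0.
have expand x y : normc (x - z) < rho -> normc (y - z) < rho ->
    normc a / 2 * normc (x - y) <= normc (F x - F y).
  move=> xr yr; have h := hF x y xr yr.
  have : normc (a * (x - y)) <= normc (F x - F y) + normc (F x - F y - a * (x - y)).
    have {1}-> : a * (x - y) = F x - F y - (F x - F y - a * (x - y)) by ring.
    exact: ler_normcB.
  by rewrite normcM => h'; lra.
have zr : normc (z - z) < rho by rewrite normc_sub0; lra.
pose A := [set y : R[i] | Re z - eta <= Re y <= Re z + eta /\
                          Im z - eta <= Im y <= Im z + eta].
have inA y : normc (y - z) <= eta -> A y.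
  move=> ye; split; rewrite -ler_distl distrC.
    by rewrite distrC -complex_ReB (le_trans (Re_le_normc _)).
  by rewrite distrC -complex_ImB (le_trans (Im_le_normc _)).
have Ar y : A y -> normc (y - z) < rho.
  move=> [h1 h2]; apply: le_lt_trans er; apply: (le_trans (normc_le_ReIm _)).
  rewrite complex_ReB complex_ImB mulr_natl mulr2n.
  by rewrite lerD // ler_distl.
have Az : A z by apply: inA; rewrite normc_sub0 ltW.
have cA : compact A by exact: compact_complex_box.
have [||y] := @compact_EVT_min _ R (fun y => normc (F y - zeta)) A _ cA.
- by exists z.
- apply/subspace_continuousP => x Ax; apply: cvg_within_filter.
  apply: cvg_normc; apply: cvgB; last exact: cvg_cst.
  apply/(cvg_normcP (FF := nbhs_filter x)) => e ee0; apply/nbhs_normcP.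
  pose L := normc a * 2.
  have L0 : 0 < L by rewrite mulr_gt0.
  exists (Num.min (rho - normc (x - z)) (e / L)).
    by rewrite lt_min subr_gt0 Ar // divr_gt0.
  move=> y; rewrite lt_min => /andP[yr ye].
  have {}yr : normc (y - z) < rho.
    by rewrite (le_lt_trans (ler_normc_trans x _ _)) // -ltrBrDr.
  have h := hF y x yr (Ar _ Ax).
  have : normc (F y - F x) <= normc (a * (y - x)) + normc (F y - F x - a * (y - x)).
    rewrite -[F y - F x in leLHS](subrK (a * (y - x))) addrC.
    by rewrite (le_trans (ler_normcD _ _)).
  rewrite normcM => h'.
  have : normc (F y - F x) <= L * normc (y - x).
    by rewrite /L; have := normc_ge0 (y - x); nra.
  by move=> /le_lt_trans; apply; rewrite mulrC -ltr_pdivlMr.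
rewrite inE => Ay ymin.
have {}ymin x : A x -> normc (F y - zeta) <= normc (F x - zeta).
  by move=> Ax; apply: ymin; rewrite inE.
have yz : normc (y - z) < eta.
  have h := expand y z (Ar _ Ay) zr.
  have h1 := ymin z Az; rewrite [leRHS]normcB in h1.
  have h2 : normc (F y - F z) <= normc (F y - zeta) + normc (zeta - F z).
    exact: ler_normc_trans.
  have : normc a / 2 * normc (y - z) < normc a / 2 * eta by lra.
  by rewrite ltr_pM2l // divr_gt0.
exists y => //; apply/eqP; rewrite -subr_eq0 -normc_eq0; apply/negPn/negP => n0.
pose p := normc (F y - zeta).
have p0 : 0 < p by rewrite lt_neqAle eq_sym n0 normc_ge0.
pose t := (eta - normc (y - z)) / eta.
have t0 : 0 < t by rewrite divr_gt0 // subr_gt0.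
have t1 : t <= 1.
  by rewrite ler_pdivrMr // mul1r gerBl normc_ge0.
pose v := (zeta - F y) / a.
have nv : normc v = p / normc a by rewrite normcM normcV normcB.
have pe : p < normc a / 4 * eta.
  by rewrite (le_lt_trans (ymin z Az)) // normcB.
have ve : normc v < eta.
  rewrite nv ltr_pdivrMr // (lt_le_trans pe) //.
  have : 0 < eta * normc a by rewrite mulr_gt0.
  by lra.
(* since normc v < eta, the choice of t keeps y' within eta of z *)
pose y' := y + t%:C * v.
have y'y : normc (y' - y) = t * (p / normc a).
  by rewrite /y' addrAC subrr add0r normcM normcR gtr0_norm // nv.
have Ay' : A y'.
  apply: inA; apply: (le_trans (ler_normc_trans y _ _)).
  rewrite y'y -nv -lerBrDr.
  have -> : eta - normc (y - z) = t * eta by rewrite /t divfK // gt_eqF.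
  by rewrite ler_pM2l // ltW.
have := ymin y' Ay'; apply/negP; rewrite -ltNge.
have h := hF y' y (Ar _ Ay') (Ar _ Ay).
have e1 : F y' - zeta = (F y' - F y - a * (y' - y)) + (1 - t)%:C * (F y - zeta).
  have -> : y' - y = t%:C * v by rewrite /y'; ring.
  have -> : a * (t%:C * v) = t%:C * (zeta - F y) by rewrite /v; field.
  by rewrite rmorphB rmorph1; ring.
rewrite e1 (le_lt_trans (ler_normcD _ _)) // normcM normcR ger0_norm ?subr_ge0 //.
rewrite (le_lt_trans (lerD h (lexx _))) // y'y -/p.
have -> : normc a / 2 * (t * (p / normc a)) = t * p / 2.
  by field; rewrite gt_eqF.
have : 0 < t * p by rewrite mulr_gt0.
by lra.
Qed.

(** The quantitative content of the inverse function theorem at z, with one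
   number d for all the scales: the radius of a ball in U, the expansion factor
   and the openness of F.  This makes the property inherited by smaller d, hence
   uniform over compact sets. *)
Definition locally_invertible F U z (d : R) :=
  [/\ forall y, normc (y - z) < d -> U y,
      forall x y, normc (x - z) < d -> normc (y - z) < d ->
        d * normc (x - y) <= normc (F x - F y) &
      forall eta zeta, 0 < eta -> eta <= d -> normc (zeta - F z) < d * eta ->
        exists2 y, normc (y - z) < eta & F y = zeta].

Lemma locally_invertibleW F U z (d d' : R) :
  locally_invertible F U z d -> 0 < d' -> d' <= d -> locally_invertible F U z d'.
Proof.
move=> [h1 h2 h3] d'0 d'd; split.
- by move=> y yd; apply: h1; exact: lt_le_trans d'd.
- move=> x y xd yd; apply: le_trans (h2 x y _ _); try exact: lt_le_trans d'd.
  by rewrite ler_wpM2r ?normc_ge0.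
- move=> eta zeta e0 ed hz; apply: h3 => //; first exact: le_trans d'd.
  by apply: (lt_le_trans hz); rewrite ler_wpM2r // ltW.
Qed.

Lemma strict_locally_invertible F U z a (rho d : R) : a != 0 ->
  (forall y, normc (y - z) < rho -> U y) ->
  (forall x y, normc (x - z) < rho -> normc (y - z) < rho ->
     normc (F x - F y - a * (x - y)) <= normc a / 2 * normc (x - y)) ->
  0 < d -> d <= rho / 4 -> d <= normc a / 4 -> locally_invertible F U z d.
Proof.
move=> a0 hU hF d0 dr da; split.
- by move=> x xz; apply: hU; apply: (lt_trans xz); lra.
- move=> x x' xz x'z.
  have xr : normc (x - z) < rho by lra.
  have x'r : normc (x' - z) < rho by lra.
  have h := hF x x' xr x'r.
  have : normc (a * (x - x')) <= normc (F x - F x') + normc (F x - F x' - a * (x - x')).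
    have {1}-> : a * (x - x') = F x - F x' - (F x - F x' - a * (x - x')) by ring.
    exact: ler_normcB.
  rewrite normcM => h'; have := normc_ge0 (x - x'); nra.
- move=> eta zeta eta0 ed hz.
  apply: (strict_surjective a0 hF eta0); first by lra.
  by apply: (lt_le_trans hz); rewrite ler_wpM2r // ltW.
Qed.

Lemma sderiv_locally_invertible F U z a : open U -> U z -> sderiv F z a -> a != 0 ->
  exists2 d : R, 0 < d & \forall y \near z, locally_invertible F U y d.
Proof.
move=> /open_normcP oU Uz Fa a0.
have na : 0 < normc a by rewrite normc_gt0.
have [r r0 hr] := oU z Uz.
have [e e0 he] := Fa _ (divr_gt0 na (ltr0n _ 2)).
pose rho := Num.min r e / 2.
have rho0 : 0 < rho by rewrite divr_gt0 // lt_min r0.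
have re x y : normc (x - y) < rho -> normc (y - z) < rho ->
    normc (x - z) < r /\ normc (x - z) < e.
  move=> h1 h2; apply/andP; rewrite -lt_min.
  rewrite (le_lt_trans (ler_normc_trans y _ _)) //.
  by rewrite [ltRHS](_ : _ = rho + rho) ?ltrD // /rho; field.
pose d := Num.min (rho / 4) (normc a / 4).
have d0 : 0 < d by rewrite lt_min; apply/andP; split; exact: divr_gt0.
exists d => //; apply/nbhs_normcP; exists rho => // y yz.
apply: (strict_locally_invertible (rho := rho) a0) => //.
- by move=> x xy; apply: hr; case: (re x y).
- by move=> x x' h1 h2; apply: he; [case: (re x y) | case: (re x' y)].
- by rewrite /d ge_min lexx.
- by rewrite /d ge_min lexx orbT.
Qed.

(** Evenly covered neighbourhoods are replaced by a common scale of local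
   invertibility over each compact part of X, which is what lifting uses. *)
Definition uniform_covering F U X :=
  forall J, compact J -> J `<=` X ->
    exists2 d : R, 0 < d & forall z, U z -> J (F z) -> locally_invertible F U z d.

(** The part of U over a compact set is compact, so compact_uniform applies to
   the scales of sderiv_locally_invertible. *)
Lemma proper_uniform_covering F F1 U X : open U ->
  (forall z, U z -> sderiv F z (F1 z)) -> (forall z, U z -> F1 z != 0) ->
  (forall J, compact J -> J `<=` X -> compact (U `&` F @^-1` J)) ->
  uniform_covering F U X.
Proof.
move=> oU hF F0 prop J cJ JX.
have [||d d0 hd] := compact_uniform (P := locally_invertible F U) (prop J cJ JX).
- by move=> z d d'; exact: locally_invertibleW.
- move=> z [Uz _].
  have [d d0 hd] := sderiv_locally_invertible oU Uz (hF z Uz) (F0 z Uz).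
  by exists d => //; apply: filterS hd.
- by exists d => // z Uz Jz; apply: hd.
Qed.

(** The scale at z is proportional to |z|, which is bounded below over a compact
   set that avoids 0. *)
Lemma sqr_uniform_covering :
  uniform_covering (fun z => z ^+ 2) [set z | z != 0] [set z | z != 0].
Proof.
move=> J cJ J0.
have [||m m0 hm] := compact_uniform (P := fun z m => m <= normc z) cJ.
- by move=> z d d' h _ /le_trans; apply.
- move=> z Jz; have nz : 0 < normc z by rewrite normc_gt0; exact: (J0 z).
  exists (normc z / 2); first by rewrite divr_gt0.
  apply/nbhs_normcP; exists (normc z / 2); first by rewrite divr_gt0.
  move=> y yz _; have := ler_dist_normc y z; rewrite ler_norml => /andP[h _].
  by move: h; set u := normc (y - z) in yz *; lra.
- pose s := Num.sqrt m.
  have s0 : 0 < s by rewrite sqrtr_gt0.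
  exists (s / 8) => [|z z0 Jz]; first by rewrite divr_gt0.
  have sz : s <= normc z.
    rewrite -(@ler_pXn2r _ 2) ?nnegrE ?normc_ge0 ?(ltW s0) // sqr_sqrtr ?(ltW m0) //.
    by rewrite -normcX; exact: (hm (z ^+ 2) Jz).
  have n2 : normc (2 * z) = 2 * normc z by rewrite normcM normc_nat.
  apply: (@strict_locally_invertible _ _ _ (2 * z) (s / 2)).
  + by rewrite mulf_neq0 // pnatr_eq0.
  + move=> y yz /=; rewrite -normc_gt0.
    by have := ler_dist_normc y z; rewrite ler_norml => /andP[h _]; lra.
  + move=> x y xz yz.
    have -> : x ^+ 2 - y ^+ 2 - 2 * z * (x - y) = ((x - z) + (y - z)) * (x - y) by ring.
    rewrite normcM n2 ler_wpM2r ?normc_ge0 // (le_trans (ler_normcD _ _)) //; lra.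
  + by rewrite divr_gt0.
  + by lra.
  + by rewrite n2; lra.
Qed.

End LocalInverse.

(** * Lifting through a uniform covering *)

Section Lifting.
Context {R : realType}.
Implicit Types (s z a zeta : R[i]) (F G psi p q : R[i] -> R[i]) (U X S K J Q : set R[i]).

Definition star_shaped s0 Q :=
  forall s (t : R), Q s -> 0 <= t <= 1 -> Q (s0 + t%:C * (s - s0)).

(** Continuity relative to Q: lifts are first built over sets that are not open. *)
Definition cont_in Q psi := forall s, Q s -> forall e : R, 0 < e ->
  exists2 d : R, 0 < d &
    forall s', Q s' -> normc (s' - s) < d -> normc (psi s' - psi s) < e.

Lemma cvg_cont_in Q psi : (forall s, Q s -> psi @ nbhs s --> psi s) -> cont_in Q psi.
Proof.
move=> h s Qs e e0; have := h s Qs.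
move=> /(cvg_normcP (FF := nbhs_filter s)) /(_ e e0) /nbhs_normcP[d d0 hd].
by exists d => // s' _; exact: hd.
Qed.

Lemma cont_inW Q Q' psi : Q' `<=` Q -> cont_in Q psi -> cont_in Q' psi.
Proof.
move=> QQ h s Qs e e0; have [d d0 hd] := h s (QQ _ Qs) e e0.
by exists d => // s' /QQ; exact: hd.
Qed.

Lemma cont_in_uniform Q psi : compact Q -> cont_in Q psi -> forall e : R, 0 < e ->
  exists2 d : R, 0 < d & forall s s', Q s -> Q s' -> normc (s' - s) < d ->
    normc (psi s' - psi s) < e.
Proof.
move=> cQ h e e0; have e2 : 0 < e / 2 by rewrite divr_gt0.
have [||d d0 hd] := compact_uniform (P := fun s d => forall s', Q s' ->
    normc (s' - s) < d -> normc (psi s' - psi s) < e) cQ.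
- by move=> s d d' hP d'0 d'd s' Qs' /lt_le_trans /(_ d'd); exact: hP.
- move=> s Qs; have [d d0 hd] := h s Qs _ e2.
  have d2 : 0 < d / 2 by rewrite divr_gt0.
  exists (d / 2) => //; apply/nbhs_normcP; exists (d / 2) => // y ys Qy s' Qs' s'y.
  apply: (le_lt_trans (ler_normc_trans (psi s) _ _)); rewrite (splitr e).
  apply: ltrD.
    apply: hd => //; apply: (le_lt_trans (ler_normc_trans y _ _)).
    by rewrite (splitr d) ltrD.
  by rewrite normcB; apply: hd => //; apply: (lt_trans ys); lra.
- by exists d => // s s' Qs; exact: hd.
Qed.

(** The distance of two lifts is continuous and takes no value in ]0, d[, so it
   stays 0. *)
Lemma path_lift_unique F U (p q : R -> R[i]) (a b d : R) : 0 < d -> a <= b ->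
  (forall t, a <= t <= b -> locally_invertible F U (p t) d) ->
  (forall t, a <= t <= b -> F (p t) = F (q t)) ->
  {within `[a, b], continuous (fun t => normc (p t - q t))} ->
  p a = q a -> p b = q b.
Proof.
move=> d0 ab hp Fpq cpq pqa; apply/eqP; rewrite -subr_eq0 -normc_eq0.
apply/negPn/negP => n0; pose r := normc (p b - q b).
have r0 : 0 < r by rewrite lt_neqAle eq_sym n0 normc_ge0.
pose v := Num.min r (d / 2).
have v0 : 0 < v by rewrite lt_min r0 divr_gt0.
have [|t] := IVT (v := v) ab cpq.
  rewrite pqa normc_sub0 min_l ?max_r ?normc_ge0 // -/r ltW //=.
  by rewrite /v ge_min lexx.
rewrite in_itv /= => tab hv.
have vd : v < d by rewrite /v gt_min orbC ltr_pdivrMr // ltr_pMr // ltr1n.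
have [_ inj _] := hp t tab.
have := inj (p t) (q t); rewrite normc_sub0 normcB hv => /(_ d0 vd).
rewrite Fpq // normc_sub0 leNgt => /negP; apply.
by rewrite mulr_gt0 // normcB hv.
Qed.

Lemma star_lift_unique F U Q s0 p q (d : R) : 0 < d -> star_shaped s0 Q ->
  (forall s, Q s -> locally_invertible F U (p s) d) ->
  (forall s, Q s -> F (p s) = F (q s)) ->
  cont_in Q p -> cont_in Q q -> p s0 = q s0 -> forall s, Q s -> p s = q s.
Proof.
move=> d0 star hp Fpq cp cq pq0 s Qs.
pose l (t : R) := s0 + t%:C * (s - s0).
have Ql t : 0 <= t <= 1 -> Q (l t) by exact: star.
have l0 : l 0 = s0 by rewrite /l; ring.
have l1 : l 1 = s by rewrite /l; ring.
rewrite -l1; apply: (@path_lift_unique F U (p \o l) (q \o l) 0 1 d) => //=.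
- by move=> t t01; apply/hp/Ql.
- by move=> t t01; apply/Fpq/Ql.
- apply/subspace_continuousP => t /=; rewrite in_itv /= => t01.
  have key (g : R[i] -> R[i]) : cont_in Q g ->
      (g (l x) @[x --> within `[0, 1] (nbhs t)]) --> g (l t).
    move=> cg; apply/cvg_normcP => e e0.
    have [r r0 hr] := cg _ (Ql _ t01) e e0.
    pose M := normc (s - s0) + 1; have M0 : 0 < M := lip_gt0 _.
    rewrite near_withinE; apply/nbhs_ballP; exists (r / M); first exact: divr_gt0.
    move=> x; rewrite /ball /= => tx; rewrite in_itv /= => x01.
    apply: hr; first exact: Ql.
    have -> : l x - l t = (x - t)%:C * (s - s0) by rewrite /l rmorphB /=; ring.
    rewrite normcM normcR; rewrite ltr_pdivlMr // distrC in tx.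
    by apply: le_lt_trans tx; rewrite ler_wpM2l // lerDl.
  by apply: cvg_normc; apply: cvgB; apply: key.
- by rewrite l0.
Qed.

(** The map G is deformed to a constant by the dilations s0 + t (s - s0); a lift
   is carried along in finitely many steps, each so small that every point moves
   within its ball of local invertibility. *)
Lemma compact_star_lift F U X G Q s0 z0 : uniform_covering F U X ->
  compact Q -> star_shaped s0 Q -> Q s0 -> cont_in Q G ->
  (forall s, Q s -> X (G s)) -> U z0 -> F z0 = G s0 ->
  exists psi, [/\ psi s0 = z0, forall s, Q s -> U (psi s),
    forall s, Q s -> F (psi s) = G s & cont_in Q psi].
Proof.
move=> cov cQ star Qs0 cG GX Uz0 Fz0.
have cJ : compact (G @` Q).
  apply: continuous_compact => //; apply/subspace_continuousP => s Qs.
  apply/cvg_normcP => e e0; have [d d0 hd] := cG s Qs e e0.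
  rewrite near_withinE; apply/nbhs_normcP; exists d => // y yd Qy.
  exact: hd.
have [|d d0 hd] := cov _ cJ; first by move=> _ [s Qs <-]; exact: GX.
(* a move by less than d * (d / 4) lifts to a move by less than d / 4 *)
have dd0 : 0 < d * (d / 4) by rewrite mulr_gt0 // divr_gt0.
have [r r0 hr] := cont_in_uniform cQ cG dd0.
have [m m0 hm] : exists2 m : R, 0 < m & forall s, Q s -> normc (s - s0) <= m^-1.
  have [||m m0 hm] := compact_uniform (P := fun s m => normc (s - s0) <= m^-1) cQ.
  - move=> s e e' h e'0 e'e; apply: (le_trans h).
    by rewrite lef_pV2 // posrE // (lt_le_trans e'0).
  - move=> s Qs; pose B := normc (s - s0) + 1.
    have B0 : 0 < B := lip_gt0 _.
    exists B^-1; first by rewrite invr_gt0.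
    apply/nbhs_normcP; exists 1 => // y ys _; rewrite invrK.
    by apply: (le_trans (ler_normc_trans s _ _)); rewrite /B addrC lerD2l ltW.
  - by exists m.
have [M M0 hM] : exists2 M : nat, (0 < M)%N & m^-1 / M%:R < r.
  have := @archi_boundP R (m^-1 / r) _.
  rewrite divr_ge0 ?invr_ge0 ?ltW // => /(_ isT) h.
  have M0 : 0 < (Num.Def.archi_bound (m^-1 / r))%:R :> R.
    by rewrite (le_lt_trans _ h) // divr_ge0 ?invr_ge0 ?ltW.
  exists (Num.Def.archi_bound (m^-1 / r)); first by rewrite -(ltr_nat R).
  by rewrite ltr_pdivrMr // mulrC -ltr_pdivrMr.
have Mr0 : 0 < M%:R :> R by rewrite ltr0n.
pose l (t : R) s := s0 + t%:C * (s - s0).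
pose tau k : R := k%:R / M%:R.
have tau01 k : (k <= M)%N -> 0 <= tau k <= 1.
  by move=> kM; rewrite divr_ge0 //= ler_pdivrMr // mul1r ler_nat.
have Ql k s : (k <= M)%N -> Q s -> Q (l (tau k) s).
  by move=> /tau01 t01 Qs; exact: star.
have ls0 t : l t s0 = s0 by rewrite /l subrr mulr0 addr0.
have step k : (k <= M)%N -> exists psi, [/\ psi s0 = z0, forall s, Q s -> U (psi s),
    forall s, Q s -> F (psi s) = G (l (tau k) s) & cont_in Q psi].
  elim: k => [_|k IH kM].
    exists (fun=> z0); split => // [s Qs|s Qs e e0].
      by rewrite Fz0 /l /tau mul0r mul0r addr0.
    by exists 1 => // s' _ _; rewrite normc_sub0.
  have [psi [p0 pU pF pc]] := IH (ltnW kM).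
  have pinv s : Q s -> locally_invertible F U (psi s) d.
    move=> Qs; apply: hd; first exact: pU.
    by rewrite pF //; exists (l (tau k) s) => //; apply: Ql => //; exact: ltnW.
  have d4 : 0 < d / 4 by rewrite divr_gt0.
  have d4d : d / 4 <= d by rewrite ler_pdivrMr // ler_pMr // ler1n.
  have /choice[psi' hpsi'] : forall s, exists y, Q s ->
      normc (y - psi s) < d / 4 /\ F y = G (l (tau k.+1) s).
    move=> s; have [Qs|nQ] := pselect (Q s); last by exists z0.
    have [_ _ sur] := pinv s Qs.
    have [|y h1 h2] := sur (d / 4) (G (l (tau k.+1) s)) d4 d4d; last by exists y.
    rewrite pF //; apply: hr; try (by apply: Ql => //; exact: ltnW).
    have -> : l (tau k.+1) s - l (tau k) s = (M%:R^-1)%:C * (s - s0).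
      have -> : (M%:R^-1 : R) = tau k.+1 - tau k.
        by rewrite /tau -mulrBl -natr1 addrAC subrr add0r mul1r.
      by rewrite /l rmorphB; ring.
    rewrite normcM normcR ger0_norm ?invr_ge0 // mulrC.
    by apply: le_lt_trans hM; rewrite ler_wpM2r ?invr_ge0 // hm.
  have close s : Q s -> normc (psi' s - psi s) < d.
    by move=> Qs; apply: lt_le_trans d4d; apply: (proj1 (hpsi' s Qs)).
  exists psi'; split.
  - have [_ inj _] := pinv s0 Qs0.
    have := inj (psi' s0) (psi s0) (close _ Qs0); rewrite normc_sub0 => /(_ d0).
    have [_ ->] := hpsi' s0 Qs0; rewrite pF // !ls0 normc_sub0 pmulr_rle0 //.
    move=> h; rewrite -p0; apply/eqP; rewrite -subr_eq0 -normc_eq0.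
    by rewrite eq_le h normc_ge0.
  - move=> s Qs; have [hU _ _] := pinv s Qs; apply: hU; exact: close.
  - by move=> s Qs; case: (hpsi' s Qs).
  - move=> s Qs e e0.
    have [d1 d10 hd1] := pc s Qs _ d4.
    have [d2 d20 hd2] := cG _ (Ql k.+1 s kM Qs) _ (mulr_gt0 d0 e0).
    exists (Num.min d1 d2); first by rewrite lt_min d10.
    move=> s' Qs'; rewrite lt_min => /andP[s1 s2].
    have [_ inj _] := pinv s Qs.
    have cs' : normc (psi' s' - psi s) < d.
      apply: (le_lt_trans (ler_normc_trans (psi s') _ _)).
      have h1 := proj1 (hpsi' s' Qs'); have h2 := hd1 s' Qs' s1; lra.
    rewrite -(ltr_pM2l d0); apply: le_lt_trans (inj _ _ cs' (close s Qs)) _.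
    rewrite (proj2 (hpsi' s Qs)) (proj2 (hpsi' s' Qs')).
    apply: hd2; first exact: Ql.
    have -> : l (tau k.+1) s' - l (tau k.+1) s = (tau k.+1)%:C * (s' - s).
      by rewrite /l; ring.
    have /andP[t0 t1] := tau01 k.+1 kM.
    rewrite normcM normcR ger0_norm //; apply: le_lt_trans s2.
    by rewrite ler_piMl ?normc_ge0.
have [psi [p0 pU pF pc]] := step M (leqnn M).
exists psi; split => // s Qs; rewrite pF // /l /tau divff ?gt_eqF //.
by congr (G _); ring.
Qed.

(** The cone with vertex s0 over a square around s: such cones are star-shaped
   and exhaust an open star-shaped set. *)
Lemma compact_cone s0 s (r : R) : 0 <= r ->
  compact [set x | exists t y, [/\ 0 <= t <= 1,
    Re s - r <= Re y <= Re s + r /\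
    Im s - r <= Im y <= Im s + r &
    x = s0 + t%:C * (y - s0)]].
Proof.
move=> r0; have := compact_setX (@segment_compact R 0 1)
  (@compact_complex_box R (Re s - r) (Re s + r) (Im s - r) (Im s + r)).
set B := _ `*` _ => cB.
rewrite [X in compact X](_ : _ =
    (fun x : R * R[i] => s0 + (x.1)%:C * (x.2 - s0)) @` B); last first.
  apply/seteqP; split.
    move=> _ [t [y [t01 hy ->]]]; exists (t, y) => //; split => //=.
  by move=> _ [[t y] [/= t01 hy] <-]; exists t, y; split.
apply: continuous_compact => //; apply: continuous_subspaceT => p.
apply: cvgD; first exact: cvg_cst.
apply: cvgM; last by apply: cvgB; [exact: cvg_snd|exact: cvg_cst].
by apply: cvg_complex; [exact: cvg_fst|exact: cvg_cst].
Qed.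

(** An open star-shaped set is exhausted by compact cones, and the lifts over
   two of them agree by uniqueness over their intersection. *)
Lemma star_lift F U X G S s0 z0 : uniform_covering F U X ->
  open S -> star_shaped s0 S -> S s0 -> (forall s, S s -> G @ nbhs s --> G s) ->
  (forall s, S s -> X (G s)) -> U z0 -> F z0 = G s0 ->
  exists psi, [/\ psi s0 = z0, forall s, S s -> U (psi s),
    forall s, S s -> F (psi s) = G s & forall s, S s -> psi @ nbhs s --> psi s].
Proof.
move=> cov oS star Ss0 cG GX Uz0 Fz0.
pose good Q := [/\ compact Q, star_shaped s0 Q, Q s0 & Q `<=` S].
have exh s : S s -> exists2 Q, good Q & \forall y \near s, Q y.
  move=> Ss; have [r r0 hr] := (proj1 (open_normcP S) oS) s Ss.
  have r3 : 0 < r / 3 by rewrite divr_gt0.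
  eexists; first split.
  - exact: (@compact_cone s0 s (r / 3) (ltW r3)).
  - move=> _ u [t [y [t01 hy ->]]] /andP[u0 u1]; have /andP[t0 t1] := t01.
    exists (u * t), y; split => //; last by rewrite rmorphM /=; ring.
    by rewrite mulr_ge0 //= mulr_ile1.
  - exists 0, s; split; rewrite ?lexx ?ler01 //; last by rewrite mul0r addr0.
    by rewrite !lerDl !gerBl ltW.
  - move=> _ [t [y [t01 [hy1 hy2] ->]]]; apply: star => //; apply: hr.
    rewrite (le_lt_trans (normc_le_ReIm _)) // complex_ReB complex_ImB.
    rewrite -ler_distl in hy1; rewrite -ler_distl in hy2.
    by apply: (le_lt_trans (lerD hy1 hy2)); lra.
  - apply/nbhs_normcP; exists (r / 3) => // y ys; exists 1, y.
    split; rewrite ?ler01 ?lexx //; last by rewrite mul1r; ring.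
    rewrite -!ler_distl -complex_ReB -complex_ImB.
    by rewrite !(le_trans _ (ltW ys)) ?Re_le_normc ?Im_le_normc.
have lft Q : good Q -> exists psi, [/\ psi s0 = z0, forall s, Q s -> U (psi s),
    forall s, Q s -> F (psi s) = G s & cont_in Q psi].
  move=> [cQ sQ Q0 QS]; apply: (@compact_star_lift F U X) => //.
  - by apply: cvg_cont_in => s /QS; exact: cG.
  - by move=> s /QS; exact: GX.
have uniq Q Q' p q : good Q -> good Q' ->
    [/\ p s0 = z0, forall s, Q s -> U (p s), forall s, Q s -> F (p s) = G s & cont_in Q p] ->
    [/\ q s0 = z0, forall s, Q' s -> U (q s), forall s, Q' s -> F (q s) = G s & cont_in Q' q] ->
    forall s, Q s -> Q' s -> p s = q s.
  move=> [cQ sQ Q0 QS] [cQ' sQ' Q'0 Q'S] [p0 pU pF pc] [q0 qU qF qc] s Qs Q's.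
  have cJ : compact (G @` Q).
    apply: continuous_compact => //; apply/subspace_continuousP => x /QS /cG cx.
    exact: cvg_within_filter.
  have [|d d0 hd] := cov _ cJ; first by move=> _ [x Qx <-]; exact/GX/QS.
  apply: (@star_lift_unique F U (Q `&` Q') s0 p q d) => //.
  - by move=> x t [h1 h2] t01; split; [exact: sQ|exact: sQ'].
  - by move=> x [h1 h2]; apply: hd; [exact: pU|rewrite pF //; exists x].
  - by move=> x [h1 h2]; rewrite pF // qF.
  - by apply: cont_inW pc => x [].
  - by apply: cont_inW qc => x [].
  - by rewrite p0 q0.
pose P s (Q : set R[i]) (psi : R[i] -> R[i]) :=
  [/\ good Q, \forall y \near s, Q y & [/\ psi s0 = z0, forall s, Q s -> U (psi s),
    forall s, Q s -> F (psi s) = G s & cont_in Q psi]].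
have /choice[W hW] : forall s, exists W : set R[i] * (R[i] -> R[i]), S s -> P s W.1 W.2.
  move=> s; have [Ss|nS] := pselect (S s); last by exists (setT, id).
  have [Q gQ nQ] := exh s Ss; have [psi h] := lft Q gQ.
  by exists (Q, psi).
pose psi s := (W s).2 s.
have WQ s : S s -> (W s).1 s by move=> /hW[_ /nbhs_singleton].
have agree s y : S s -> (W s).1 y -> psi y = (W s).2 y.
  move=> Ss Qy; have [g1 n1 h1] := hW s Ss.
  have Sy : S y by case: g1 => _ _ _; apply.
  have [g2 n2 h2] := hW y Sy.
  exact: (uniq _ _ _ _ g2 g1 h2 h1 _ (WQ y Sy) Qy).
exists psi; split.
- by rewrite /psi; have [_ _ []] := hW s0 Ss0.
- by move=> s Ss; rewrite /psi; have [_ _ [_ h _ _]] := hW s Ss; apply: h; exact: WQ.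
- by move=> s Ss; rewrite /psi; have [_ _ [_ _ h _]] := hW s Ss; apply: h; exact: WQ.
- move=> s Ss; have [g1 n1 [_ _ _ h]] := hW s Ss.
  apply/(cvg_normcP (FF := nbhs_filter s)) => e e0.
  have [d d0 hd] := h s (WQ s Ss) e e0.
  have nd : \forall y \near s, normc (y - s) < d by apply/nbhs_normcP; exists d.
  near=> y; rewrite !(agree s) //; try (by apply: WQ); try (by near: y).
  by apply: hd; near: y.
Unshelve. all: by end_near.
Qed.

End Lifting.

(** * The complex exponential *)

Section ComplexExponential.
Context {R : realType}.
Implicit Types (x y z u : R[i]).

Definition cexp z : R[i] :=
  (expR (Re z))%:C * (cos (Im z) +i* sin (Im z)).

Lemma cexp0 : cexp 0 = 1.
Proof. by rewrite /cexp /= expR0 cos0 sin0 mul1r. Qed.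

Lemma cexpD x y : cexp (x + y) = cexp x * cexp y.
Proof.
rewrite /cexp complex_ReD complex_ImD expRD cosD sinD rmorphM /=.
rewrite mulrACA; congr (_ * _); simpc.
by congr (_ +i* _); rewrite addrC.
Qed.

Lemma normc_cexp z : normc (cexp z) = expR (Re z).
Proof.
by rewrite normcM normcR ger0_norm ?expR_ge0 //= cos2Dsin2 sqrtr1 mulr1.
Qed.

Lemma cexp_neq0 z : cexp z != 0.
Proof. by rewrite -normc_gt0 normc_cexp expR_gt0. Qed.

Lemma cexpN z : cexp (- z) = (cexp z)^-1.
Proof. by apply: (mulfI (cexp_neq0 z)); rewrite -cexpD subrr cexp0 divff ?cexp_neq0. Qed.

Lemma cexp_near0 (e : R) : 0 < e -> exists2 d : R, 0 < d &
  forall u, normc u < d -> normc (cexp u - 1 - u) <= e * normc u.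
Proof.
move=> e0; have e6 : 0 < e / 6 by rewrite divr_gt0.
have [d1 d10 h1] := (proj1 (is_derive_epsP _ _ _)) (is_derive_expR (0 : R)) _ e6.
have [d2 d20 h2] := (proj1 (is_derive_epsP _ _ _)) (is_derive_cos (0 : R)) _ e6.
have [d3 d30 h3] := (proj1 (is_derive_epsP _ _ _)) (is_derive_sin (0 : R)) _ e6.
have [d4 d40 h4] := (proj1 (is_derive_epsP _ _ _)) (is_derive_expR (0 : R)) 1 ltr01.
exists (Num.min (Num.min d1 d2) (Num.min (Num.min d3 d4) (Num.min (1 / 2) (e / 12)))).
  by rewrite !lt_min d10 d20 d30 d40 !divr_gt0.
move=> u; rewrite !lt_min => /andP[/andP[u1 u2] /andP[/andP[u3 u4] /andP[u5 u6]]].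
set x := Re u; set y := Im u.
have xu : `|x| <= normc u := Re_le_normc u.
have yu : `|y| <= normc u := Im_le_normc u.
have {}h1 : `|expR x - 1 - x| <= e / 6 * normc u.
  have := h1 x; rewrite subr0 expR0 mul1r => /(_ (le_lt_trans xu u1)) h.
  by apply: (le_trans h); rewrite ler_pM2l.
have {}h2 : `|cos y - 1| <= e / 6 * normc u.
  have := h2 y; rewrite subr0 cos0 sin0 oppr0 mul0r subr0 => /(_ (le_lt_trans yu u2)) h.
  by apply: (le_trans h); rewrite ler_pM2l.
have {}h3 : `|sin y - y| <= e / 6 * normc u.
  have := h3 y; rewrite subr0 cos0 sin0 mul1r subr0 => /(_ (le_lt_trans yu u3)) h.
  by apply: (le_trans h); rewrite ler_pM2l.
have {}h4 : `|expR x - 1| <= 2 * normc u.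
  have := h4 x; rewrite subr0 expR0 !mul1r => /(_ (le_lt_trans xu u4)) h.
  have := ler_normD (expR x - 1 - x) x; rewrite subrK; lra.
have ex2 : `|expR x| <= 2.
  have := ler_normD (expR x - 1) 1; rewrite subrK normr1; lra.
have n0 := normc_ge0 u.
have hR : `|Re (cexp u - 1 - u)| <= e / 2 * normc u.
  have -> : Re (cexp u - 1 - u) = expR x * (cos y - 1) + (expR x - 1 - x).
    by rewrite !complex_ReB /cexp complex_ReM /= -/x -/y; ring.
  apply: (le_trans (ler_normD _ _)); rewrite normrM.
  have : `|expR x| * `|cos y - 1| <= 2 * (e / 6 * normc u) by rewrite ler_pM.
  by lra.
have hI : `|Im (cexp u - 1 - u)| <= e / 2 * normc u.
  have -> : Im (cexp u - 1 - u) = expR x * (sin y - y) + y * (expR x - 1).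
    by rewrite !complex_ImB /cexp complex_ImM /= -/x -/y; ring.
  apply: (le_trans (ler_normD _ _)); rewrite !normrM.
  have : `|expR x| * `|sin y - y| <= 2 * (e / 6 * normc u) by rewrite ler_pM.
  have : `|y| * `|expR x - 1| <= normc u * (e / 6) by rewrite ler_pM //; lra.
  by lra.
by apply: (le_trans (normc_le_ReIm _)); lra.
Qed.

Lemma sderiv_cexp z : sderiv cexp z (cexp z).
Proof.
move=> e e0; pose K := normc (cexp z).
have K0 : 0 < K by rewrite normc_gt0 cexp_neq0.
have eK : 0 < e / (4 * K) by rewrite divr_gt0 // mulr_gt0.
have [d d0 hd] := cexp_near0 eK; have [d1 d10 hd1] := cexp_near0 ltr01.
exists (Num.min (Num.min (d / 2) d1) (Num.min (1 / 2) (e / (4 * K)))).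
  by rewrite !lt_min eK d10 !divr_gt0.
move=> x y; rewrite !lt_min => /andP[/andP[xd _] _] /andP[/andP[yd yd1] /andP[y1 ye]].
have xy : normc (x - y) < d.
  by rewrite (le_lt_trans (ler_normc_trans z _ _)) // (splitr d) ltrD // normcB.
have yz : normc (cexp y - cexp z) <= K * (2 * normc (y - z)).
  have -> : cexp y - cexp z = cexp z * (cexp (y - z) - 1).
    by rewrite mulrBr mulr1 -cexpD [z + _]addrC subrK.
  rewrite [normc _]normcM ler_pM2l // -[cexp _ - 1](subrK (y - z)).
  by have := hd1 (y - z) yd1; have := ler_normcD (cexp (y - z) - 1 - (y - z)) (y - z); lra.
have ny : normc (cexp y) <= 2 * K.
  have := ler_normcD (cexp y - cexp z) (cexp z); rewrite subrK -/K; nra.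
have -> : cexp x - cexp y - cexp z * (x - y) =
  cexp y * (cexp (x - y) - 1 - (x - y)) + (cexp y - cexp z) * (x - y).
  have {1}-> : cexp x = cexp y * cexp (x - y) by rewrite -cexpD [y + _]addrC subrK.
  by ring.
apply: (le_trans (ler_normcD _ _)).
rewrite [normc (_ * (_ - 1 - _))]normcM [normc (_ * (x - y))]normcM.
rewrite (splitr e) mulrDl lerD //.
  have -> : e / 2 * normc (x - y) = 2 * K * (e / (4 * K) * normc (x - y)).
    by field; rewrite gt_eqF.
  apply: ler_pM ny (hd _ xy) => //; exact: normc_ge0.
rewrite ler_wpM2r ?normc_ge0 // (le_trans yz) //.
have -> : e / 2 = K * (2 * (e / (4 * K))) by field; rewrite gt_eqF.
by rewrite !ler_pM2l // ltW.
Qed.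

Lemma periodic_int (V : zmodType) (u : R -> V) (T y : R) (k : int) : periodic u T ->
  u (y + k%:~R * T) = u y.
Proof.
move=> pu; case: k => n; first by have := periodicn pu n y; rewrite -[T *+ n]mulr_natl.
rewrite NegzE mulrNz mulNr.
have := periodicn pu n.+1 (y - n.+1%:R * T).
by rewrite -[T *+ n.+1]mulr_natl subrK => ->.
Qed.

Definition two_pi_i : R[i] := 0 +i* (pi *+ 2).

Lemma cexp_period z (k : int) : cexp (z + k%:~R * two_pi_i) = cexp z.
Proof.
have kE : k%:~R = (k%:~R : R)%:C :> R[i] by rewrite rmorph_int.
have Re2 : Re (k%:~R * two_pi_i) = 0 by rewrite kE complex_ReM /= mulr0 mul0r subr0.
have Im2 : Im (k%:~R * two_pi_i) = k%:~R * (pi *+ 2).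
  by rewrite kE complex_ImM /= mul0r addr0.
rewrite /cexp complex_ReD complex_ImD Re2 Im2 addr0.
by rewrite (periodic_int _ _ (@cosD2pi R)) (periodic_int _ _ (@sinD2pi R)).
Qed.

Lemma cos_eq1 (y : R) : cos y = 1 -> exists k : int, y = k%:~R * (pi *+ 2).
Proof.
move=> cy; have p2 : 0 < pi *+ 2 :> R by rewrite mulrn_wgt0 // pi_gt0.
pose k := Num.floor (y / (pi *+ 2)); pose r := y - k%:~R * (pi *+ 2).
have ry : y = r + k%:~R * (pi *+ 2) by rewrite /r subrK.
have cr : cos r = 1 by rewrite -(periodic_int r k (@cosD2pi R)) -ry.
have r0 : 0 <= r.
  by rewrite subr_ge0 -ler_pdivlMr // floor_le.
have r2 : r < pi *+ 2.
  rewrite ltrBlDr -[X in X + _]mul1r -mulrDl -ltr_pdivrMr // addrC.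
  by rewrite -[1]/(1%:~R) -rmorphD; exact: floorD1_gt.
exists k; suff -> : k%:~R * (pi *+ 2) = y by [].
rewrite [RHS]ry; suff -> : r = 0 by rewrite add0r.
apply/eqP; rewrite eq_le r0 andbT leNgt; apply/negP => rp.
have h := cos_mulr2n (r / 2); rewrite -[_ *+ 2]mulr_natr divfK // cr in h.
have s0 : sin (r / 2) = 0.
  by apply/eqP; rewrite -sqrf_eq0 sin2cos2; apply/eqP; move: h; rewrite mulr2n; lra.
have : 0 < sin (r / 2).
  by apply: sin_gt0_pi; rewrite divr_gt0 //= ltr_pdivrMr // mulr_natr.
by rewrite s0 ltxx.
Qed.

Lemma cexp_eq1 z : cexp z = 1 -> exists k : int, z = k%:~R * two_pi_i.
Proof.
move=> h; have re0 : Re z = 0.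
  by have := normc_cexp z; rewrite h normc1 -(@expR0 R) => /expR_inj.
have [k hk] : exists k : int, Im z = k%:~R * (pi *+ 2).
  apply: cos_eq1; have := congr1 (fun x => Re x) h.
  by rewrite /cexp complex_ReM /= re0 expR0 mul1r mul0r subr0.
exists k; have kE : k%:~R = (k%:~R : R)%:C :> R[i] by rewrite rmorph_int.
by apply: complexP; rewrite kE ?complex_ReM ?complex_ImM /= ?hk ?re0; ring.
Qed.

Lemma cexp_eq x y : cexp x = cexp y -> exists k : int, x = y + k%:~R * two_pi_i.
Proof.
move=> h; have /cexp_eq1[k hk] : cexp (x - y) = 1.
  by rewrite cexpD h cexpN divff ?cexp_neq0.
by exists k; rewrite -hk addrC subrK.
Qed.

Lemma cexp_surjective u : u != 0 -> exists z, cexp z = u.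
Proof.
move=> u0; have nu : 0 < normc u by rewrite normc_gt0.
pose x := Re u / normc u; pose y := Im u / normc u.
have xy1 : x ^+ 2 + y ^+ 2 = 1.
  rewrite /x /y !expr_div_n -mulrDl -sqr_normc divff //.
  by rewrite expf_neq0 // gt_eqF.
have x1 : -1 <= x <= 1.
  by rewrite -ler_norml /x normrM normfV (gtr0_norm nu) ler_pdivrMr // mul1r Re_le_normc.
have ex v : cos v = x -> sin v = y -> exists z, cexp z = u.
  move=> cv sv; exists (ln (normc u) +i* v).
  rewrite /cexp /= cv sv lnK ?posrE //.
  by apply: complexP; rewrite ?complex_ReM ?complex_ImM /= /x /y; field; rewrite gt_eqF.
have y2 : y ^+ 2 = 1 - x ^+ 2 by rewrite -xy1; ring.
have cx : cos (acos x) = x by rewrite acosK // in_itv.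
have [y0|y0] := leP 0 y.
  by apply: (ex (acos x)) => //; rewrite sin_acos // -y2 sqrtr_sqr ger0_norm.
apply: (ex (- acos x)); first by rewrite cosN.
by rewrite sinN sin_acos // -y2 sqrtr_sqr ltr0_norm // opprK.
Qed.

End ComplexExponential.

(** * Strips, annuli and components *)

Section Uniformization.
Context {R : realType}.
Implicit Types (s z : R[i]) (F G f psi p q : R[i] -> R[i]) (U X S J : set R[i]).
Implicit Types (a b : \bar R).

(** The expansion of F at psi s, solved for the increment of psi, first bounds
   that increment by M |x - y|; the errors of F and G then become errors of the
   order of |x - y| for psi. *)
Lemma sderiv_lift F G psi s (A B : R[i]) : A != 0 ->
  sderiv F (psi s) A -> sderiv G s B -> psi @ nbhs s --> psi s ->
  (\forall x \near s, F (psi x) = G x) -> sderiv psi s (B / A).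
Proof.
move=> A0 FA GB cpsi FG e e0.
have nA : 0 < normc A by rewrite normc_gt0.
pose L := normc B + 1; have L0 : 0 < L := lip_gt0 _.
pose M := 2 * L / normc A; have M0 : 0 < M by rewrite divr_gt0 // mulr_gt0.
pose e1 := Num.min (normc A / 2) (e * normc A / (2 * M)).
have e10 : 0 < e1 by rewrite lt_min !divr_gt0 // mulr_gt0.
have e1a : e1 <= normc A / 2 by rewrite /e1 ge_min lexx.
have e1b : e1 * M <= e * normc A / 2.
  have : e1 <= e * normc A / (2 * M) by rewrite /e1 ge_min lexx orbT.
  by rewrite -(ler_pM2r M0) => /le_trans; apply; rewrite le_eqVlt; apply/orP; left;
    apply/eqP; field; rewrite gt_eqF.
have e20 : 0 < e * normc A / 2 by rewrite divr_gt0 // mulr_gt0.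
have [d d0 hd] := FA _ e10.
have nd : \forall x \near s, normc (psi x - psi s) < d.
  by move/(cvg_normcP (FF := nbhs_filter s)): cpsi; apply.
have := near2I (near2I (near2_near nd) (near2_near FG)) (near2I (GB _ e20) (sderiv_lip GB)).
apply: near2W => x y [[[px py] [Fx Fy]] [h2 h3]].
have h1 := hd _ _ px py; rewrite Fx Fy in h1.
set P := psi x - psi y in h1 *; set N := normc (x - y) in h2 h3 *.
have h4 : normc P <= M * N.
  have : normc (A * P) <= normc (G x - G y) + normc (G x - G y - A * P).
    have {1}-> : A * P = G x - G y - (G x - G y - A * P) by ring.
    exact: ler_normcB.
  rewrite normcM => h; have nP := normc_ge0 P.
  have : normc A * normc P <= L * N + normc A / 2 * normc P by rewrite /L; nra.
  move=> h'; rewrite /M mulrAC ler_pdivlMr //; lra.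
have -> : P - B / A * (x - y) =
   ((G x - G y - B * (x - y)) - (G x - G y - A * P)) / A by field.
rewrite normcM normcV ler_pdivrMr //; apply: (le_trans (ler_normcB _ _)).
have nP := normc_ge0 P.
have : e1 * normc P <= e1 * (M * N) by rewrite ler_pM2l.
have N0 : 0 <= N := normc_ge0 _.
have : (e1 * M) * N <= e * normc A / 2 * N by rewrite ler_wpM2r.
by lra.
Qed.

Lemma ointerval_nbhs a b (t : R) : ointerval a b t ->
  exists2 e : R, 0 < e & forall t', `|t' - t| < e -> ointerval a b t'.
Proof.
rewrite /ointerval /= => /andP[h1 h2].
have [e1 e10 he1] : exists2 e : R, 0 < e & forall t', `|t' - t| < e -> (a < t'%:E)%E.
  case: a h1 => [a| |] // h1; last by exists 1 => // t' _; rewrite ltNyr.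
  rewrite lte_fin in h1; exists (t - a) => [|t']; first by rewrite subr_gt0.
  by rewrite lte_fin ltr_norml => /andP[h _]; lra.
have [e2 e20 he2] : exists2 e : R, 0 < e & forall t', `|t' - t| < e -> (t'%:E < b)%E.
  case: b h2 => [b| |] // h2; last by exists 1 => // t' _; rewrite ltry.
  rewrite lte_fin in h2; exists (b - t) => [|t']; first by rewrite subr_gt0.
  by rewrite lte_fin ltr_norml => /andP[_ h]; lra.
exists (Num.min e1 e2) => [|t']; first by rewrite lt_min e10.
by rewrite lt_min => /andP[h3 h4]; rewrite he1 // he2.
Qed.

Lemma ointerval_convex a b (t t' u : R) : ointerval a b t -> ointerval a b t' ->
  0 <= u <= 1 -> ointerval a b (t + u * (t' - t)).
Proof.
rewrite /ointerval /=; move=> /andP[h1 h2] /andP[h3 h4] /andP[u0 u1].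
have [c1 c2] : Num.min t t' <= t + u * (t' - t) /\ t + u * (t' - t) <= Num.max t t'.
  have u1' : 0 <= 1 - u by rewrite subr_ge0.
  have [tt|tt] := leP t t'.
    have k1 : 0 <= u * (t' - t) by rewrite mulr_ge0 // subr_ge0.
    have k2 : 0 <= (1 - u) * (t' - t) by rewrite mulr_ge0 // subr_ge0.
    by split; lra.
  have k1 : 0 <= u * (t - t') by rewrite mulr_ge0 // subr_ge0 ltW.
  have k2 : 0 <= (1 - u) * (t - t') by rewrite mulr_ge0 // subr_ge0 ltW.
  by split; lra.
apply/andP; split.
- case: a h1 h3 => [a| |] // h1 h3; last by rewrite ltNyr.
  by rewrite !lte_fin in h1 h3 *; apply: lt_le_trans c1; rewrite lt_min h1.
- case: b h2 h4 => [b| |] // h2 h4; last by rewrite ltry.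
  by rewrite !lte_fin in h2 h4 *; apply: (le_lt_trans c2); rewrite gt_max h2.
Qed.

Definition strip a b : set R[i] := [set s | ointerval a b (Re s)].

Lemma open_strip a b : open (strip a b).
Proof.
apply/open_normcP => s /ointerval_nbhs[e e0 he]; exists e => // y ys.
by apply: he; rewrite -complex_ReB (le_lt_trans (Re_le_normc _)).
Qed.

Lemma star_strip a b s : strip a b s -> star_shaped s (strip a b).
Proof.
move=> hs x t hx t01; rewrite /strip /= complex_ReD complex_ReM /= mul0r subr0.
by rewrite complex_ReB; exact: ointerval_convex.
Qed.

Definition annulus a b : set R[i] :=
  [set u | u != 0 /\ ointerval a b (ln (normc u))].

Lemma lnnormE f z : f z != 0 -> lnnorm f z = (ln (normc (f z)))%:E.
Proof. by move=> fz; rewrite /lnnorm lne_EFin // normc_gt0. Qed.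

Lemma level_annulus f z a b : (a < lnnorm f z < b)%E <-> annulus a b (f z).
Proof.
have [fz|fz] := eqVneq (f z) 0.
  rewrite /lnnorm fz normc0 /= lexx; split; first by rewrite ltNge leNye.
  by rewrite /annulus /= => -[]; rewrite eqxx.
rewrite lnnormE // /annulus /= fz; split => [|[]]; by [].
Qed.

Lemma cexp_annulus a b s : strip a b s -> annulus a b (cexp s).
Proof.
by move=> Ss; split; [exact: cexp_neq0|rewrite normc_cexp expRK].
Qed.

Lemma annulus_strip a b s : annulus a b (cexp s) -> strip a b s.
Proof. by move=> [_]; rewrite normc_cexp expRK. Qed.

Lemma cvg_ln (u : R) : 0 < u -> ln x @[x --> u] --> ln u.
Proof. exact: continuous_ln. Qed.

Lemma open_annulus a b : open (annulus a b).
Proof.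
apply/open_normcP => u [u0 /ointerval_nbhs[e e0 he]].
have nu : 0 < normc u by rewrite normc_gt0.
have := cvg_ln nu; move=> /cvgrPdist_lt /(_ _ e0) /nbhs_ballP[d /= d0 hd].
exists (Num.min d (normc u)) => [|y]; first by rewrite lt_min d0.
rewrite lt_min => /andP[yd yu]; split.
  rewrite -normc_gt0; have := ler_dist_normc y u; rewrite ler_norml => /andP[h _]; lra.
apply: he; rewrite distrC; apply: hd; rewrite /ball /= distrC.
exact: le_lt_trans (ler_dist_normc _ _) yd.
Qed.

Lemma connected_ball z (r : R) : connected [set y | normc (y - z) < r].
Proof.
have [r0|r0] := leP r 0.
  rewrite (_ : [set y | _] = set0); first exact: connected0.
  by apply/seteqP; split => // y /= /(le_lt_trans (normc_ge0 _)); rewrite ltNge r0.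
rewrite (_ : [set y | _] = \bigcup_(y in [set y | normc (y - z) < r])
   ((fun t : R => z + t%:C * (y - z)) @` `[0, 1])).
  apply: bigcup_connected.
    exists z => y _; exists 0; rewrite /= ?in_itv /= ?lexx ?ler01 //.
    by rewrite mul0r addr0.
  move=> y _; apply: connected_continuous_connected; first exact: segment_connected.
  apply: continuous_subspaceT => t; apply: (pderiv_continuous (v := y - z)).
  exact: pderiv_line.
apply/seteqP; split => [y yr|_ [y yr [t t01 <-]]].
  exists y => //; exists 1; rewrite /= ?in_itv /= ?lexx ?ler01 //.
  by rewrite mul1r addrC subrK.
move: t01; rewrite /= in_itv /= => /andP[t0 t1].
rewrite addrAC subrr add0r normcM normcR ger0_norm //.
by apply: le_lt_trans yr; rewrite ler_piMl ?normc_ge0.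
Qed.

(** Balls are connected, so a component of A contains every ball in A around one
   of its points. *)
Lemma open_component (A : set R[i]) z : open A -> open (connected_component A z).
Proof.
move=> /open_normcP oA; apply/open_normcP => y Cy.
have [e e0 he] := oA y (connected_component_sub Cy).
exists e => // x xy; apply: (connected_component_trans Cy).
apply: (connected_component_max (B := [set x | normc (x - y) < e])) => //=.
- by rewrite normc_sub0.
- exact: connected_ball.
Qed.

Lemma analytic_near (f g : R[i] -> R[i]) z :
  analytic_at f z -> (\forall x \near z, f x = g x) -> analytic_at g z.
Proof.
move=> [c hc] fg; exists c; near=> x.
have <- : f x = g x by near: x.
by near: x.
Unshelve. all: by end_near.
Qed.

Lemma analytic_derive1 f z : analytic_at f z ->
  sderiv f z (derive1 f z) /\ analytic_at (derive1 f) z.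
Proof.
move=> /analytic_sderiv[f1 af1 nf1]; split.
  by have h := nbhs_singleton nf1; rewrite (sderiv_derive1 h).
apply: (analytic_near af1); apply: filterS nf1 => x h.
by rewrite (sderiv_derive1 h).
Qed.

(** Uniqueness along the segment from s1 to s, which is compact. *)
Lemma lift_unique_on F U X G S p q s1 : uniform_covering F U X ->
  star_shaped s1 S -> S s1 -> (forall s, S s -> X (G s)) ->
  (forall s, S s -> G @ nbhs s --> G s) ->
  (forall s, S s -> U (p s)) ->
  (forall s, S s -> F (p s) = G s) -> (forall s, S s -> F (q s) = G s) ->
  (forall s, S s -> p @ nbhs s --> p s) -> (forall s, S s -> q @ nbhs s --> q s) ->
  p s1 = q s1 -> forall s, S s -> p s = q s.
Proof.
move=> cov star S1 GX cG pU pF qF cp cq pq s Ss.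
pose Q := (fun t : R => s1 + t%:C * (s - s1)) @` `[0, 1].
have QS x : Q x -> S x.
  by move=> [t /= + <-]; rewrite in_itv /= => t01; exact: star.
have cQ : compact Q.
  apply: continuous_compact; last exact: segment_compact.
  apply: continuous_subspaceT => t; apply: (pderiv_continuous (v := s - s1)).
  exact: pderiv_line.
have cJ : compact (G @` Q).
  apply: continuous_compact => //; apply/subspace_continuousP => x /QS /cG cx.
  exact: cvg_within_filter.
have [|d d0 hd] := cov _ cJ; first by move=> _ [x Qx <-]; exact/GX/QS.
apply: (@star_lift_unique _ F U Q s1 p q d) => //.
- move=> _ u [t + <-] /andP[u0 u1]; rewrite /= in_itv /= => /andP[t0 t1].
  exists (u * t); last by rewrite rmorphM /=; ring.
  by rewrite /= in_itv /= mulr_ge0 //= mulr_ile1.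
- by move=> x Qx; apply: hd; [exact/pU/QS|rewrite pF; [exists x|exact: QS]].
- by move=> x /QS Sx; rewrite pF // qF.
- by apply: cvg_cont_in => x /QS; exact: cp.
- by apply: cvg_cont_in => x /QS; exact: cq.
- exists 1; rewrite /= ?in_itv /= ?lexx ?ler01 //.
  by rewrite mul1r addrC subrK.
Qed.

End Uniformization.

(** * The lemniscate region as a covering of an annulus *)

Section Covering.
Context {R : realType}.
Implicit Types (s z : R[i]) (f psi : R[i] -> R[i]) (U D : set R[i]).
Implicit Types (a b : \bar R).

(** Properness of ln|f| gives properness of f: the moduli of the values in J form
   a compact set, and the part of U over J is closed in the compact part of U
   over those moduli. *)
Lemma lemniscate_proper D U f a b :
  lemniscate_region D U f a b -> regular_region U f ->
  [/\ open U, connected U, U !=set0,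
   (forall z, U z -> [/\ annulus a b (f z), sderiv f z (derive1 f z),
     analytic_at (derive1 f) z & derive1 f z != 0]) &
   forall J, compact J -> J `<=` annulus a b -> compact (U `&` f @^-1` J)].
Proof.
move=> [oD fD ab [z0 z0A ->] prop] reg.
set A := level_strip D f a b in z0A prop reg *.
have DA z : A z -> D z /\ annulus a b (f z) by move=> [Dz /level_annulus].
have df z : D z -> sderiv f z (derive1 f z) /\ analytic_at (derive1 f) z.
  by move=> /fD; exact: analytic_derive1.
have oA : open A.
  apply/open_normcP => z /DA[Dz fz].
  have nX : \forall y \near f z, annulus a b y.
    by move: (@open_annulus R a b); rewrite openE; apply.
  have nD : \forall y \near z, D y by move: oD; rewrite openE; apply.
  have nfX : \forall y \near z, annulus a b (f y).
    by apply: (sderiv_cvg (df z Dz).1); exact: nX.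
  have /nbhs_normcP[e e0 he] : \forall y \near z, D y /\ annulus a b (f y).
    by near=> y; split; near: y.
  by exists e => // y /he [Dy fy]; split => //; apply/level_annulus.
set U' := connected_component A z0 in prop reg *.
have UA : U' `<=` A by exact: connected_component_sub.
have oU : open U' by exact: open_component.
have cfU z : U' z -> f @ nbhs z --> f z.
  by move=> /UA/DA[Dz _]; exact: sderiv_cvg (df z Dz).1.
have main z : U' z -> [/\ annulus a b (f z), sderiv f z (derive1 f z),
     analytic_at (derive1 f) z & derive1 f z != 0].
  move=> Uz; have [Dz fz] := DA _ (UA _ Uz); have [h1 h2] := df z Dz.
  by split => //; have := reg z Uz; rewrite mulf_eq0 negb_or => /andP[].
split => //.
- exact: component_connected.
- by exists z0; exact: connected_component_refl.
move=> J cJ JX.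
pose K := (fun u => ln (normc u)) @` J.
have cK : compact K.
  apply: continuous_compact => //; apply/subspace_continuousP => u /JX [u0 _].
  apply: cvg_within_filter.
  have cn : normc x @[x --> u] --> normc u by exact: (@cvg_normc R _ (nbhs u) _ id u).
  by apply: (cvg_comp _ _ cn); apply: cvg_ln; rewrite normc_gt0.
have KI : K `<=` ointerval a b by move=> _ [u /JX[_ hu] <-].
pose L := [set z | U' z /\ exists2 t, K t & lnnorm f z = t%:E].
have cL : compact L by exact: prop.
have LU : U' `&` f @^-1` J `<=` L.
  move=> z [Uz Jz]; split => //; exists (ln (normc (f z))); first by exists (f z).
  by apply: lnnormE; case: (JX _ Jz).
apply: (subclosed_compact _ cL LU).
have hC := @norm_hausdorff R[i] R[i].
move=> z cz.
have Lz : L z.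
  by apply: (compact_closed hC cL); exact: (closureS LU).
have [Uz _] := Lz; split => //=.
apply: (compact_closed hC cJ) => B nB.
have [y [[_ Jy] By]] := cz _ (cfU z Uz _ nB).
by exists (f y).
Unshelve. all: by end_near.
Qed.

(** The map f in logarithmic coordinates: psi lifts exp through f, and n is the
   number of sheets.  Two translates of psi by multiples of 2 pi i agree at a
   point, by compactness of a fibre, hence everywhere, which gives the period.
   All lifts of exp have open images, two of which are equal or disjoint, so the
   image of psi is the whole of the connected set U. *)
Lemma lemniscate_uniformization D U f a b :
  lemniscate_region D U f a b -> regular_region U f ->
  exists (psi : R[i] -> R[i]) (n : nat), [/\ (0 < n)%N,
    (forall s, strip a b s -> U (psi s) /\ f (psi s) = cexp s),
    (forall s, strip a b s -> sderiv psi s (cexp s / derive1 f (psi s))),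
    (forall z, U z -> exists2 s, strip a b s & psi s = z) &
    (forall s s', strip a b s -> strip a b s' ->
       (psi s = psi s' <-> exists m : int, s = s' + (m * n%:Z)%:~R * two_pi_i))].
Proof.
move=> lem reg.
have [oU cU [z0 Uz0] hU prop] := lemniscate_proper lem reg.
have cov : uniform_covering f U (annulus a b).
  by apply: (@proper_uniform_covering _ f (derive1 f)) => // z /hU[].
pose S := strip a b.
have oS : open S by exact: open_strip.
have starS s : S s -> star_shaped s S by exact: star_strip.
have Xexp s : S s -> annulus a b (cexp s) by exact: cexp_annulus.
have cexpc s : cexp @ nbhs s --> cexp s by exact: sderiv_cvg (sderiv_cexp s).
pose lift psi := [/\ forall s, S s -> U (psi s),
    forall s, S s -> f (psi s) = cexp s & forall s, S s -> psi @ nbhs s --> psi s].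
have logS z s : U z -> cexp s = f z -> S s.
  by move=> /hU[fz _ _ _] sz; apply: (@annulus_strip R a b); rewrite sz.
have fneq0 z : U z -> f z != 0 by move=> /hU[[]].
have liftE z : U z -> exists psi s, [/\ lift psi, S s & psi s = z].
  move=> Uz; have [s0 hs0] := cexp_surjective (fneq0 z Uz).
  have Ss0 : S s0 := logS z s0 Uz hs0.
  have [psi [p1 p2 p3 p4]] := star_lift cov oS (starS s0 Ss0) Ss0
     (fun s _ => cexpc s) Xexp Uz (esym hs0).
  by exists psi, s0.
have liftU psi psi' s1 : lift psi -> lift psi' -> S s1 -> psi s1 = psi' s1 ->
    forall s, S s -> psi s = psi' s.
  move=> [p1 p2 p3] [q1 q2 q3] S1 pq.
  exact: (lift_unique_on cov (starS s1 S1) S1 Xexp (fun s _ => cexpc s)).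
have Re2 : Re (two_pi_i : R[i]) = 0 by [].
have SD s (k : int) : S s -> S (s + k%:~R * two_pi_i).
  rewrite /S /strip /= complex_ReD complex_ReM Re2 mulr0 sub0r.
  have kE : k%:~R = (k%:~R : R)%:C :> R[i] by rewrite rmorph_int.
  by rewrite kE /= mul0r oppr0 addr0.
have liftD psi (k : int) : lift psi -> lift (fun s => psi (s + k%:~R * two_pi_i)).
  move=> [p1 p2 p3]; split => [s Ss|s Ss|s Ss].
  - exact/p1/SD.
  - by rewrite p2 ?cexp_period //; exact: SD.
  - apply: (cvg_comp _ _ _ (p3 _ (SD s k Ss))).
    by apply: cvgD; [exact: cvg_id|exact: cvg_cst].
have sd psi s : lift psi -> S s -> sderiv psi s (cexp s / derive1 f (psi s)).
  move=> [p1 p2 p3] Ss; have [_ h1 _ h2] := hU _ (p1 s Ss).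
  apply: (sderiv_lift h2 h1 (sderiv_cexp s) (p3 s Ss)).
  have : \forall x \near s, S x by move: oS; rewrite openE; apply.
  by apply: filterS => x; exact: p2.
have [psi [s0 [lpsi Ss0 psi0]]] := liftE z0 Uz0.
have [p1 p2 p3] := lpsi.
(* the points u k lie in a compact fibre, where points closer than d coincide *)
have [n n0 hn] : exists2 n : nat, (0 < n)%N &
    forall s, S s -> psi (s + (n%:Z)%:~R * two_pi_i) = psi s.
  pose u (k : nat) := psi (s0 + (k%:Z)%:~R * two_pi_i).
  have Uu k : U (u k) by exact/p1/SD.
  have fu k : f (u k) = f z0.
    by rewrite /u p2 ?cexp_period; [rewrite -p2 ?psi0|exact: SD].
  have cfz : compact [set f z0] by exact: compact_set1.
  have fzX : [set f z0] `<=` annulus a b by move=> _ ->; case: (hU _ Uz0).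
  have [d d0 hd] := cov _ cfz fzX.
  have [|p [[Up fp] cp]] := prop _ cfz fzX (u @ \oo) _.
    by exists 0%N => // k _; split; [exact: Uu|exact: fu].
  have d2 : 0 < d / 2 by rewrite divr_gt0.
  have often N : exists2 k : nat, (N <= k)%N & normc (u k - p) < d / 2.
    have FA : (u @ \oo) [set w | exists2 k : nat, (N <= k)%N & w = u k].
      by exists N => // k Nk; exists k.
    have nB : nbhs (p : R[i]) [set w | normc (w - p) < d / 2].
      by apply/nbhs_normcP; exists (d / 2).
    by have [w [[k Nk ->] h]] := cp _ _ FA nB; exists k.
  have [k _ hk] := often 0%N; have [k' kk' hk'] := often k.+1.
  have uk : u k' = u k.
    have [_ inj _] := hd (u k) (Uu k) (fu k).
    have := inj (u k') (u k); rewrite !fu !normc_sub0.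
    have -> : normc (u k' - u k) < d.
      rewrite (le_lt_trans (ler_normc_trans p _ _)) // (splitr d) ltrD //.
      by rewrite normcB.
    move=> /(_ isT d0) h; apply/eqP; rewrite -subr_eq0 -normc_eq0 eq_le normc_ge0.
    by rewrite -(pmulr_rle0 _ d0) h.
  exists (k' - k)%N => [|s Ss]; first by rewrite subn_gt0.
  have := liftU _ _ s0 (liftD psi k'%:Z lpsi) (liftD psi k%:Z lpsi) Ss0 uk
     (s + (- k%:Z)%:~R * two_pi_i) (SD s _ Ss).
  rewrite -!addrA -!mulrDl -!rmorphD addNr mul0r addr0 /= => <-.
  by congr (psi (s + _%:~R * _)); rewrite -subzn ?(ltnW kk') // addrC.
(* the periods form a subgroup of int, with positive generator N *)
pose isper (k : int) := forall s, S s -> psi (s + k%:~R * two_pi_i) = psi s.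
have perD k k' : isper k -> isper k' -> isper (k + k').
  by move=> h h' s Ss; rewrite rmorphD mulrDl addrA h' ?h //; exact: SD.
have perN k : isper k -> isper (- k).
  move=> h s Ss; have := h _ (SD s (- k) Ss).
  by rewrite -addrA -mulrDl -rmorphD addNr mul0r addr0.
have perM k (m : nat) : isper k -> isper (k * m%:Z).
  move=> hk; elim: m => [|m IH]; first by move=> s _; rewrite mulr0 mul0r addr0.
  by rewrite -addn1 PoszD mulrDr mulr1; apply: perD.
have perMz k (m : int) : isper k -> isper (m * k).
  by rewrite mulrC; case: m => m hk; [exact: perM|rewrite NegzE mulrN; exact/perN/perM].
pose P (k : nat) := (0 < k)%N && `[< isper k%:Z >].
have exP : exists k, P k by exists n; rewrite /P n0; apply/asboolP.
pose N := ex_minn exP.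
have [N0 hN minN] : [/\ (0 < N)%N, isper N%:Z & forall k, P k -> (N <= k)%N].
  by rewrite /N; case: ex_minnP => m /andP[m0 /asboolP hm] h.
have per_dvd k : isper k -> exists m : int, k = m * N%:Z.
  move=> hk; exists (k %/ N)%Z.
  have hr : isper (k %% N)%Z.
    by rewrite /modz; apply: perD => //; exact/perN/perMz.
  have r0 : (0 <= k %% N)%Z by apply: modz_ge0; rewrite -lt0n.
  have rN : (k %% N)%Z < N%:Z by apply: ltz_pmod.
  rewrite {1}(divz_eq k N%:Z); suff -> : (k %% N)%Z = 0 by rewrite addr0.
  case: (k %% N)%Z r0 rN hr => // r _ rN hr.
  apply/eqP; rewrite eqz_nat -leqn0 leqNgt; apply/negP => r0.
  have Pr : P r by rewrite /P r0; apply/asboolP.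
  by have := minN r Pr; rewrite leqNgt -ltz_nat rN.
exists psi, N; split => //.
- by move=> s Ss; split; [exact: p1|exact: p2].
- by move=> s; exact: sd.
- move=> z Uz; apply: contrapT => nz.
  (* images of lifts are open, and two of them are equal or disjoint *)
  have imopen q s : lift q -> S s -> \forall y \near q s, exists2 s', S s' & q s' = y.
    move=> [q1 q2 q3] Ss; have [_ h1 _ h2] := hU _ (q1 s Ss).
    have [d d0 /nbhs_singleton hd] := sderiv_locally_invertible oU (q1 s Ss) h1 h2.
    have nS : \forall x \near s, S x /\ normc (q x - q s) < d.
      move/(cvg_normcP (FF := nbhs_filter s)): (q3 s Ss) => /(_ d d0).
      have : \forall x \near s, S x by move: oS; rewrite openE; apply.
      exact: filterS2.
    move: nS => /nbhs_normcP[r r0 hr].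
    have [e e0 /nbhs_singleton he] := sderiv_locally_invertible openT I
       (sderiv_cexp s) (cexp_neq0 s).
    have me0 : 0 < Num.min e r by rewrite lt_min e0.
    have me : 0 < e * Num.min e r by rewrite mulr_gt0.
    have := sderiv_cvg h1; rewrite q2 // => /(cvg_normcP (FF := nbhs_filter _)) /(_ _ me) nf.
    have nd : \forall y \near q s, normc (y - q s) < d by apply/nbhs_normcP; exists d.
    apply: filterS2 nf nd => y fy yd.
    have [_ _ sur] := he; have [|s' s's hs'] := sur _ _ me0 _ fy.
      by rewrite ge_min lexx.
    have [|Ss' qs'] := hr s'; first by apply: (lt_le_trans s's); rewrite ge_min lexx orbT.
    exists s' => //; have [_ inj _] := hd.
    have := inj _ _ qs' yd; rewrite q2 // hs' normc_sub0 pmulr_rle0 // => h.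
    by apply/eqP; rewrite -subr_eq0 -normc_eq0 eq_le h normc_ge0.
  pose V := [set z | exists2 s, S s & psi s = z].
  have oV : open V.
    by apply/open_normcP => y [s Ss <-]; apply/nbhs_normcP; exact: imopen.
  pose W := [set z | U z /\ ~ V z].
  have oW : open W.
    apply/open_normcP => y [Uy nVy]; apply/nbhs_normcP.
    have [q [s [lq Ss qs]]] := liftE y Uy; rewrite -qs.
    apply: filterS (imopen q s lq Ss) => x [s' Ss' <-]; split.
      by case: lq => q1 _ _; exact: q1.
    move=> [s'' Ss'' e]; apply: nVy; rewrite -qs.
    have [q1 q2 q3] := lq.
    have : cexp s'' = cexp s' by rewrite -p2 // e q2.
    move=> /cexp_eq[k hk]; exists (s + k%:~R * two_pi_i); first exact: SD.
    by apply: (liftU _ _ s' (liftD psi k lpsi) lq Ss') => //; rewrite -hk.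
  have UV : U `&` V = U.
    apply: cU; first by exists z0; split => //; exists s0.
      by exists V.
    exists (~` W); first exact: open_closedC.
    apply/seteqP; split => y [Uy h]; split => //; first by case.
    by apply: contrapT => nV; apply: h.
  by apply: nz; move: Uz; rewrite -UV => -[_ [s Ss <-]]; exists s.
- move=> s s' Ss Ss'; split => [e|[m ->]]; last by rewrite (perMz N%:Z m hN).
  have : cexp s = cexp s' by rewrite -p2 // e p2.
  move=> /cexp_eq[k hk].
  have [|m km] := per_dvd k; last by exists m; rewrite -km.
  move=> x Sx; apply: (liftU _ _ s' (liftD psi k lpsi) lpsi Ss') => //.
  by rewrite -hk.
Unshelve. all: by end_near.
Qed.

End Covering.

(** * Integrals over a segment *)

Section RealIntegral.
Context {R : realType}.
Implicit Types (g : R -> R) (T : R).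
Local Notation mu := (@lebesgue_measure R).

Definition rint T g : R := \int[mu]_(x in `[0, T]) g x.

Lemma continuous_integrable T g : continuous g -> mu.-integrable `[0, T] (EFin \o g).
Proof.
move=> cg; apply: continuous_compact_integrable; first exact: segment_compact.
exact: continuous_subspaceT.
Qed.

Lemma integral_EFin T g : continuous g ->
  (\int[mu]_(x in `[0%R, T]) (g x)%:E)%E = (rint T g)%:E.
Proof.
move=> /(@continuous_integrable T) gi; rewrite /rint /Rintegral fineK //.
exact: (integrable_fin_num _ gi).
Qed.

Lemma rintD T f g : continuous f -> continuous g ->
  rint T (fun x => f x + g x) = rint T f + rint T g.
Proof. by move=> cf cg; rewrite /rint RintegralD //; exact: continuous_integrable. Qed.

Lemma rintZ T c g : continuous g -> rint T (fun x => c * g x) = c * rint T g.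
Proof. by move=> cg; rewrite /rint RintegralZl //; exact: continuous_integrable. Qed.

Lemma rint_cst T c : 0 <= T -> rint T (fun=> c) = c * T.
Proof.
move=> T0; rewrite /rint Rintegral_cst //= lebesgue_measure_itv /= lte_fin.
by case: ltgtP T0 => // [T0|<-]; rewrite ?mulr0 // -EFinD subr0.
Qed.

Lemma le_rint T f g : continuous f -> continuous g ->
  (forall x, 0 <= x <= T -> f x <= g x) -> rint T f <= rint T g.
Proof.
move=> cf cg fg; apply: le_Rintegral; rewrite ?continuous_integrable //.
Qed.

Lemma normr_rint_le T g M : 0 <= T -> continuous g ->
  (forall x, 0 <= x <= T -> `|g x| <= M) -> `|rint T g| <= M * T.
Proof.
move=> T0 cg gM; have cc (c : R) : continuous (fun _ : R => c) by move=> x; exact: cvg_cst.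
rewrite ler_norml -mulNr -!(rint_cst _ T0).
by apply/andP; split; apply: le_rint => // x /gM; rewrite ler_norml => /andP[].
Qed.

Lemma rint_FTC T g (G : R -> R) : 0 < T -> continuous g ->
  (forall x : R, 0 <= x <= T -> is_derive x 1 G (g x)) -> rint T g = G T - G 0.
Proof.
move=> T0 cg dG.
have cG x : 0 <= x <= T -> G @ nbhs x --> G x.
  move=> /dG dx; have /derivable1_diffP h := @ex_derive _ _ _ _ _ _ _ dx.
  exact: (differentiable_continuous h).
have := @continuous_FTC2 R g G 0 T T0; rewrite (integral_EFin _ cg) => h.
suff : (rint T g)%:E = ((G T)%:E - (G 0)%:E)%E by rewrite -EFinB => -[].
have oo x : x \in `]0, T[ -> 0 <= x <= T.
  by rewrite in_itv /= => /andP[x0 xT]; rewrite !ltW.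
apply: h.
- exact: continuous_subspaceT.
- split.
  + by move=> x /oo /dG hx; exact: (@ex_derive _ _ _ _ _ _ _ hx).
  + by apply: cvg_at_right_filter; apply: cG; rewrite lexx ltW.
  + by apply: cvg_at_left_filter; apply: cG; rewrite lexx ltW.
- by move=> x /oo /dG hx; rewrite derive1E; exact: (@derive_val _ _ _ _ _ _ _ hx).
Qed.

(** The bound c is the base point of the integral that defines the primitive. *)
Lemma continuous_primitive g (c : R) : continuous g ->
  exists G : R -> R, forall x : R, c < x -> is_derive x 1 G (g x).
Proof.
move=> cg; exists (fun x => \int[mu]_(t in `[c, x]) g t) => x cx.
have xx1 : x < x + 1 by rewrite ltrDl.
have gi : mu.-integrable `[c, x + 1] (EFin \o g).
  apply: continuous_compact_integrable; first exact: segment_compact.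
  exact: continuous_subspaceT.
have [h1 h2] := @continuous_FTC1_closed R g c x (x + 1) xx1 gi cx (cg x).
by split; [exact: h1|rewrite -derive1E; exact: h2].
Qed.

End RealIntegral.

Section ComplexIntegral.
Context {R : realType}.
Implicit Types (f g : R -> R[i]) (T : R) (s z : R[i]).

Definition cint T g : R[i] :=
  rint T (fun x => Re (g x)) +i* rint T (fun x => Im (g x)).

Lemma continuousRe g : continuous g -> continuous (fun x => Re (g x)).
Proof. by move=> cg x; exact: cvg_Re (cg x). Qed.

Lemma continuousIm g : continuous g -> continuous (fun x => Im (g x)).
Proof. by move=> cg x; exact: cvg_Im (cg x). Qed.

Lemma ccontinuousM f g : continuous f -> continuous g -> continuous (fun x => f x * g x).
Proof. by move=> cf cg x; exact: cvg_cM (cf x) (cg x). Qed.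

Lemma ccontinuous_cst z : continuous (fun _ : R => z).
Proof. by move=> x; exact: cvg_cst. Qed.

Lemma ccontinuousZ z g : continuous g -> continuous (fun x => z * g x).
Proof. by move=> cg; apply: ccontinuousM cg; exact: ccontinuous_cst. Qed.

Lemma cvg_conjc (U : Type) (F : set_system U) {FF : Filter F} (f : U -> R[i]) (l : R[i]) :
  f @ F --> l -> (f x)^*%C @[x --> F] --> l^*%C.
Proof.
move=> fl; apply: cvg_ReIm.
  have e (z : R[i]) : Re z^*%C = Re z by case: z.
  rewrite e [X in X @ _](_ : _ = fun x => Re (f x)); first exact: cvg_Re.
  by apply/funext => x; rewrite e.
have e (z : R[i]) : Im z^*%C = - Im z by case: z.
rewrite e [X in X @ _](_ : _ = fun x => - Im (f x)).
  by apply: cvgN; exact: cvg_Im.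
by apply/funext => x; rewrite e.
Qed.

Lemma ccontinuousJ g : continuous g -> continuous (fun x => (g x)^*%C).
Proof. by move=> cg x; exact: cvg_conjc (cg x). Qed.

Lemma cintD T f g : continuous f -> continuous g ->
  cint T (fun x => f x + g x) = cint T f + cint T g.
Proof.
move=> cf cg; rewrite /cint.
have -> : (fun x => Re (f x + g x)) = fun x => Re (f x) + Re (g x).
  by apply/funext => x; rewrite complex_ReD.
have -> : (fun x => Im (f x + g x)) = fun x => Im (f x) + Im (g x).
  by apply/funext => x; rewrite complex_ImD.
by rewrite !rintD //; first [exact: continuousRe|exact: continuousIm].
Qed.

Lemma cintZ T z g : continuous g -> cint T (fun x => z * g x) = z * cint T g.
Proof.
move=> cg; rewrite /cint.
have cR := continuousRe cg; have cI := continuousIm cg.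
have cZ (c : R) (u : R -> R) : continuous u -> continuous (fun x => c * u x).
  by move=> cu x; apply: cvgM; [exact: cvg_cst|exact: cu].
have -> : (fun x => Re (z * g x)) =
    fun x => Re z * Re (g x) + (- Im z) * Im (g x).
  by apply/funext => x; rewrite complex_ReM mulNr.
have -> : (fun x => Im (z * g x)) =
    fun x => Re z * Im (g x) + Im z * Re (g x).
  by apply/funext => x; rewrite complex_ImM.
rewrite !rintD ?rintZ //; try exact: cZ.
by apply: complexP; rewrite ?complex_ReM ?complex_ImM /= ?mulNr.
Qed.

Lemma cintB T f g : continuous f -> continuous g ->
  cint T (fun x => f x - g x) = cint T f - cint T g.
Proof.
move=> cf cg; have [z zE] : exists z : R[i], z = -1 by exists (-1).
have cZ : continuous (fun x => z * g x) by apply: ccontinuousZ.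
have -> : (fun x => f x - g x) = (fun x => f x + z * g x).
  by apply/funext => x; rewrite zE mulN1r.
by rewrite (cintD _ cf cZ) (cintZ _ _ cg) zE mulN1r.
Qed.

Lemma cint_cst T z : 0 <= T -> cint T (fun=> z) = z * T%:C.
Proof.
move=> T0; rewrite /cint !rint_cst //.
by apply: complexP; rewrite ?complex_ReM ?complex_ImM /=; ring.
Qed.

(** The factor 2 comes from bounding the two components separately. *)
Lemma normc_cint_le T g M : 0 <= T -> continuous g ->
  (forall x, 0 <= x <= T -> normc (g x) <= M) -> normc (cint T g) <= 2 * M * T.
Proof.
move=> T0 cg gM; apply: (le_trans (normc_le_ReIm _)) => /=.
rewrite -mulrA mulr_natl mulr2n lerD // normr_rint_le //.
- exact: continuousRe.
- by move=> x xT; rewrite (le_trans (Re_le_normc _)) // gM.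
- exact: continuousIm.
- by move=> x xT; rewrite (le_trans (Im_le_normc _)) // gM.
Qed.

Lemma cint_FTC T g G : 0 < T -> continuous g ->
  (forall x, pderiv G x (g x)) -> cint T g = G T - G 0.
Proof.
move=> T0 cg dG; apply: complexP; rewrite ?complex_ReB ?complex_ImB /=.
  apply: (@rint_FTC R T _ (fun x => Re (G x))) => //; first exact: continuousRe.
  by move=> x _; have /pderivP[] := dG x.
apply: (@rint_FTC R T _ (fun x => Im (G x))) => //; first exact: continuousIm.
by move=> x _; have /pderivP[] := dG x.
Qed.

End ComplexIntegral.
Arguments ccontinuous_cst {R} z.
Arguments ccontinuousZ {R} z {g} cg.

(** * Cauchy's theorem for periodic functions on a strip *)

Section Cauchy.
Context {R : realType}.
Implicit Types (s z : R[i]) (phi : R[i] -> R[i]) (T : R).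
Implicit Types (a b : \bar R).

Definition vline s (x : R) : R[i] := s + x%:C * 'i.

Lemma strip_vline a b s x : strip a b s -> strip a b (vline s x).
Proof. by rewrite /strip /= complex_ReD complex_ReM /= mulr0 mul0r subr0 addr0. Qed.

Lemma pderiv_vline phi z s x : sderiv phi (vline s x) z ->
  pderiv (phi \o vline s) x (z * 'i).
Proof. by move=> h; apply: pderiv_comp_sderiv h _; exact: pderiv_line. Qed.

Lemma continuous_vline a b phi phi1 s : (forall z, strip a b z -> sderiv phi z (phi1 z)) ->
  strip a b s -> continuous (phi \o vline s).
Proof.
move=> h Ss x; apply: (pderiv_continuous (v := phi1 (vline s x) * 'i)).
by apply: pderiv_vline; apply: h; exact: strip_vline.
Qed.

Lemma strip_continuous_derivative a b phi phi1 z :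
  (forall z, strip a b z -> sderiv phi z (phi1 z)) -> strip a b z ->
  phi1 @ nbhs z --> phi1 z.
Proof.
move=> h Sz; apply: (sderiv_continuous_derivative _ (h z Sz)).
have : \forall y \near z, strip a b y by move: (@open_strip R a b); rewrite openE; apply.
by apply: filterS => y; exact: h.
Qed.

(** The derivative of the mean over a vertical segment is the mean of phi1, which
   vanishes because phi takes the same value at both ends of a period. *)
Lemma periodic_mean_cst a b phi phi1 T : 0 < T ->
  (forall s, strip a b s -> sderiv phi s (phi1 s)) ->
  (forall s, strip a b s -> phi (vline s T) = phi s) ->
  forall s s', strip a b s -> strip a b s' ->
    cint T (phi \o vline s) = cint T (phi \o vline s').
Proof.
move=> T0 dphi perphi.
have cphi s : strip a b s -> continuous (phi \o vline s).
  exact: (continuous_vline dphi).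
have cphi1 s : strip a b s -> continuous (phi1 \o vline s).
  move=> Ss x.
  have c1 : phi1 @ nbhs (vline s x) --> phi1 (vline s x).
    by apply: (strip_continuous_derivative dphi); exact: strip_vline.
  exact: (cvg_comp (vline s) phi1 (pderiv_continuous (@pderiv_line R s 'i x)) c1).
(* the linear term of the increment integrates to 0, and e' is e shared over the
   length T and the factor 2 of normc_cint_le *)
have key s (e : R) : strip a b s -> 0 < e -> exists2 d : R, 0 < d &
    forall s', normc (s' - s) < d ->
      normc (cint T (phi \o vline s') - cint T (phi \o vline s)) <= e * normc (s' - s).
  move=> Ss e0; pose e' := e / (2 * T).
  have e'0 : 0 < e' by rewrite divr_gt0 // mulr_gt0.
  have [||d d0 hd] := compact_uniform (K := `[0, T]) (P := fun x d => forall s',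
     normc (s' - s) < d -> normc (phi (vline s' x) - phi (vline s x)
        - phi1 (vline s x) * (s' - s)) <= e' * normc (s' - s)) (@segment_compact R 0 T).
  - by move=> x d d' h _ d'd s' /lt_le_trans /(_ d'd); exact: h.
  - move=> x _; have e2 : 0 < e' / 2 by rewrite divr_gt0.
    have Sx := strip_vline x Ss.
    have [d1 d10 h1] := dphi _ Sx _ e2.
    have := strip_continuous_derivative dphi Sx.
    move=> /(cvg_normcP (FF := nbhs_filter _)) /(_ _ e2) /nbhs_normcP[d2 d20 h2].
    pose d := Num.min d1 d2 / 2.
    have d0 : 0 < d by rewrite divr_gt0 // lt_min d10.
    have dd : d + d = Num.min d1 d2 by rewrite /d; field.
    exists d => //; apply/nbhs_ballP; exists d => // y; rewrite /ball /= => xy _ s' s's.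
    have vy : normc (vline s y - vline s x) < d.
      have -> : vline s y - vline s x = (y - x)%:C * 'i by rewrite /vline rmorphB; ring.
      by rewrite normcM normc_i mulr1 normcR distrC.
    have vs : vline s' y - vline s y = s' - s by rewrite /vline; ring.
    have b1 : normc (vline s' y - vline s x) < Num.min d1 d2.
      by rewrite -dd (le_lt_trans (ler_normc_trans (vline s y) _ _)) // vs ltrD.
    have b2 : normc (vline s y - vline s x) < Num.min d1 d2.
      by rewrite -dd (lt_trans vy) // ltrDl.
    move: b1 b2; rewrite !lt_min => /andP[b1 b1'] /andP[b2 b2'].
    have := h1 _ _ b1 b2; rewrite vs => k1; have k2 := h2 _ b2'.
    have -> : phi (vline s' y) - phi (vline s y) - phi1 (vline s y) * (s' - s) =
      (phi (vline s' y) - phi (vline s y) - phi1 (vline s x) * (s' - s)) -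
      (phi1 (vline s y) - phi1 (vline s x)) * (s' - s) by ring.
    apply: (le_trans (ler_normcB _ _)); rewrite normcM (splitr e') mulrDl lerD //.
    by rewrite ler_wpM2r ?normc_ge0 // ltW.
  have [r r0 hr] := (proj1 (open_normcP _)) (@open_strip R a b) s Ss.
  exists (Num.min d r) => [|s']; first by rewrite lt_min d0.
  rewrite lt_min => /andP[s'd s'r]; have Ss' := hr _ s'r.
  have c0 : cint T (fun x => (s' - s) * phi1 (vline s x)) = 0.
    rewrite cintZ; last exact: cphi1.
    have : cint T (fun x => 'i * phi1 (vline s x)) = phi (vline s T) - phi (vline s 0).
      apply: (@cint_FTC R T _ (phi \o vline s)) => // [|x].
        by apply: ccontinuousM; [exact: ccontinuous_cst|exact: cphi1].
      by rewrite mulrC; apply: pderiv_vline; apply: dphi; exact: strip_vline.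
    rewrite perphi // /vline mul0r addr0 subrr cintZ; last exact: cphi1.
    have inz : ('i : R[i]) != 0 by rewrite -normc_gt0 normc_i.
    by move=> /eqP; rewrite mulf_eq0 (negbTE inz) => /eqP ->; rewrite mulr0.
  have cm : continuous (fun x => (s' - s) * phi1 (vline s x)).
    by apply: ccontinuousM; [exact: ccontinuous_cst|exact: cphi1].
  have cb : continuous (fun x => phi (vline s' x) - phi (vline s x)).
    by move=> x; apply: cvgB; [exact: cphi|exact: cphi].
  have -> : cint T (phi \o vline s') - cint T (phi \o vline s) =
    cint T (fun x => phi (vline s' x) - phi (vline s x) - (s' - s) * phi1 (vline s x)).
    by rewrite -(cintB T (cphi _ Ss') (cphi _ Ss)) -[LHS]subr0 -c0 -(cintB T cb cm).
  have := @normc_cint_le R T (fun x => phi (vline s' x) - phi (vline s x)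
     - (s' - s) * phi1 (vline s x)) (e' * normc (s' - s)) (ltW T0) _ _.
  have -> : 2 * (e' * normc (s' - s)) * T = e * normc (s' - s).
    by rewrite /e'; field; rewrite gt_eqF.
  apply => [x|x xT]; first by apply: cvgB; [exact: cb|exact: cm].
  by rewrite [_ * phi1 _]mulrC; apply: hd => //=; rewrite in_itv.
move=> s s' Ss Ss'.
pose l (t : R) := s + t%:C * (s' - s).
have -> : s = l 0 by rewrite /l; ring.
have -> : s' = l 1 by rewrite /l; ring.
apply: (@pderiv0_cst R (fun t => cint T (phi \o vline (l t))) 0 1) => // t t01 e e0.
have Sl : strip a b (l t) by exact: star_strip.
pose M := normc (s' - s) + 1; have M0 : 0 < M := lip_gt0 _.
have [d d0 hd] := key (l t) (e / M) Sl (divr_gt0 e0 M0).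
exists (d / M) => [|x xt]; first by rewrite divr_gt0.
have lx : normc (l x - l t) <= `|x - t| * M.
  have -> : l x - l t = (x - t)%:C * (s' - s) by rewrite /l rmorphB; ring.
  by rewrite normcM normcR ler_wpM2l // lerDl.
rewrite mul0r subr0; apply: (le_trans (hd (l x) _)).
  by apply: (le_lt_trans lx); rewrite -ltr_pdivlMr.
apply: (le_trans (ler_wpM2l _ lx)); first by rewrite ltW // divr_gt0.
by rewrite mulrCA divfK ?gt_eqF // mulrC.
Qed.

End Cauchy.

(** * Fourier series of continuous functions *)

Section Fourier.
Context {R : realType}.
Implicit Types (f g r u v : R -> R[i]) (k l : int) (M N : nat) (z : R[i]).

(** Symmetric partial sums of two-sided series, which telescope. *)
Definition zsum (V : zmodType) M (F : int -> V) : V :=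
  F 0 + \sum_(0 <= j < M) (F j.+1%:Z + F (- j.+1%:Z)).

Lemma zsum0 (V : zmodType) (F : int -> V) : zsum 0 F = F 0.
Proof. by rewrite /zsum big_geq // addr0. Qed.

Lemma zsumS (V : zmodType) M (F : int -> V) :
  zsum M.+1 F = zsum M F + (F M.+1%:Z + F (- M.+1%:Z)).
Proof. by rewrite /zsum big_nat_recr //= addrA. Qed.

Lemma zsumD (V : zmodType) M (F G : int -> V) :
  zsum M (fun k => F k + G k) = zsum M F + zsum M G.
Proof.
elim: M => [|M IH]; first by rewrite !zsum0.
rewrite !zsumS IH.
have aux (p q r s t u : V) : p + q + (r + s + (t + u)) = p + (r + t) + (q + (s + u)).
  by rewrite (addrACA r) (addrACA p).
exact: aux.
Qed.

Lemma zsumN (V : zmodType) M (F : int -> V) : zsum M (fun k => - F k) = - zsum M F.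
Proof. by elim: M => [|M IH]; rewrite ?zsum0 // !zsumS IH !opprD. Qed.

Lemma zsumB (V : zmodType) M (F G : int -> V) :
  zsum M (fun k => F k - G k) = zsum M F - zsum M G.
Proof. by rewrite zsumD zsumN. Qed.

Lemma zsumZ (V : pzRingType) M (c : V) (F : int -> V) :
  zsum M (fun k => c * F k) = c * zsum M F.
Proof. by elim: M => [|M IH]; rewrite ?zsum0 // !zsumS IH !mulrDr. Qed.

Lemma zsum_telescope (V : zmodType) M (F : int -> V) :
  zsum M (fun k => F (k - 1) - F k) = F (- M.+1%:Z) - F M%:Z.
Proof.
elim: M => [|M IH]; first by rewrite zsum0 sub0r.
rewrite zsumS IH.
have -> : M.+1%:Z - 1 = M%:Z by rewrite -addn1 PoszD addrK.
have -> : - M.+1%:Z - 1 = - M.+2%:Z by rewrite -opprD -PoszD addn1.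
have aux (p q r t : V) : p - q + (q - r + (t - p)) = t - r.
  by rewrite !addrA addrNK addrAC [p - r - p]addrAC subrr sub0r addrC.
exact: aux.
Qed.

Lemma zsum_delta M z : zsum M (fun k => z * (k == 0)%:R) = z.
Proof.
elim: M => [|M IH]; first by rewrite zsum0 eqxx mulr1.
by rewrite zsumS IH oppr_eq0 /= !mulr0 !addr0.
Qed.

Variables (T omega : R).
Hypotheses (T0 : 0 < T) (omegaT : omega * T = pi *+ 2).

Definition expk k (x : R) : R[i] := cexp (0 +i* (k%:~R * omega * x)).

Lemma expkD k l x : expk (k + l) x = expk k x * expk l x.
Proof.
rewrite /expk -cexpD; congr cexp.
by apply: complexP; rewrite ?complex_ReD ?complex_ImD /= ?addr0 // intrD !mulrDl.
Qed.

Lemma expk0 x : expk 0 x = 1.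
Proof. by rewrite /expk !mul0r cexp0. Qed.

Lemma cexp_conj z : (cexp z)^*%C = cexp (z^*%C).
Proof.
case: z => x y; apply: complexP; rewrite /cexp /= cosN sinN; ring.
Qed.

Lemma expk_conj k x : (expk k x)^*%C = expk (- k) x.
Proof. by rewrite /expk cexp_conj /= mulrNz !mulNr. Qed.

Lemma expk_at0 k : expk k 0 = 1.
Proof. by rewrite /expk mulr0 cexp0. Qed.

Lemma cexp_int k : cexp (k%:~R * two_pi_i) = 1 :> R[i].
Proof. by rewrite -(add0r (_ * two_pi_i)) cexp_period cexp0. Qed.

Lemma int_two_pi_i k : k%:~R * two_pi_i = 0 +i* (k%:~R * (pi *+ 2)) :> R[i].
Proof.
have kE : k%:~R = (k%:~R : R)%:C :> R[i] by rewrite rmorph_int.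
by apply: complexP; rewrite kE ?complex_ReM ?complex_ImM /=; ring.
Qed.

Lemma expk_atT k : expk k T = 1.
Proof. by rewrite -(cexp_int k) /expk -mulrA omegaT int_two_pi_i. Qed.

Lemma pderiv_expk k x : pderiv (expk k) x ((0 +i* (k%:~R * omega)) * expk k x).
Proof.
pose q : R[i] := 0 +i* (k%:~R * omega).
have E y : 0 +i* (k%:~R * omega * y) = 0 + y%:C * q.
  by apply: complexP; rewrite ?complex_ReD ?complex_ImD ?complex_ReM ?complex_ImM /=; ring.
have -> : expk k = cexp \o (fun y : R => 0 + y%:C * q).
  by apply/funext => y; rewrite /expk E.
rewrite mulrC.
exact: pderiv_comp_sderiv (sderiv_cexp _) (pderiv_line _ _ _).
Qed.

Lemma continuous_expk k : continuous (expk k).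
Proof. by move=> x; exact: pderiv_continuous (pderiv_expk k x). Qed.

Arguments continuous_expk k : clear implicits.

Lemma conjcM (y z : R[i]) : (y * z)^*%C = y^*%C * z^*%C.
Proof. by case: y z => a b [c d]; apply: complexP; rewrite /=; ring. Qed.

Lemma conjcB (y z : R[i]) : (y - z)^*%C = y^*%C - z^*%C.
Proof. by case: y z => a b [c d]; apply: complexP; rewrite /=; ring. Qed.

Lemma cintJ g : continuous g -> cint T (fun x => (g x)^*%C) = (cint T g)^*%C.
Proof.
move=> cg; rewrite /cint /=.
have -> : (fun x => Re (g x)^*%C) = fun x => Re (g x).
  by apply/funext => x; case: (g x).
have -> : (fun x => Im (g x)^*%C) = fun x => -1 * Im (g x).
  by apply/funext => x; case: (g x) => p q; rewrite mulN1r.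
by rewrite rintZ ?mulN1r //; exact: continuousIm.
Qed.

(** The factor T^-1 makes the functions expk orthonormal. *)
Definition ip u v : R[i] := (T^-1)%:C * cint T (fun x => u x * (v x)^*%C).

Lemma ip_continuous u v : continuous u -> continuous v ->
  continuous (fun x => u x * (v x)^*%C).
Proof. by move=> cu cv; exact: (ccontinuousM cu (ccontinuousJ cv)). Qed.

Lemma ipC u v : continuous u -> continuous v -> ip v u = (ip u v)^*%C.
Proof.
move=> cu cv; rewrite /ip conjcM conjc_real -(cintJ (ip_continuous cu cv)).
congr (_ * cint T _); apply/funext => x.
by rewrite conjcM conjcK mulrC.
Qed.

Lemma ipBl u v w : continuous u -> continuous v -> continuous w ->
  ip (fun x => u x - v x) w = ip u w - ip v w.
Proof.
move=> cu cv cw.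
rewrite /ip -mulrBr -(cintB T (ip_continuous cu cw) (ip_continuous cv cw)).
by congr (_ * cint T _); apply/funext => x; rewrite mulrBl.
Qed.

Lemma ipZl z u v : continuous u -> continuous v ->
  ip (fun x => z * u x) v = z * ip u v.
Proof.
move=> cu cv; rewrite /ip mulrCA -(cintZ T z (ip_continuous cu cv)).
by congr (_ * cint T _); apply/funext => x; rewrite mulrA.
Qed.

(** The squared norm of ip, as a real number. *)
Definition energy g : R := T^-1 * rint T (fun x => normc (g x) ^+ 2).

Lemma continuous_sqr_normc g : continuous g -> continuous (fun x => normc (g x) ^+ 2).
Proof.
move=> cg x; rewrite /continuous_at expr2.
have cn : normc (g y) @[y --> x] --> normc (g x) by exact: (cvg_normc (cg x)).
exact: (@cvgM _ _ _ _ (fun y => normc (g y)) (fun y => normc (g y)) _ _ cn cn).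
Qed.

Lemma mulcJ z : z * z^*%C = (normc z ^+ 2)%:C.
Proof.
rewrite sqr_normc; case: z => x y /=; apply: complexP.
  by rewrite complex_ReM /=; ring.
by rewrite complex_ImM /=; ring.
Qed.

Lemma ip_energy g : continuous g -> ip g g = (energy g)%:C.
Proof.
move=> cg; rewrite /ip /energy rmorphM /=; congr (_ * _).
have -> : (fun x => g x * (g x)^*%C) = fun x => (normc (g x) ^+ 2)%:C.
  by apply/funext => x; exact: mulcJ.
by rewrite /cint /= rint_cst ?(ltW T0) // mul0r.
Qed.

Lemma energy_ge0 g : continuous g -> 0 <= energy g.
Proof.
move=> cg; rewrite mulr_ge0 ?invr_ge0 ?(ltW T0) //.
rewrite -[0](mul0r T) -(rint_cst 0 (ltW T0)); apply: le_rint => [x||x _].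
- exact: cvg_cst.
- exact: continuous_sqr_normc.
- exact: sqr_ge0.
Qed.

Lemma energy_le g (B : R) : continuous g ->
  (forall x, normc (g x) <= B) -> energy g <= B ^+ 2.
Proof.
move=> cg gB; rewrite /energy mulrC ler_pdivrMr // -(rint_cst _ (ltW T0)).
apply: le_rint => [|x|x _]; [exact: continuous_sqr_normc|exact: cvg_cst|].
by rewrite lerXn2r ?nnegrE ?normc_ge0 // (le_trans _ (gB x)) ?normc_ge0.
Qed.

Definition coef g k : R[i] := ip g (expk k).

Lemma coef_expk k l : coef (expk k) l = (k == l)%:R.
Proof.
have TT : T%:C != 0 :> R[i] by rewrite -normc_gt0 normcR gtr0_norm.
have E : (fun x => expk k x * (expk l x)^*%C) = expk (k - l).
  by apply/funext => x; rewrite expk_conj -expkD.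
rewrite /coef /ip E; have [->|kl] := eqVneq k l.
  rewrite subrr; have -> : expk 0 = fun=> 1 by apply/funext => x; rewrite expk0.
  by rewrite cint_cst ?(ltW T0) // mul1r fmorphV /= mulVf.
pose q : R[i] := 0 +i* ((k - l)%:~R * omega).
have om0 : omega != 0.
  apply/eqP => om0; move: omegaT; rewrite om0 mul0r => /esym/eqP.
  by rewrite mulrn_eq0 /= gt_eqF // pi_gt0.
have q0 : q != 0.
  by rewrite eq_complex /= eqxx mulf_neq0 // intr_eq0 subr_eq0.
have : cint T (fun x => q * expk (k - l) x) = expk (k - l) T - expk (k - l) 0.
  apply: cint_FTC => //; last exact: pderiv_expk.
  exact: (ccontinuousZ q (continuous_expk (k - l))).
rewrite expk_at0 expk_atT subrr (cintZ T q (continuous_expk (k - l))).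
by move=> /eqP; rewrite mulf_eq0 (negbTE q0) /= => /eqP ->; rewrite mulr0.
Qed.

Lemma coef_cst z k : coef (fun=> z) k = z * (k == 0)%:R.
Proof.
have -> : (fun _ : R => z) = fun x => z * expk 0 x.
  by apply/funext => x; rewrite expk0 mulr1.
rewrite /coef (ipZl z (continuous_expk (0)) (continuous_expk (k))).
by rewrite -/(coef _ _) coef_expk eq_sym.
Qed.

Lemma project_continuous r k z : continuous r ->
  continuous (fun x => r x - z * expk k x).
Proof.
move=> cr x; apply: cvgB; first exact: cr.
by apply: cvgM; [exact: cvg_cst|exact: continuous_expk].
Qed.

Lemma ip_project r k z v : continuous r -> continuous v ->
  ip (fun x => r x - z * expk k x) v = ip r v - z * ip (expk k) v.
Proof.
move=> cr cv; have ce : continuous (expk k) by exact: continuous_expk.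
by rewrite (ipBl cr (ccontinuousZ z ce) cv) (ipZl z ce cv).
Qed.

Lemma project_coef r k l : continuous r -> k != l ->
  coef (fun x => r x - coef r k * expk k x) l = coef r l.
Proof.
move=> cr kl; rewrite [LHS](ip_project _ _ cr (continuous_expk (l))).
by rewrite -/(coef (expk k) l) coef_expk (negbTE kl) mulr0 subr0.
Qed.

(** Pythagoras: what remains is orthogonal to expk k. *)
Lemma project_energy r k : continuous r ->
  energy (fun x => r x - coef r k * expk k x) = energy r - normc (coef r k) ^+ 2.
Proof.
move=> cr; have ce : continuous (expk k) by exact: continuous_expk. set c := coef r k.
have cp : continuous (fun x => r x - c * expk k x) := project_continuous cr.
have h0 : ip (expk k) (fun x => r x - c * expk k x) = 0.
  rewrite (ipC cp ce) (ip_project _ _ cr ce) -/(coef r k) -/(coef (expk k) k).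
  by rewrite coef_expk eqxx mulr1 subrr conjc0.
have h1 : ip r (fun x => r x - c * expk k x) = ip r r - c * c^*%C.
  rewrite (ipC cp cr) (ip_project _ _ cr cr) conjcB (conjcM c).
  by rewrite -(ipC cr cr) -(ipC ce cr) -/(coef r k) -/c mulrC.
apply: complexI; rewrite -(ip_energy cp) (ip_project _ _ cr cp) h0 mulr0 subr0 h1.
by rewrite (ip_energy cr) mulcJ -rmorphB.
Qed.

Definition fourier_rem g M x : R[i] := g x - zsum M (fun k => coef g k * expk k x).

(** The projections are removed one at a time, and removing one leaves the other
   coefficients unchanged. *)
Lemma fourier_remP g M : continuous g ->
  [/\ continuous (fourier_rem g M),
      forall l, (M < `|l|)%N -> coef (fourier_rem g M) l = coef g l &
      energy (fourier_rem g M) = energy g - zsum M (fun k => normc (coef g k) ^+ 2)].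
Proof.
move=> cg; elim: M => [|M [c1 c2 c3]].
  have -> : fourier_rem g 0 = fun x => g x - coef g 0 * expk 0 x.
    by apply/funext => x; rewrite /fourier_rem zsum0.
  split; first exact: project_continuous.
    by move=> l l0; apply: (project_coef cg); rewrite eq_sym -absz_gt0.
  by rewrite (project_energy _ cg) zsum0.
pose r1 x := fourier_rem g M x - coef (fourier_rem g M) M.+1%:Z * expk M.+1%:Z x.
have cr1 : continuous r1 := project_continuous c1.
have nM : M.+1%:Z != - M.+1%:Z by [].
have e1 : coef r1 (- M.+1%:Z) = coef g (- M.+1%:Z).
  by rewrite (project_coef c1 nM) c2 // abszN.
have e0 : coef (fourier_rem g M) M.+1%:Z = coef g M.+1%:Z by rewrite c2.
have -> : fourier_rem g M.+1 = fun x => r1 x - coef r1 (- M.+1%:Z) * expk (- M.+1%:Z) x.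
  by apply/funext => x; rewrite e1 /r1 e0 /fourier_rem zsumS; ring.
split; first exact: project_continuous.
- move=> l Ml; rewrite (project_coef cr1); last first.
    by apply/eqP => lE; move: Ml; rewrite -lE abszN ltnn.
  rewrite (project_coef c1); last by apply/eqP => lE; move: Ml; rewrite -lE ltnn.
  by rewrite c2 // ltnW.
- by rewrite (project_energy _ cr1) e1 (project_energy _ c1) e0 c3 zsumS; ring.
Qed.

Lemma bessel g M : continuous g ->
  zsum M (fun k => normc (coef g k) ^+ 2) <= energy g.
Proof.
move=> cg; have [c1 _ c3] := fourier_remP M cg.
by rewrite -subr_ge0 -c3; exact: energy_ge0.
Qed.

(** Riemann-Lebesgue lemma, from Bessel's inequality. *)
Lemma coef_small g (e : R) : continuous g -> 0 < e -> exists N, forall M, (N <= M)%N ->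
  normc (coef g M.+1%:Z) < e /\ normc (coef g (- M.+1%:Z)) < e.
Proof.
move=> cg e0; pose u M := zsum M (fun k => normc (coef g k) ^+ 2).
have uS M : u M.+1 = u M + (normc (coef g M.+1%:Z) ^+ 2 + normc (coef g (- M.+1%:Z)) ^+ 2).
  exact: zsumS.
have ndu : nondecreasing_seq u.
  apply/nondecreasing_seqP => M; rewrite uS lerDl addr_ge0 ?sqr_ge0 //.
have : cvgn u.
  apply: nondecreasing_is_cvgn => //; exists (energy g) => _ [M _ <-].
  exact: bessel.
move=> /cvg_ex[l /cvgrPdist_lt ul].
have e2 : 0 < e ^+ 2 / 2 by rewrite divr_gt0 // exprn_gt0.
have [N _ hN] := ul _ e2; exists N => M NM.
have h1 : `|l - u M| < e ^+ 2 / 2 := hN M NM.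
have h2 : `|l - u M.+1| < e ^+ 2 / 2 := hN M.+1 (leqW NM).
have h3 : u M.+1 - u M < e ^+ 2.
  by move: h1 h2; rewrite !ltr_norml => /andP[_ h1] /andP[h2 _]; lra.
have sq1 := sqr_ge0 (normc (coef g M.+1%:Z)).
have sq2 := sqr_ge0 (normc (coef g (- M.+1%:Z))).
have lt_sq z : normc z ^+ 2 < e ^+ 2 -> normc z < e.
  by rewrite ltr_pXn2r ?nnegrE ?normc_ge0 // ltW.
rewrite uS in h3.
by split; apply: lt_sq; apply: le_lt_trans h3; rewrite addrAC subrr add0r ?lerDl ?lerDr.
Qed.

(** Chernoff's argument: dividing the increment of g by expk 1 - 1 gives a
   continuous function q, so the partial sums of the Fourier series of g telescope
   to two coefficients of q, which tend to 0 by coef_small. *)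
Lemma fourier_pointwise g g1 : (forall x, pderiv g x (g1 x)) -> continuous g1 ->
  (forall x, expk 1 x = 1 -> g x = g 0) ->
  forall e : R, 0 < e -> exists N, forall M, (N <= M)%N ->
    normc (zsum M (coef g) - g 0) < e.
Proof.
move=> dg cg1 perg e e0.
have cg : continuous g by move=> x; exact: pderiv_continuous (dg x).
pose w : R[i] := 0 +i* (1%:~R * omega).
have om0 : omega != 0.
  apply/eqP => om0; move: omegaT; rewrite om0 mul0r => /esym/eqP.
  by rewrite mulrn_eq0 /= gt_eqF // pi_gt0.
have w0 : w != 0 by rewrite eq_complex /= eqxx mul1r.
have nw : 0 < normc w by rewrite normc_gt0.
pose q x := if expk 1 x == 1 then g1 x / w else (g x - g 0) / (expk 1 x - 1).
have qE x : g x - g 0 = q x * expk 1 x - q x.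
  rewrite /q; case: eqP => [E|/eqP E]; first by rewrite perg // E mulr1 !subrr.
  set v := (g x - g 0) / _; have -> : g x - g 0 = v * (expk 1 x - 1).
    by rewrite /v divfK // subr_eq0.
  by rewrite mulrBr mulr1.
have cq : continuous q.
  move=> x; have [E|E] := eqVneq (expk 1 x) 1; last first.
    have E1 : expk 1 x - 1 != 0 by rewrite subr_eq0.
    have ne : \forall y \near x, expk 1 y != 1.
      have /cvg_normcP h := continuous_expk 1 x.
      have nE : 0 < normc (expk 1 x - 1) by rewrite normc_gt0.
      apply: filterS (h _ nE) => y; rewrite normcB; apply: contraTneq => ->.
      by rewrite ltxx.
    have qx : q x = (g x - g 0) / (expk 1 x - 1) by rewrite /q (negbTE E).
    rewrite /continuous_at qx.
    have : (fun y => (g y - g 0) / (expk 1 y - 1)) @ x --> (g x - g 0) / (expk 1 x - 1).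
      have cA : (fun y => g y - g 0) @ x --> g x - g 0.
        by apply: cvgB; [exact: cg|exact: cvg_cst].
      have cB : (fun y => expk 1 y - 1) @ x --> expk 1 x - 1.
        have sub z : (fun y => expk 1 y - z) @ x --> expk 1 x - z.
          by apply: cvgB; [exact: continuous_expk|exact: cvg_cst].
        exact: sub.
      exact: (cvgM cA (cvgV E1 cB)).
    apply: cvg_trans; apply: near_eq_cvg.
    by apply: filterS ne => y hy; rewrite /q (negbTE hy).
  have qx : q x = g1 x / w by rewrite /q E eqxx.
  apply/cvg_normcP => d d0; rewrite qx.
  set v := g1 x.
  have nvw : 0 < normc v + normc w by rewrite ltr_wpDl ?normc_ge0.
(* near x both increments are replaced by their linear parts, of quotient
   v / w, up to a relative error controlled by eps *)
  pose eps := Num.min (normc w / 2) (d * normc w ^+ 2 / (4 * (normc v + normc w))).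
  have eps0 : 0 < eps.
    by rewrite lt_min !divr_gt0 ?mulr_gt0 ?exprn_gt0.
  have eps1 : eps <= normc w / 2 by rewrite /eps ge_min lexx.
  have eps2 : eps * (normc v + normc w) <= d * normc w ^+ 2 / 4.
    have : eps <= d * normc w ^+ 2 / (4 * (normc v + normc w)).
      by rewrite /eps ge_min lexx orbT.
    rewrite -(ler_pM2r nvw) => /le_trans; apply; rewrite le_eqVlt; apply/orP; left.
    by apply/eqP; field; rewrite gt_eqF.
  have [d1 d10 h1] := dg x _ eps0.
  have [d2 d20 h2] := pderiv_expk 1 x eps0.
  have /cvg_normcP /(_ _ (mulr_gt0 d0 nw)) h3 := cg1 x.
  have h4 : \forall y \near x, `|y - x| < Num.min d1 d2.
    apply/nbhs_ballP; exists (Num.min d1 d2); first by rewrite /= lt_min d10.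
    by move=> y; rewrite /ball /= distrC.
  apply: filterS2 h3 h4 => y h3; rewrite lt_min => /andP[y1 y2].
  rewrite /q; case: eqP => [Ey|/eqP Ey].
    rewrite -mulrBl normcM normcV ltr_pdivrMr //.
  have gx0 : g x = g 0 by exact: perg.
  have {h1} := h1 y y1; have {h2} := h2 y y2.
  rewrite E gx0 mulr1 -/w -/v; set B := expk 1 y - 1; set A := g y - g 0.
  set hh := (y - x)%:C; move=> hB hA.
  have B0 : B != 0 by rewrite subr_eq0.
  have nB : 0 < normc B by rewrite normc_gt0.
  have nh : normc hh = `|y - x| by rewrite normcR.
  have BL : normc w * `|y - x| / 2 <= normc B.
    have : normc (w * hh) <= normc B + normc (B - w * hh).
      have {1}-> : w * hh = B - (B - w * hh) by ring.
      exact: ler_normcB.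
    rewrite normcM nh => h; have := normr_ge0 (y - x); nra.
  have -> : A / B - v / w = ((A - v * hh) * w - (B - w * hh) * v) / (B * w).
    by field; rewrite B0 w0.
  rewrite normcM normcV ltr_pdivrMr; last by rewrite normcM mulr_gt0.
  have num : normc ((A - v * hh) * w - (B - w * hh) * v) <=
     eps * (normc v + normc w) * `|y - x|.
    apply: (le_trans (ler_normcB _ _)); rewrite !normcM.
    have i1 : normc (A - v * hh) * normc w <= eps * `|y - x| * normc w.
      by rewrite ler_wpM2r ?normc_ge0.
    have i2 : normc (B - w * hh) * normc v <= eps * `|y - x| * normc v.
      by rewrite ler_wpM2r ?normc_ge0.
    by lra.
  apply: (le_lt_trans num); rewrite normcM.
  have yx : 0 < `|y - x|.
    rewrite normr_gt0 subr_eq0; apply: contraNneq Ey => ->.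
    by rewrite E.
  have i3 : eps * (normc v + normc w) * `|y - x| <= d * normc w ^+ 2 / 4 * `|y - x|.
    by rewrite ler_wpM2r.
  have i4 : d * (normc w * `|y - x| / 2) * normc w <= d * normc B * normc w.
    by rewrite ler_wpM2r ?normc_ge0 // ler_wpM2l // ltW.
  have i5 : 0 < d * normc w ^+ 2 * `|y - x|.
    by rewrite !mulr_gt0 // exprn_gt0.
  have e5 : d * (normc w * `|y - x| / 2) * normc w = d * normc w ^+ 2 * `|y - x| / 2.
    by field.
  by lra.
have cqE : continuous (fun x => q x * expk 1 x).
  exact: (ccontinuousM cq (continuous_expk (1))).
have cf k : coef g k - g 0 * (k == 0)%:R = coef q (k - 1) - coef q k.
  have ck : continuous (expk k) by exact: continuous_expk.
  have cc : continuous (fun _ : R => g 0) by exact: ccontinuous_cst.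
  rewrite -coef_cst /coef -(ipBl cg cc ck).
  have -> : (fun x => g x - g 0) = fun x => q x * expk 1 x - q x.
    by apply/funext => x; exact: qE.
  rewrite (ipBl cqE cq ck); congr (_ - _).
  rewrite /ip; congr (_ * cint T _); apply/funext => x.
  by rewrite !expk_conj -mulrA -expkD opprB.
have e2 : 0 < e / 2 by rewrite divr_gt0.
have [N hN] := coef_small cq e2; exists N.+1 => -[//|M] NM.
have -> : zsum M.+1 (coef g) - g 0 = coef q (- M.+2%:Z) - coef q M.+1%:Z.
  rewrite -zsum_telescope -[in LHS](zsum_delta M.+1 (g 0)) -zsumB.
  by congr (zsum _ _); apply/funext => k; exact: cf.
apply: (le_lt_trans (ler_normcB _ _)); rewrite (splitr e) ltrD //.
  by have [_] := hN M.+1 (leqW NM).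
by have [] := hN M NM.
Qed.

End Fourier.
Arguments continuous_expk {R} omega k.

(** * Parseval's formula on a strip *)

Section StripParseval.
Context {R : realType}.
Implicit Types (s z : R[i]) (k : int) (M : nat) (a b : \bar R).

Lemma sderiv_scale (c : R[i]) z : sderiv (fun x => c * x) z c.
Proof.
move=> e e0; exists 1 => // x y _ _.
have -> : c * x - c * y - c * (x - y) = 0 by ring.
by rewrite normc0 mulr_ge0 ?normc_ge0 // ltW.
Qed.

Variables (T omega : R).
Hypotheses (T0 : 0 < T) (omega0 : 0 < omega) (omegaT : omega * T = pi *+ 2).
Variables (a b : \bar R) (h h1 : R[i] -> R[i]).
Hypotheses (dh : forall s, strip a b s -> sderiv h s (h1 s))
           (perh : forall s, strip a b s -> h (vline s T) = h s).

Local Notation expk := (expk omega).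
Local Notation coef := (coef T omega).

(** A power of the coordinate of an annulus, in logarithmic coordinates. *)
Definition monexp k s : R[i] := cexp ((k%:~R * omega)%:C * s).

Lemma sderiv_monexp k s : sderiv (monexp k) s (monexp k s * (k%:~R * omega)%:C).
Proof.
exact: (sderiv_comp (sderiv_scale (k%:~R * omega)%:C s) (sderiv_cexp _)).
Qed.

Lemma monexp_vline k s x : monexp k (vline s x) = monexp k s * expk k x.
Proof.
rewrite /monexp /expk -cexpD; congr cexp; rewrite /vline mulrDr; congr (_ + _).
by apply: complexP; rewrite ?complex_ReM ?complex_ImM /=; ring.
Qed.

Lemma monexpN k s : monexp k s * monexp (- k) s = 1.
Proof.
rewrite /monexp -cexpD; have -> : (k%:~R * omega)%:C * s + ((- k)%:~R * omega)%:C * s = 0.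
  by rewrite -mulrDl mulrNz mulNr -rmorphD subrr; apply: mul0r.
exact: cexp0.
Qed.

Lemma normc_monexp k s : normc (monexp k s) = expR (k%:~R * omega * Re s).
Proof. by rewrite /monexp normc_cexp complex_ReM /= mul0r subr0. Qed.

Lemma vlineD s x y : vline (vline s x) y = vline s (x + y).
Proof. by rewrite /vline rmorphD /=; ring. Qed.

Lemma vline0 s : vline s 0 = s.
Proof. by apply: complexP; rewrite ?complex_ReD ?complex_ImD ?complex_ReM ?complex_ImM /=; ring. Qed.

Lemma period_int s k : strip a b s -> h (vline s (k%:~R * T)) = h s.
Proof.
move=> Ss; have per : periodic (fun x => h (vline s x)) T.
  by move=> x; rewrite -vlineD perh //; exact: strip_vline.
by have := periodic_int 0 k per; rewrite add0r vline0.
Qed.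

Lemma continuous_h s : strip a b s -> continuous (h \o vline s).
Proof. exact: continuous_vline dh. Qed.

(** Up to the factor monexp k s, the coefficient is the mean over a period of the
   holomorphic function h s * monexp (- k) s, which is the same on every line. *)
Lemma coef_monexp : exists c : int -> R[i],
  forall s, strip a b s -> forall k, coef (h \o vline s) k = c k * monexp k s.
Proof.
have [[s0 S0]|ne] := pselect (exists s0, strip a b s0); last first.
  by exists (fun=> 0) => s Ss; case: ne; exists s.
pose phi k z := h z * monexp (- k) z.
exists (fun k => (T^-1)%:C * cint T (phi k \o vline s0)) => s Ss k.
have dphi z : strip a b z -> sderiv (phi k) z (h1 z * monexp (- k) z +
    h z * (monexp (- k) z * ((- k)%:~R * omega)%:C)).
  by move=> Sz; apply: sderivM; [exact: dh|exact: sderiv_monexp].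
have pphi z : strip a b z -> phi k (vline z T) = phi k z.
  move=> Sz; rewrite /phi perh // monexp_vline.
  by rewrite (expk_atT omegaT) mulr1.
rewrite (periodic_mean_cst T0 dphi pphi S0 Ss).
have -> : phi k \o vline s =
    fun x => monexp (- k) s * ((h \o vline s) x * (expk k x)^*%C).
  apply/funext => x; rewrite expk_conj.
  have -> : (phi k \o vline s) x = h (vline s x) * monexp (- k) (vline s x) by [].
  have -> : (h \o vline s) x = h (vline s x) by [].
  by rewrite monexp_vline mulrCA.
rewrite (cintZ T _ (ip_continuous (continuous_h Ss) (continuous_expk omega k))).
have cancel (t m i n : R[i]) : n * m = 1 -> t * (m * i) * n = t * i.
  by move=> nm; rewrite -[RHS]mul1r -nm; ring.
by rewrite (cancel _ _ _ _ (monexpN k s)).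
Qed.

(** From Bessel's inequality, with E + 1 as a bound for the square root of E. *)
Lemma coef_le g k : continuous g -> normc (coef g k) <= energy T g + 1.
Proof.
move=> cg; have E0 := energy_ge0 T0 cg.
have h2 : normc (coef g k) ^+ 2 <= energy T g.
  have := bessel T0 omegaT (`|k|)%N cg; apply: le_trans.
  have ge0 j : 0 <= normc (coef g j) ^+ 2 by exact: sqr_ge0.
  case kn: `|k|%N => [|n].
    by rewrite zsum0; move/eqP: kn; rewrite absz_eq0 => /eqP ->.
  rewrite zsumS; apply: (@le_trans _ _ (normc (coef g n.+1%:Z) ^+ 2 + normc (coef g (- n.+1%:Z)) ^+ 2)).
    case: k kn => m /=; first by move=> ->; rewrite lerDl.
    by move=> [->]; rewrite NegzE lerDr.
  by rewrite lerDr /zsum addr_ge0 ?sumr_ge0 // => j _; rewrite addr_ge0.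
have := normc_ge0 (coef g k); move: h2; set u := normc _; set E := energy _ _ in E0 *.
by move=> h2 u0; rewrite leNgt; apply/negP => Eu; nra.
Qed.

(** The coefficients on the lines at distance d to the right and to the left are
   bounded.  Going back to s multiplies those with k >= 0, seen from the right,
   and those with k < 0, seen from the left, by exp (- |k| omega d). *)
Lemma coef_geometric s : strip a b s ->
  exists B q : R, [/\ 0 < B, 0 < q, q < 1 &
    forall x k, normc (coef (h \o vline (vline s x)) k) <= B * q ^+ `|k|%N].
Proof.
move=> Ss; have [c hc] := coef_monexp.
have [r r0 hr] := (proj1 (open_normcP _)) (@open_strip R a b) s Ss.
pose d := r / 2; have d0 : 0 < d by rewrite divr_gt0.
have dr : d < r by rewrite ltr_pdivrMr // ltr_pMr // ltr1n.
have Sd (e : R) : `|e| = d -> strip a b (s + e%:C).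
  by move=> e_d; apply: hr; rewrite addrAC subrr add0r normcR e_d.
have Sp : strip a b (s + d%:C) by apply: Sd; rewrite gtr0_norm.
have Sm : strip a b (s + (- d)%:C) by apply: Sd; rewrite normrN gtr0_norm.
have Ep := energy_ge0 T0 (continuous_h Sp); have Em := energy_ge0 T0 (continuous_h Sm).
pose B := energy T (h \o vline (s + d%:C)) + energy T (h \o vline (s + (- d)%:C)) + 1.
pose q := expR (- (omega * d)).
have od : 0 < omega * d by rewrite mulr_gt0.
have qX n : q ^+ n = expR (n%:R * - (omega * d)).
  by rewrite /q -expRM_natl.
exists B, q; split => [|||x k]; first by rewrite /B; lra.
- exact: expR_gt0.
- by rewrite /q expR_lt1 oppr_lt0.
have Sx := strip_vline x Ss.
have E k' (e : R) : `|e| = d -> normc (coef (h \o vline (s + e%:C)) k') =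
     normc (coef (h \o vline (vline s x)) k') * expR (k'%:~R * omega * e).
  move=> e_d; rewrite (hc _ (Sd e e_d)) (hc _ Sx) [LHS]normcM.
  rewrite [normc (c k' * monexp k' (vline s x))]normcM !normc_monexp -[RHS]mulrA -expRD.
  have -> : Re (vline s x) = Re s.
    by rewrite complex_ReD complex_ReM /= mulr0 mul0r subr0 addr0.
  by rewrite complex_ReD /= -mulrDr.
have gen (e : R) : `|e| = d -> k%:~R * omega * e = (`|k|%N)%:R * (omega * d) ->
    normc (coef (h \o vline (s + e%:C)) k) <= B ->
    normc (coef (h \o vline (vline s x)) k) <= B * q ^+ `|k|%N.
  move=> e_d eE; rewrite E // eE qX mulrN expRN => hB.
  by rewrite ler_pdivlMr // expR_gt0.
case: k gen => n gen.
- apply: (gen d); rewrite ?gtr0_norm //; first by rewrite /= mulrA.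
  apply: (le_trans (coef_le _ (continuous_h Sp))); rewrite /B; lra.
- apply: (gen (- d)); rewrite ?normrN ?gtr0_norm //.
    by rewrite NegzE abszN /= mulrNz !mulNr mulrN opprK mulrA.
  apply: (le_trans (coef_le _ (continuous_h Sm))); rewrite /B; lra.
Qed.

Lemma zsum_geometric (B q : R) (F : int -> R[i]) : 0 < q -> q < 1 ->
  (forall k, normc (F k) <= B * q ^+ `|k|%N) -> forall M d,
  normc (zsum (M + d) F - zsum M F) <= 2 * B * q / (1 - q) * (q ^+ M - q ^+ (M + d)).
Proof.
move=> q0 q1 hF M; elim=> [|d IH]; first by rewrite addn0 !subrr normc0 mulr0.
rewrite addnS zsumS; set u := F _; set v := F _.
have -> : zsum (M + d) F + (u + v) - zsum M F = (zsum (M + d) F - zsum M F) + (u + v) by ring.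
have hu : normc u <= B * q ^+ (M + d).+1 := hF _.
have hv : normc v <= B * q ^+ (M + d).+1 by have := hF (- (M + d).+1%:Z); rewrite abszN.
apply: (le_trans (ler_normcD _ _)); apply: (le_trans (lerD IH (ler_normcD _ _))).
have e1 : 2 * B * q / (1 - q) * (q ^+ M - q ^+ (M + d).+1) =
  2 * B * q / (1 - q) * (q ^+ M - q ^+ (M + d)) + (B * q ^+ (M + d).+1 + B * q ^+ (M + d).+1).
  by rewrite (exprS q (M + d)); field; rewrite gt_eqF // subr_gt0.
by rewrite e1 lerD2l lerD.
Qed.

Lemma series_at s : strip a b s -> forall e : R, 0 < e -> exists N, forall M, (N <= M)%N ->
  normc (zsum M (coef (h \o vline s)) - h s) < e.
Proof.
move=> Ss e e0; have om0 : omega != 0 by rewrite gt_eqF.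
pose g1 x := h1 (vline s x) * 'i.
have [||x Ex|N hN] := @fourier_pointwise R T omega T0 omegaT (h \o vline s) g1 _ _ _ e e0.
- by move=> x; apply: pderiv_vline; apply: dh; exact: strip_vline.
- move=> x; apply: cvg_cM; last exact: cvg_cst.
  have c1 : h1 @ nbhs (vline s x) --> h1 (vline s x).
    by apply: (strip_continuous_derivative dh); exact: strip_vline.
  exact: (cvg_comp (vline s) h1 (pderiv_continuous (@pderiv_line R s 'i x)) c1).
- have [k] := cexp_eq1 Ex; rewrite int_two_pi_i => -[]; rewrite mul1r -omegaT => xk.
  have -> : x = k%:~R * T by apply: (mulfI om0); rewrite xk mulrCA.
  by rewrite /= period_int // vline0.
- by exists N => M /hN; rewrite /= vline0.
Qed.

(** Geometric decay of the coefficients and pointwise convergence make the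
   remainders of the Fourier series tend to 0 uniformly on a line, so their
   energies tend to 0 too; coef_monexp gives the dependence on the line. *)
Lemma strip_parseval : exists2 m : int -> R, (forall k, 0 <= m k) &
  forall s, strip a b s ->
    zsum M (fun k => m k * expR (k%:~R * (2 * omega) * Re s)) @[M --> \oo]
      --> energy T (h \o vline s).
Proof.
have [c hc] := coef_monexp.
exists (fun k => normc (c k) ^+ 2) => [k|s Ss]; first exact: sqr_ge0.
have ch := continuous_h Ss.
have [B [q [B0 q0 q1 hB]]] := coef_geometric Ss.
pose K := 2 * B * q / (1 - q).
have K0 : 0 < K by rewrite divr_gt0 ?subr_gt0 // !mulr_gt0.
have remle M x : normc (fourier_rem T omega (h \o vline s) M x) <= K * q ^+ M.
  have Sx := strip_vline x Ss.
  have -> : fourier_rem T omega (h \o vline s) M x =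
      h (vline s x) - zsum M (coef (h \o vline (vline s x))).
    rewrite /fourier_rem; congr (_ - zsum M _); apply/funext => k.
    by rewrite (hc _ Sx) (hc _ Ss) monexp_vline mulrA.
  apply/ler_addgt0Pr => e e0; have [N hN] := series_at Sx e0.
  have := hN (M + N)%N (leq_addl _ _); rewrite normcB => /ltW h2.
  apply: (le_trans (ler_normc_trans (zsum (M + N) (coef (h \o vline (vline s x)))) _ _)).
  rewrite addrC lerD //.
  apply: (le_trans (zsum_geometric q0 q1 (hB x) M N)).
  by rewrite ler_pM2l // gerBl exprn_ge0 // ltW.
have -> : (fun M => zsum M (fun k => normc (c k) ^+ 2 *
      expR (k%:~R * (2 * omega) * Re s))) =
    (fun M => energy T (h \o vline s) - energy T (fourier_rem T omega (h \o vline s) M)).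
  apply/funext => M; have [_ _ ->] := fourier_remP T0 omegaT M ch.
  rewrite opprB addrC subrK; congr (zsum M _); apply/funext => k.
  rewrite (hc _ Ss) normcM normc_monexp exprMn; congr (_ * _).
  by rewrite expr2 -expRD; congr expR; ring.
rewrite -[X in _ --> X]subr0; apply: cvgB; first exact: cvg_cst.
have qc : (K * q ^+ M) * (K * q ^+ M) @[M --> \oo] --> (0 : R).
  rewrite -(mul0r (0 : R)); have q00 : K * q ^+ M @[M --> \oo] --> (0 : R).
    rewrite -(mulr0 K); apply: cvgM; first exact: cvg_cst.
    by apply: cvg_expr; rewrite gtr0_norm.
  exact: (cvgM q00 q00).
apply: (squeeze_cvgr _ (cvg_cst 0) qc).
near=> M; have [cr _ _] := fourier_remP T0 omegaT M ch.
rewrite (energy_ge0 T0 cr) /= -expr2; exact: (energy_le T0 cr (remle M)).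
Unshelve. all: by end_near.
Qed.

End StripParseval.

(** * Arc length on a level set *)

Section LevelCurves.
Context {R : realType}.
Implicit Types (z s : R[i]) (x y t : R).

Lemma speedE (gamma : R -> R[i]) x v : pderiv gamma x v -> speed gamma x = normc v.
Proof.
move=> /pderivP[h1 h2]; rewrite /speed /re_part /im_part !derive1E.
rewrite (@derive_val _ _ _ _ _ _ _ h1) (@derive_val _ _ _ _ _ _ _ h2).
by rewrite -sqr_normc sqrtr_sqr ger0_norm // normc_ge0.
Qed.

Lemma curve_pderiv (l : R) (gamma : R -> R[i]) : simple_closed_curve l gamma ->
  exists2 v : R -> R[i], (forall x, pderiv gamma x (v x)) &
    continuous v /\ forall x, v x != 0.
Proof.
move=> [l0 per inj [[d1 c1] [d2 c2]] sp].
pose v x := derive1 (re_part gamma) x +i* derive1 (im_part gamma) x.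
have dv x : pderiv gamma x (v x).
  apply/pderivP; split; split => /=.
  - exact: d1.
  - by rewrite derive1E.
  - exact: d2.
  - by rewrite derive1E.
exists v => //; split => x.
  by apply: cvg_complex; [exact: c1|exact: c2].
by rewrite -normc_gt0 -(speedE (dv x)) lt_neqAle eq_sym sp sqrtr_ge0.
Qed.

(** The left-hand side has derivative G (x + P) - G x = 0. *)
Lemma periodic_primitive (G Q : R -> R) (P c : R) : 0 < P -> c < 0 ->
  continuous G -> (forall x, G (x + P) = G x) ->
  (forall x : R, c < x -> is_derive x 1 Q (G x)) ->
  forall x, c < x -> Q (x + P) - Q x = rint P G.
Proof.
move=> P0 c0 cG perG dQ x cx.
have hP : rint P G = Q P - Q 0.
  apply: rint_FTC => // y /andP[y0 _]; apply: dQ; exact: lt_le_trans y0.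
pose W y := Q (y + P) - Q y.
have dW (y : R) : c < y -> is_derive y 1 W 0.
  move=> cy; have cyP : c < y + P by rewrite ltr_wpDr // ltW.
  have dyP := dQ _ cyP; have dy := dQ _ cy.
  have ds : is_derive y 1 (fun u : R => u + P) 1.
    apply/is_derive_epsP => e e0; exists 1 => // u _.
    have -> : u + P - (y + P) - 1 * (u - y) = 0 by ring.
    by rewrite normr0 mulr_ge0 // ltW.
  have dc := @is_derive1_comp R Q (fun u => u + P) y _ _ dyP ds.
  have -> : (0 : R) = G (y + P) * 1 - G y by rewrite perG mulr1 subrr.
  exact: (is_deriveB dc dy).
have W0 : W 0 = rint P G by rewrite /W add0r hP.
rewrite -W0; change (W x = W 0).
have [x0|x0] := leP x 0.
  by apply: is_derive0_cst => // y /andP[xy _]; apply: dW; exact: lt_le_trans xy.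
symmetry; apply: is_derive0_cst; first exact: ltW.
by move=> y /andP[xy _]; apply: dW; exact: lt_le_trans xy.
Qed.

Lemma rint_double (G : R -> R) (P : R) : 0 < P -> continuous G ->
  (forall x, G (x + P) = G x) -> rint (P + P) G = 2 * rint P G.
Proof.
move=> P0 cG perG; have [Q dQ] := @continuous_primitive R G (-1) cG.
have m1 : (-1 : R) < 0 by rewrite oppr_lt0.
have h := periodic_primitive P0 m1 cG perG dQ.
have -> : rint (P + P) G = Q (P + P) - Q 0.
  apply: rint_FTC => //; first exact: addr_gt0.
  by move=> x /andP[x0 _]; apply: dQ; exact: lt_le_trans x0.
have h0 := h 0 m1; have hP := h P (lt_trans m1 P0).
by rewrite add0r in h0; lra.
Qed.

(* The data of lemniscate_uniformization on the level t, where f1 is the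
   derivative of f. *)
Variables (a b : \bar R) (U : set R[i]) (f f1 psi : R[i] -> R[i]) (n : nat) (t : R).
Hypotheses (n0 : (0 < n)%N) (ht : ointerval a b t).
Hypothesis cov : uniform_covering f U (annulus a b).
Hypothesis hf : forall z, U z ->
  [/\ annulus a b (f z), sderiv f z (f1 z), f1 @ nbhs z --> f1 z & f1 z != 0].
Hypothesis hpsi : forall s, strip a b s -> U (psi s) /\ f (psi s) = cexp s.
Hypothesis dpsi : forall s, strip a b s -> sderiv psi s (cexp s / f1 (psi s)).
Hypothesis surj : forall z, U z -> exists2 s, strip a b s & psi s = z.
Hypothesis hper : forall s s', strip a b s -> strip a b s' ->
  (psi s = psi s' <-> exists m : int, s = s' + (m * n%:Z)%:~R * two_pi_i).

Definition level_in_U : set R[i] := [set z | U z /\ normc (f z) = expR t].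

Definition level_curve x : R[i] := psi (vline t%:C x).

Definition level_period : R := n%:R * (pi *+ 2).

Let psi1 s := cexp s / f1 (psi s).

Let Gam := level_curve.
Let P := level_period.

Lemma level_period_gt0 : 0 < P.
Proof. by rewrite mulr_gt0 ?ltr0n // mulrn_wgt0 // pi_gt0. Qed.

Lemma strip_level x : strip a b (vline t%:C x).
Proof. by apply: strip_vline; exact: ht. Qed.

Lemma level_curveU x : U (Gam x).
Proof. by case: (hpsi (strip_level x)). Qed.

Lemma level_curveE x y : Gam x = Gam y <-> exists m : int, x = y + m%:~R * P.
Proof.
have PE (m : int) : (m * n%:Z)%:~R * (pi *+ 2) = m%:~R * P.
  by rewrite /P /level_period mulrA intrM.
split.
- move=> /(hper (strip_level x) (strip_level y)).1 [m]; rewrite int_two_pi_i PE => e.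
  exists m; have := congr1 (fun z => Im z) e.
  by rewrite /vline !complex_ImD !complex_ImM /= !mul0r !addr0 !mulr1 !add0r.
- move=> [m ->]; apply/(hper (strip_level _) (strip_level y)); exists m.
  rewrite int_two_pi_i PE; apply: complexP.
    by rewrite /vline !complex_ReD !complex_ReM /=; ring.
  by rewrite /vline !complex_ImD !complex_ImM /=; ring.
Qed.

Lemma level_curve_periodic x : Gam (x + P) = Gam x.
Proof. by apply/level_curveE; exists 1; rewrite mul1r. Qed.

Lemma level_curve_surj z : level_in_U z -> exists x, Gam x = z.
Proof.
move=> [Uz fz]; have [s Ss sz] := surj Uz.
have [_ fs] := hpsi Ss.
have Rs : Re s = t.
  by apply: expR_inj; rewrite -normc_cexp -fs sz.
exists (Im s); rewrite /Gam /level_curve -sz; congr (psi _).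
apply: complexP.
  by rewrite /vline !complex_ReD !complex_ReM /= Rs; ring.
by rewrite /vline !complex_ImD !complex_ImM /=; ring.
Qed.

Lemma level_curve_in x : level_in_U (Gam x).
Proof.
split; first exact: level_curveU.
have [_ ->] := hpsi (strip_level x).
by rewrite normc_cexp /vline complex_ReD complex_ReM /= mul0r mulr0 subr0 addr0.
Qed.

Lemma range_level_curve : range Gam = level_in_U.
Proof.
apply/seteqP; split => [_ [x _ <-]|z]; first exact: level_curve_in.
by move=> /level_curve_surj[x <-]; exists x.
Qed.

Lemma pderiv_level_curve x : pderiv Gam x (psi1 (vline t%:C x) * 'i).
Proof. by apply: pderiv_vline; apply: dpsi; exact: strip_level. Qed.

Lemma psi1_neq0 s : strip a b s -> psi1 s != 0.
Proof.
move=> Ss; have [Us _] := hpsi Ss; have [_ _ _ f10] := hf Us.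
by rewrite mulf_neq0 ?cexp_neq0 // invr_eq0.
Qed.

Lemma cvg_psi1 s : strip a b s -> psi1 @ nbhs s --> psi1 s.
Proof.
move=> Ss; have [Us _] := hpsi Ss; have [_ _ cf1 f10] := hf Us.
apply: cvg_cM; first exact: sderiv_cvg (sderiv_cexp s).
by apply: cvgV f10 _; exact: (cvg_comp psi f1 (sderiv_cvg (dpsi Ss)) cf1).
Qed.

Lemma continuous_psi1_line : continuous (fun x => psi1 (vline t%:C x)).
Proof.
move=> x.
exact: (cvg_comp (vline t%:C) psi1 (pderiv_continuous (@pderiv_line R t%:C 'i x))
  (cvg_psi1 (strip_level x))).
Qed.

Lemma level_curve_simple : simple_closed_curve P Gam.
Proof.
split.
- exact: level_period_gt0.
- by move=> x; exact: level_curve_periodic.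
- move=> x y; rewrite !in_itv /= => /andP[x0 xP] /andP[y0 yP] /level_curveE[m xy].
  have P0 := level_period_gt0.
  have m1 : m%:~R * P < 1 * P by lra.
  have m2 : - 1 * P < m%:~R * P by lra.
  move: m1 m2; rewrite !ltr_pM2r // -[1]/(1%:~R) -mulrNz !ltr_int => m1 m2.
  have m0 : m = 0 by lia.
  by rewrite xy m0 mul0r addr0.
- have dG x := (pderivP _ _ _).1 (pderiv_level_curve x).
  have c : continuous (fun x => psi1 (vline t%:C x) * 'i).
    by apply: ccontinuousM; [exact: continuous_psi1_line|exact: ccontinuous_cst].
  split; split.
  + by move=> x; have [h _] := dG x; exact: (@ex_derive _ _ _ _ _ _ _ h).
  + have -> : derive1 (re_part Gam) = fun x => Re (psi1 (vline t%:C x) * 'i).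
      apply/funext => x; have [h _] := dG x.
      by rewrite derive1E; exact: (@derive_val _ _ _ _ _ _ _ h).
    exact: continuousRe c.
  + by move=> x; have [_ h] := dG x; exact: (@ex_derive _ _ _ _ _ _ _ h).
  + have -> : derive1 (im_part Gam) = fun x => Im (psi1 (vline t%:C x) * 'i).
      apply/funext => x; have [_ h] := dG x.
      by rewrite derive1E; exact: (@derive_val _ _ _ _ _ _ _ h).
    exact: continuousIm c.
- move=> x; rewrite (speedE (pderiv_level_curve x)) normcM normc_i mulr1 normc_eq0.
  by apply: psi1_neq0; exact: strip_level.
Qed.

Section OneCurve.
Variables (l : R) (gamma : R -> R[i]).
Hypotheses (sgamma : simple_closed_curve l gamma)
           (gammaE : forall x, level_in_U (gamma x)).

(** Since |f| is constant along gamma, f' gamma' / f is purely imaginary.  Its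
   imaginary part kappa is the angular speed, the angle theta is a primitive, and
   uniqueness of path lifts identifies gamma with the level curve at theta. *)
Lemma curve_angle : exists (theta kappa : R -> R),
  [/\ forall x : R, 0 <= x -> is_derive x 1 theta (kappa x),
      continuous kappa,
      forall x, kappa x != 0,
      forall x, 0 <= x -> gamma x = Gam (theta x) &
      forall x, 0 <= x -> speed gamma x = `|kappa x| * normc (psi1 (vline t%:C (theta x)))].
Proof.
have [v dv [cv v0]] := curve_pderiv sgamma.
have gU x : U (gamma x) by case: (gammaE x).
have nf x : normc (f (gamma x)) = expR t by case: (gammaE x).
have f0 x : f (gamma x) != 0 by rewrite -normc_gt0 nf expR_gt0.
have cgam x : gamma @ nbhs x --> gamma x := pderiv_continuous (dv x).
have dF x : pderiv (f \o gamma) x (f1 (gamma x) * v x).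
  by have [_ h _ _] := hf (gU x); exact: pderiv_comp_sderiv h (dv x).
have cf1 x : f1 (gamma y) @[y --> x] --> f1 (gamma x).
  by have [_ _ h _] := hf (gU x); exact: (cvg_comp gamma f1 (cgam x) h).
have cF x : f (gamma y) @[y --> x] --> f (gamma x) := pderiv_continuous (dF x).
pose q x := f1 (gamma x) * v x / f (gamma x).
have cq : continuous q.
  move=> x; apply: cvg_cM; first exact: cvg_cM (cf1 x) (cv x).
  exact: cvgV (f0 x) (cF x).
pose kappa x := Im (q x).
have ck : continuous kappa by exact: continuousIm.
(* |f gamma| is constant, so its logarithmic derivative is purely imaginary *)
have Rq x : Re (q x) = 0.
  have /pderivP[h1 h2] := dF x.
  set F' := f1 (gamma x) * v x in h1 h2.
  pose N y := Re (f (gamma y)) * Re (f (gamma y)) +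
              Im (f (gamma y)) * Im (f (gamma y)).
  have NE y : N y = expR t ^+ 2.
    by rewrite /N -!expr2 -sqr_normc nf.
  have dN : is_derive x 1 N (2 * (Re (f (gamma x)) * Re F' +
                                  Im (f (gamma x)) * Im F')).
    apply: (is_derive_eq (is_deriveD (is_deriveM h1 h1) (is_deriveM h2 h2))).
    rewrite /GRing.scale /=; ring.
  have dN0 : is_derive x 1 N 0.
    have -> : N = cst (expR t ^+ 2) by apply/funext; exact: NE.
    exact: is_derive_cst.
  have := @derive_val _ _ _ _ _ _ _ dN; rewrite (@derive_val _ _ _ _ _ _ _ dN0).
  move=> /esym/eqP; rewrite mulf_eq0 pnatr_eq0 /= => /eqP e0.
  have -> : q x = F' * (f (gamma x))^-1 by [].
  case: (f (gamma x)) e0 (f0 x) => u w /= e0 _.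
  rewrite complex_ReM /=.
  have -> : Re F' * (u / (u ^+ 2 + w ^+ 2)) - Im F' * (- (w / (u ^+ 2 + w ^+ 2)))
    = (u * Re F' + w * Im F') / (u ^+ 2 + w ^+ 2) by ring.
  by rewrite e0 mul0r.
have qE x : q x = 0 +i* kappa x by apply: complexP; rewrite ?Rq.
have k0 x : kappa x != 0.
  have : q x != 0.
    have [_ _ _ f10] := hf (gU x).
    by rewrite !mulf_neq0 ?invr_eq0.
  by rewrite qE eq_complex /= eqxx.
have [x0 hx0] := level_curve_surj (gammaE 0).
have [K dK] := @continuous_primitive R kappa (-1) ck.
pose theta x := K x + (x0 - K 0).
have m1 (x : R) : 0 <= x -> -1 < x by apply: lt_le_trans; rewrite oppr_lt0.
have dth x : 0 <= x -> is_derive x (1 : R) theta (kappa x).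
  move=> /m1/dK dx; have h := is_deriveD dx (is_derive_cst (x0 - K 0) x 1).
  by apply: (is_derive_eq h); rewrite addr0.
have th0 : theta 0 = x0 by rewrite /theta addrC subrK.
have FE x : 0 <= x -> f (gamma x) = cexp (vline t%:C (theta x)).
  move=> xx0.
(* Q has derivative 0 and value 1 at 0 *)
  pose Q y := f (gamma y) * cexp (- vline t%:C (theta y)).
  have dE y : 0 <= y -> pderiv (fun y => cexp (- vline t%:C (theta y))) y
      (cexp (- vline t%:C (theta y)) * (- 'i * (kappa y)%:C)).
    move=> y0.
    have h : pderiv (fun u => - vline t%:C u) (theta y) (- 'i).
      have -> : (fun u => - vline t%:C u) = fun u => - t%:C + u%:C * - 'i.
        by apply/funext => u; rewrite /vline opprD mulrN.
      exact: pderiv_line.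
    exact: pderiv_comp_sderiv (sderiv_cexp _) (pderiv_comp h (dth y y0)).
  have dQ y : 0 <= y <= x -> pderiv Q y 0.
    move=> /andP[y0 _]; have /pderivP[h1 h2] := dF y; have /pderivP[h3 h4] := dE y y0.
    set F' := f1 (gamma y) * v y in h1 h2.
    set Ey := cexp (- vline t%:C (theta y)) in h3 h4 *.
    have F'E : F' = f (gamma y) * (0 +i* kappa y).
      by rewrite -qE /q mulrC divfK.
    set E' := Ey * _ in h3 h4.
    have z0 : F' * Ey + f (gamma y) * E' = 0.
      rewrite F'E /E'; have -> : - 'i * (kappa y)%:C = - (0 +i* kappa y) :> R[i].
        by apply: complexP; rewrite ?complex_ReM ?complex_ImM /=; ring.
      by ring.
    apply/pderivP; split.
    - have -> : (fun y => Re (Q y)) = (fun y => Re ((f \o gamma) y)) *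
          (fun y => Re (cexp (- vline t%:C (theta y)))) -
          (fun y => Im ((f \o gamma) y)) *
          (fun y => Im (cexp (- vline t%:C (theta y)))).
        by apply/funext => u; rewrite /Q complex_ReM.
      apply: (is_derive_eq (is_deriveB (is_deriveM h1 h3) (is_deriveM h2 h4))).
      rewrite -z0 complex_ReD !complex_ReM /GRing.scale /= -/Ey; ring.
    - have -> : (fun y => Im (Q y)) = (fun y => Re ((f \o gamma) y)) *
          (fun y => Im (cexp (- vline t%:C (theta y)))) +
          (fun y => Im ((f \o gamma) y)) *
          (fun y => Re (cexp (- vline t%:C (theta y)))).
        by apply/funext => u; rewrite /Q complex_ImM.
      apply: (is_derive_eq (is_deriveD (is_deriveM h1 h4) (is_deriveM h2 h3))).
      rewrite -z0 complex_ImD !complex_ImM /GRing.scale /= -/Ey; ring.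
  have Q0 : Q 0 = 1.
    have [_ e] := hpsi (strip_level x0); rewrite /Q th0 -hx0 /Gam /level_curve e.
    by rewrite -cexpD subrr cexp0.
  have := pderiv0_cst xx0 dQ; rewrite Q0 /Q cexpN => /esym h.
  by rewrite -[LHS](divfK (cexp_neq0 (vline t%:C (theta x)))) h mul1r.
have cth x : 0 <= x -> theta @ nbhs x --> theta x.
  move=> /dth dx; have /derivable1_diffP h := @ex_derive _ _ _ _ _ _ _ dx.
  exact: (differentiable_continuous h).
have gE x : 0 <= x -> gamma x = Gam (theta x).
  move=> xx0.
  have cJ : compact ((f \o gamma) @` `[0, x]).
    apply: continuous_compact; last exact: segment_compact.
    by apply: continuous_subspaceT => y; exact: cF.
  have [|d d0 hd] := cov cJ.
    by move=> _ [y _ <-]; case: (hf (gU y)).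
  apply: (@path_lift_unique R f U gamma (Gam \o theta) 0 x d) => //.
  - by move=> y y01; apply: hd; [exact: gU|exists y => //=; rewrite in_itv].
  - move=> y /andP[y0 _]; rewrite FE //.
    by have [_ ->] := hpsi (strip_level (theta y)).
  - apply/subspace_continuousP => y /=; rewrite in_itv /= => /andP[y0 _].
    apply: cvg_within_filter; apply: cvg_normc; apply: cvgB; first exact: cgam.
    have cG := pderiv_continuous (pderiv_level_curve (theta y)).
    exact: (cvg_comp theta Gam (cth y y0) cG).
  - by rewrite /= th0 hx0.
exists theta, kappa; split => // x xx0.
have vE : v x = q x * psi1 (vline t%:C (theta x)).
  have [_ _ _ f10] := hf (gU x).
  rewrite /q /psi1 -FE //; have -> : psi (vline t%:C (theta x)) = gamma x by rewrite gE.
  by field; rewrite f0 f10.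
rewrite (speedE (dv x)) vE normcM qE; congr (_ * _).
by rewrite /= expr0n add0r sqrtr_sqr.
Qed.

Variable g : R[i] -> R.
Hypothesis cg : forall z, U z -> g u @[u --> z] --> g z.

Let G x := g (Gam x) * normc (psi1 (vline t%:C x)).

Lemma continuous_density : continuous G.
Proof.
move=> x; apply: cvgM.
  have cG := pderiv_continuous (pderiv_level_curve x).
  exact: (cvg_comp Gam g cG (cg (level_curveU x))).
by apply: cvg_normc; exact: continuous_psi1_line.
Qed.

Lemma psi1_periodic x : psi1 (vline t%:C (x + P)) = psi1 (vline t%:C x).
Proof.
have e : psi (vline t%:C (x + P)) = psi (vline t%:C x) := level_curve_periodic x.
have [_ h1] := hpsi (strip_level (x + P)).
by have [_ h2] := hpsi (strip_level x); rewrite /psi1 -h1 -h2 e.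
Qed.

Lemma density_periodic x : G (x + P) = G x.
Proof. by rewrite /G level_curve_periodic psi1_periodic. Qed.

(** The angular speed kappa does not vanish, so the curve turns in one direction
   e, and by injectivity it turns exactly once.  It thus covers the level set, and
   the change of variables theta gives the integral over a period. *)
Lemma one_curve_integral :
  (forall z, level_in_U z -> exists x, gamma x = z) /\
  (\int[lebesgue_measure]_(x in `[0%R, l]) (g (gamma x) * speed gamma x)%:E)%E
    = (rint P G)%:E.
Proof.
have [theta [kappa [dth ck k0 gE spE]]] := curve_angle.
have [l0 per inj _ _] := sgamma.
have P0 := level_period_gt0.
have [e [e1 ek]] : exists e : R, (e = 1 \/ e = -1) /\ forall x, 0 < e * kappa x.
  have sgn x y : 0 < kappa x * kappa y.
    wlog xy : x y / x <= y.
      by move=> H; case: (leP x y) => [/H//|/ltW /H]; rewrite mulrC.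
    rewrite lt_neqAle eq_sym mulf_neq0 //= leNgt; apply/negP => neg.
    have [|c _ c0] := IVT (f := kappa) (v := 0) xy (continuous_subspaceT ck).
      have [kx|kx] := ltP 0 (kappa x).
        have ky : kappa y < 0 by move: neg; rewrite pmulr_rlt0.
        by rewrite ge_min le_max (ltW kx) (ltW ky) orbT.
      have {}kx : kappa x < 0 by rewrite lt_neqAle k0.
      have ky : 0 < kappa y by move: neg; rewrite nmulr_rlt0.
      by rewrite ge_min le_max (ltW kx) (ltW ky) orbT.
    by have := k0 c; rewrite c0 eqxx.
  have [p|p] := leP 0 (kappa 0).
    exists 1; split => [|x]; first by left.
    have := sgn 0 x; rewrite mul1r pmulr_rgt0 // lt_neqAle eq_sym k0; exact: p.
  exists (-1); split => [|x]; first by right.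
  by have := sgn 0 x; rewrite nmulr_rgt0 // mulN1r oppr_gt0.
have ee : e * e = 1 by case: e1 => ->; rewrite ?mulr1 ?mulrNN ?mul1r.
pose Th x := e * (theta x - theta 0).
have thE x : theta x = theta 0 + e * Th x by rewrite /Th mulrA ee mul1r addrC subrK.
have Th0 : Th 0 = 0 by rewrite /Th subrr mulr0.
have cth x : 0 <= x -> theta @ nbhs x --> theta x.
  move=> /dth dx; have /derivable1_diffP h := @ex_derive _ _ _ _ _ _ _ dx.
  exact: (differentiable_continuous h).
have cTh : {within `[0, l], continuous Th}.
  apply/subspace_continuousP => x /=; rewrite in_itv /= => /andP[x0 _].
  apply: cvg_within_filter; apply: cvgM; first exact: cvg_cst.
  by apply: cvgB; [exact: cth|exact: cvg_cst].
have dTh (x : R) : 0 <= x -> is_derive x 1 Th (e * kappa x).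
  move=> /dth dx; have := is_deriveB dx (is_derive_cst (theta 0) x 1).
  rewrite subr0 => h; exact: (is_derive_eq (is_deriveZ e h)).
have incTh x y : 0 <= x -> x < y -> y <= l -> Th x < Th y.
  move=> x0 xy yl; have [||c ci] := @MVT R Th (fun x => e * kappa x) x y xy.
  - by move=> u; rewrite in_itv /= => /andP[xu _]; apply: dTh; lra.
  - apply: continuous_subspaceW cTh => u /=; rewrite !in_itv /= => /andP[xu uy].
    by rewrite (le_trans x0 xu) (le_trans uy yl).
  - by move=> hc; rewrite -subr_gt0 hc mulr_gt0 // subr_gt0.
have ivt v : 0 <= v <= Th l -> exists2 x, 0 <= x <= l & Th x = v.
  move=> vl; have Tl : 0 <= Th l by case/andP: vl => v0; apply: le_trans.
  have [|c] := IVT (v := v) (ltW l0) cTh.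
    by rewrite Th0 min_l // max_r.
  by rewrite in_itv /= => cl hc; exists c.
have Thl : Th l = P.
  have e0 : Gam (theta l) = Gam (theta 0).
    by rewrite -!gE ?(ltW l0) // -[l]add0r per.
  have [m hm] := (level_curveE _ _).1 e0.
  have Tl0 : 0 < Th l by rewrite -Th0; apply: incTh.
  have TlE : Th l = e * m%:~R * P by rewrite /Th hm addrAC subrr add0r mulrA.
  have [k kE] : exists k : int, e * m%:~R = k%:~R.
    case: e1 => ->; first by exists m; rewrite mul1r.
    by exists (- m); rewrite mulN1r mulrNz.
  rewrite kE in TlE.
  have k1 : 0 < k by move: Tl0; rewrite TlE pmulr_lgt0 // ltr0z.
(* a second turn would bring gamma back to gamma 0 before the time l *)
  have [k1E|k2] : k = 1 \/ 2 <= k by lia.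
    by rewrite TlE k1E mul1r.
  have k2R : 2 <= k%:~R :> R by rewrite -[2]/(2%:~R) ler_int.
  have PT : P < Th l by rewrite TlE; nra.
  have [|x /andP[x0 xl] hx] := ivt P; first by rewrite (ltW P0) (ltW PT).
  have xl' : x < l.
    by rewrite lt_neqAle xl andbT; apply/negP => /eqP xE; move: PT; rewrite -hx xE ltxx.
  have x0' : x != 0.
    by apply/eqP => xE; move: P0; rewrite -hx xE Th0 ltxx.
  have : gamma x = gamma 0.
    rewrite !gE // thE hx; apply/level_curveE.
    case: e1 => ->; [exists 1|exists (-1)]; rewrite ?mul1r //.
  move=> /inj; rewrite !in_itv /= x0 xl' lexx l0 => /(_ isT isT) xE.
  by rewrite xE eqxx in x0'.
split.
- move=> z /level_curve_surj[x <-].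
  pose y := e * (x - theta 0); pose j := Num.floor (y / P).
  have j1 : j%:~R * P <= y by rewrite -ler_pdivlMr // floor_le.
  have j2 : y < j%:~R * P + P.
    rewrite -[X in _ + X]mul1r -mulrDl -ltr_pdivrMr //.
    by rewrite -[1]/(1%:~R) -rmorphD; exact: floorD1_gt.
  have [|u /andP[u0 ul] hu] := ivt (y - j%:~R * P); first by rewrite Thl; lra.
  exists u; rewrite gE // thE hu; apply/level_curveE.
  have -> : theta 0 + e * (y - j%:~R * P) = x + e * - (j%:~R * P).
    have -> : e * (y - j%:~R * P) = (e * e) * (x - theta 0) + e * - (j%:~R * P).
      by rewrite /y; ring.
    by rewrite ee; ring.
  case: e1 => ->; [exists (- j)|exists j]; first by rewrite mulrNz mul1r mulNr.
  by rewrite mulN1r opprK.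
- have cgam : continuous gamma.
    have [v dv _] := curve_pderiv sgamma.
    by move=> x; exact: pderiv_continuous (dv x).
  have csp : continuous (speed gamma).
    have [v dv [cv _]] := curve_pderiv sgamma.
    have -> : speed gamma = fun x => normc (v x).
      by apply/funext => x; exact: speedE (dv x).
    by move=> x; exact: cvg_normc (cv x).
  have cint' : continuous (fun x => g (gamma x) * speed gamma x).
    move=> x; apply: cvgM; last exact: csp.
    by apply: (cvg_comp gamma g (cgam x)); apply: cg; case: (gammaE x).
  rewrite (integral_EFin _ cint'); congr (_%:E).
(* c lies to the left of all the angles reached on [0, l] *)
  pose c := - `|theta 0| - P - 1.
  have c0 : c < 0 by rewrite /c; have := normr_ge0 (theta 0); lra.
  have [Q dQ] := @continuous_primitive R G c continuous_density.
  have Qper := periodic_primitive P0 c0 continuous_density density_periodic dQ.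
  have hth x : 0 <= x <= l -> c < theta x.
    move=> /andP[x0 xl].
    have h0 : 0 <= Th x.
      move: x0; rewrite le_eqVlt => /orP[/eqP <-|x0]; first by rewrite Th0.
      by rewrite -Th0 ltW //; apply: incTh.
    have h1 : Th x <= P.
      rewrite -Thl; move: xl; rewrite le_eqVlt => /orP[/eqP -> //|xl].
      by rewrite ltW //; apply: incTh.
    have := ler_norm (- theta 0); rewrite normrN /c (thE x).
    by case: e1 => ->; lra.
  have -> : rint l (fun x => g (gamma x) * speed gamma x) =
      e * Q (theta l) - e * Q (theta 0).
    apply: (@rint_FTC R l _ (fun x => e * Q (theta x))) => // x xl.
    have /andP[x0 _] := xl.
    have dQx := @is_derive1_comp R Q theta x _ _ (dQ _ (hth x xl)) (dth x x0).
    apply: (is_derive_eq (is_deriveZ e dQx)).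
    rewrite /GRing.scale /= /G spE // gE //.
    have -> : `|kappa x| = e * kappa x.
      have := ek x; case: e1 => ->; first by rewrite mul1r => /gtr0_norm.
      by rewrite mulN1r oppr_gt0 => /ltr0_norm.
    by ring.
  have h0 : c < theta 0 by apply: hth; rewrite lexx ltW.
  have hl : c < theta l by apply: hth; rewrite lexx ltW.
  rewrite (thE l) Thl in hl *.
  case: e1 hl => ->  hl.
  + by rewrite !mul1r Qper.
  + rewrite -(Qper _ hl); have -> : theta 0 + -1 * P + P = theta 0 by ring.
    by ring.
Qed.

End OneCurve.

(** In any description of the level set, each curve covers the whole of it, so
   there is only one. *)
Lemma level_arclength (g : R[i] -> R) : (forall z, U z -> g u @[u --> z] --> g z) ->
  is_arclength_integral level_in_U g
    (rint P (fun x => g (Gam x) * normc (psi1 (vline t%:C x))))%:E.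
Proof.
move=> cg; split.
  exists 1%N, (fun=> P), (fun=> Gam); split.
  - by move=> _; exact: level_curve_simple.
  - by move=> j k _ _ _; rewrite !ord1.
  - rewrite -range_level_curve; apply/seteqP; split => z; first by exists ord0.
    by move=> [j _].
move=> N l gam [sc disj EE].
have gE j x : level_in_U (gam j x) by rewrite EE; exists j => //; exists x.
have [j0 _] : exists2 j : 'I_N, True & range (gam j) (Gam 0).
  by have := level_curve_in 0; rewrite EE => -[j _ h]; exists j.
have only j : j = j0.
  have [cover _] := one_curve_integral (sc j0) (gE j0) cg.
  have [x hx] := cover _ (gE j 0).
  exact: (disj _ _ _ _ (esym hx)).
rewrite /curves_integral (bigD1 j0) //= big1 ?adde0; last first.
  by move=> j; rewrite (only j) eqxx.
by have [_ ->] := one_curve_integral (sc j0) (gE j0) cg.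
Qed.

End LevelCurves.

(** * The Stieltjes measure of a step function *)

Section StepMeasure.
Context {R : realType}.
Variables (m : int -> R) (nu : R).
Hypotheses (m0 : forall k, 0 <= m k) (nu0 : 0 < nu).

(** The summatory function of m, normalised to vanish at 0. *)
Definition summatory (k : int) : R :=
  match k with
  | Posz n => \sum_(0 <= j < n) m j.+1%:Z
  | Negz n => - \sum_(0 <= j < n.+1) m (- j%:Z)
  end.

Lemma summatoryS k : summatory (k + 1) = summatory k + m (k + 1).
Proof.
case: k => n.
  by rewrite -PoszD addn1 /= big_nat_recr.
case: n => [|n].
  by rewrite /= big_nat1 big_geq // addNr.
have -> : Negz n.+1 + 1 = Negz n by rewrite !NegzE; lia.
rewrite /= [in RHS]big_nat_recr //= opprD -addrA.
by have -> : Negz n = - n.+1%:Z by []; rewrite addNr addr0.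
Qed.

Lemma summatory_le k l : k <= l -> summatory k <= summatory l.
Proof.
move=> kl; have [n ->] : exists n : nat, l = k + n%:Z.
  by exists `|l - k|%N; lia.
elim: n => [|n IH]; first by rewrite addr0.
apply: (le_trans IH).
have -> : k + n.+1%:Z = k + n%:Z + 1 by rewrite -addrA -PoszD addn1.
by rewrite summatoryS lerDl.
Qed.

Definition step_fun (x : R) : R := summatory (Num.floor (x / nu)).

Lemma step_fun_nondecreasing : nondecreasing step_fun.
Proof.
move=> x y xy; apply: summatory_le; apply: le_floor.
by rewrite ler_pM2r // invr_gt0.
Qed.

Lemma step_fun_right_continuous : right_continuous step_fun.
Proof.
move=> x; pose k := Num.floor (x / nu).
have xk : x < (k + 1)%:~R * nu by rewrite -ltr_pdivrMr // floorD1_gt.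
have kx : k%:~R * nu <= x by rewrite -ler_pdivlMr // floor_le.
have ev : \forall y \near x^'+, step_fun x = step_fun y.
  near=> y; rewrite /step_fun; congr summatory; apply/esym/eqP.
  have xy : x < y by [].
  have yk : y < (k + 1)%:~R * nu by [].
  rewrite -/k; apply/eqP/floor_def.
  by rewrite ler_pdivlMr // ltr_pdivrMr // yk (le_trans kx) // ltW.
apply: cvg_trans (near_eq_cvg ev) _; exact: cvg_cst.
Unshelve. all: by end_near.
Qed.

Definition step_cumulative : cumulative R R :=
  HB.pack_for (cumulative R R) step_fun
    (isCumulative.Build R _ R step_fun step_fun_nondecreasing step_fun_right_continuous).

Local Notation mu := (lebesgue_stieltjes_measure step_cumulative).

Lemma step_measure_itvoc (u v : R) : u <= v ->
  mu `]u, v]%classic = (step_fun v - step_fun u)%:E.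
Proof.
move=> uv; rewrite /lebesgue_stieltjes_measure /measure_extension.
rewrite measurable_mu_extE /=; last exact: is_ocitv.
by rewrite wlength_itv_bnd.
Qed.

Lemma floor_lattice k (d : R) : 0 <= d -> d < nu -> Num.floor ((k%:~R * nu + d) / nu) = k.
Proof.
move=> d0 dn; apply: floor_def; rewrite ler_pdivlMr // ltr_pdivrMr //.
by rewrite lerDl d0 /= intrD mulrDl mul1r ltrD2l.
Qed.

Lemma step_fun_lattice k : step_fun (k%:~R * nu) = summatory k.
Proof. by rewrite /step_fun -[_ * nu]addr0 floor_lattice. Qed.

Let g (t x : R) : \bar R := (expR (x * t))%:E.

Lemma measurable_expRM t (D : set R) : measurable_fun D (g t).
Proof.
apply/measurable_EFinP; apply: measurable_funTS.
apply: continuous_measurable_fun => x.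
apply: continuous_comp; last exact: continuous_expR.
by apply: cvgM; [exact: cvg_id|exact: cvg_cst].
Qed.

Lemma expRM_ge0 t x : (0 <= g t x)%E.
Proof. by rewrite lee_fin expR_ge0. Qed.

(** All the mass between two consecutive lattice points sits at the right one. *)
Lemma step_integral_cell t (k : int) :
  (\int[mu]_(x in `]((k - 1)%:~R * nu)%R, (k%:~R * nu)%R]) g t x =
   (m k * expR (k%:~R * nu * t))%:E)%E.
Proof.
set u := (k - 1)%:~R * nu; set v := k%:~R * nu.
have uv : u + nu = v by rewrite /u /v intrD mulrDl mulrN1z mulNr mul1r subrK.
(* the open interval is a union of half-open ones on which step_fun is constant *)
pose B (j : nat) : set R := `]u, (v - nu / j.+1%:R)]%classic.
have nuj (j : nat) : 0 < nu / j.+1%:R /\ nu / j.+1%:R <= nu.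
  by rewrite divr_gt0 // ler_pdivrMr // ler_peMr ?ler1n // ltW.
have B0 j : mu (B j) = 0%E.
  have [h1 h2] := nuj j.
  rewrite step_measure_itvoc; last by rewrite lerBrDr -uv lerD2l.
  have -> : v - nu / j.+1%:R = (k - 1)%:~R * nu + (nu - nu / j.+1%:R) by rewrite -/u -uv; ring.
  rewrite {1}/step_fun floor_lattice ?subr_ge0 //; last by rewrite gtrBl.
  by rewrite step_fun_lattice subrr.
have mN : measurable (`]u, v[ : set R)%classic by exact: measurable_itv.
have N0 : mu `]u, v[%classic = 0%E.
  have -> : `]u, v[%classic = \bigcup_j B j.
    apply/seteqP; split => [x|x [j _]].
      rewrite /= in_itv /= => /andP[ux xv].
      have d0 : 0 < v - x by rewrite subr_gt0.
      have := @archi_boundP R (nu / (v - x)) (ltW (divr_gt0 nu0 d0)).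
      set N := Num.Def.archi_bound _ => hN.
      have xN : x <= v - nu / N.+1%:R.
        rewrite lerBrDr addrC -lerBrDr ler_pdivrMr // mulrC -ler_pdivrMr //.
        by rewrite ltW // (lt_le_trans hN) // ler_nat.
      by exists N; rewrite // /B /= in_itv /= ux xN.
    rewrite /B /= !in_itv /= => /andP[ux xv]; rewrite ux /=; apply: (le_lt_trans xv).
    by rewrite gtrBl; case: (nuj j).
  have mB j : measurable (B j) by exact: measurable_itv.
  apply/eqP; rewrite eq_le measure_ge0 andbT.
  have := @measure_sigma_subadditive _ _ _ mu (\bigcup_j B j) B mB _ (fun _ h => h).
  rewrite eseries0 // => [|j _ _]; last exact: B0.
  by apply; exact: bigcupT_measurable.
have mD : measurable (`]u, v] : set R)%classic by exact: measurable_itv.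
have uv' : u < v by rewrite -uv ltrDl.
have DN : `]u, v]%classic `\` `]u, v[%classic = [set v].
  apply/seteqP; split => [x [/=]|x /= ->]; rewrite !in_itv /=.
    move=> /andP[ux xv]; rewrite ux /= => /negP; rewrite -leNgt => vx.
    by apply/eqP; rewrite eq_le xv.
  by rewrite uv' lexx ltxx.
have mv : mu [set v] = (m k)%:E.
  have <- : mu `]u, v]%classic = (m k)%:E.
    rewrite step_measure_itvoc ?(ltW uv') // !step_fun_lattice.
    have := summatoryS (k - 1); rewrite subrK => ->.
    by rewrite addrC addKr.
  have mass (A : set R) : measurable A -> (\int[mu]_(x in A) cst 1%E x)%E = mu A.
    by move=> mA; rewrite integral_cst // mul1e.
  rewrite -(mass _ mD) -(mass _ (measurable_set1 v)) -DN; apply/esym.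
  apply: ge0_negligible_integral; [exact: mN|exact: mD|exact: measurable_cst| |exact: N0].
  by move=> x _; rewrite lee_fin ler01.
have -> : (\int[mu]_(x in `]u, v]) g t x = \int[mu]_(x in `]u, v] `\` `]u, v[) g t x)%E.
  apply: ge0_negligible_integral; [exact: mN|exact: mD|exact: measurable_expRM| |exact: N0].
  by move=> x _; exact: expRM_ge0.
rewrite DN (eq_integral (cst (expR (v * t))%:E)); last by move=> x; rewrite inE /= => ->.
transitivity ((expR (v * t))%:E * mu [set v])%E.
  by apply: integral_cst; exact: measurable_set1.
by rewrite mv -EFinM mulrC.
Qed.

Lemma step_integral_block t M :
  (\int[mu]_(x in `](- (M.+1%:R * nu))%R, (M%:R * nu)%R]) g t x =
   (zsum M (fun k => m k * expR (k%:~R * nu * t)))%:E)%E.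
Proof.
elim: M => [|M IH].
  rewrite zsum0 -step_integral_cell.
  have -> : (0 - 1)%:~R * nu = - (1%:R * nu) by rewrite sub0r mulrN1z mulN1r mulr1n mul1r.
  by have -> : 0%:~R * nu = 0%:R * nu by rewrite !mul0r.
have le1 (p q : nat) : (p <= q)%N -> p%:R * nu <= q%:R * nu.
  by move=> pq; rewrite ler_wpM2r ?(ltW nu0) // ler_nat.
have neg (p q : nat) : - (p%:R * nu) <= q%:R * nu.
  by rewrite (@le_trans _ _ 0) // ?oppr_le0 mulr_ge0 ?(ltW nu0).
have split3 (p q r s : R) : p <= q -> q <= r -> r <= s ->
   (\int[mu]_(x in `]p, s]) g t x = \int[mu]_(x in `]p, q]) g t x
     + (\int[mu]_(x in `]q, r]) g t x + \int[mu]_(x in `]r, s]) g t x))%E.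
  have split2 (p' q' r' : R) : p' <= q' -> q' <= r' ->
     (\int[mu]_(x in `]p', r']) g t x = \int[mu]_(x in `]p', q']) g t x
       + \int[mu]_(x in `]q', r']) g t x)%E.
    move=> pq qr; have -> : `]p', r']%classic = `]p', q']%classic `|` `]q', r']%classic.
      by apply: itv_bndbnd_setU; rewrite bnd_simp.
    apply: ge0_integral_setU.
    - exact: measurable_itv.
    - exact: measurable_itv.
    - exact: measurable_expRM.
    - by move=> x _; exact: expRM_ge0.
    - apply/disj_setPS => x [/=]; rewrite !in_itv /= => /andP[_ h1] /andP[h2 _].
      by move: (le_lt_trans h1 h2); rewrite ltxx.
  by move=> pq qr rs; rewrite (split2 p q s) ?(split2 q r s) // (le_trans qr).
rewrite (split3 _ (- (M.+1%:R * nu)) (M%:R * nu)) ?lerN2 ?le1 // IH zsumS.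
have -> : `](- (M.+2%:R * nu))%R, (- (M.+1%:R * nu))%R]%classic =
    `](((- M.+1%:Z) - 1)%:~R * nu)%R, ((- M.+1%:Z)%:~R * nu)%R]%classic.
  by rewrite -opprD -PoszD addn1 !mulrNz !mulNr.
have -> : `](M%:R * nu)%R, (M.+1%:R * nu)%R]%classic =
    `]((M.+1%:Z - 1)%:~R * nu)%R, (M.+1%:Z%:~R * nu)%R]%classic.
  by have -> : M.+1%:Z - 1 = M%:Z by rewrite -addn1 PoszD addrK.
rewrite !step_integral_cell -!EFinD; congr (_%:E); ring.
Qed.

(** The blocks ]-(M + 1) nu, M nu] exhaust the line and carry the symmetric
   partial sums, so monotone convergence applies. *)
Lemma step_stieltjes t (L : R) :
  zsum M (fun k => m k * expR (k%:~R * nu * t)) @[M --> \oo] --> L ->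
  mu.-integrable setT (fun x => (expR (x * t))%:E) /\
  (\int[mu]_(x in setT) (expR (x * t))%:E)%E = L%:E.
Proof.
move=> cL.
pose F (M : nat) : set R := `](- (M.+1%:R * nu)), (M%:R * nu)]%classic.
have ndF : nondecreasing_seq F.
  apply/nondecreasing_seqP => M; rewrite subsetEset => x; rewrite /F /= !in_itv /=.
  move=> /andP[h1 h2]; apply/andP; split.
    by apply: le_lt_trans h1; rewrite lerN2 ler_wpM2r ?(ltW nu0) // ler_nat.
  by apply: (le_trans h2); rewrite ler_wpM2r ?(ltW nu0) // ler_nat.
have FT : \bigcup_M F M = setT.
  apply/seteqP; split => // x _.
  have := @archi_boundP R (`|x| / nu) (divr_ge0 (normr_ge0 _) (ltW nu0)).
  set N := Num.Def.archi_bound _; rewrite ltr_pdivrMr // => hN.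
  exists N => //; rewrite /F /= in_itv /=; apply/andP; split.
    rewrite ltrNl (le_lt_trans (ler_norm _)) // normrN (lt_le_trans hN) //.
    by rewrite ler_wpM2r ?(ltW nu0) // ler_nat.
  by rewrite (le_trans (ler_norm _)) // ltW.
have IL : (\int[mu]_(x in setT) g t x)%E = L%:E.
  have c1 : (\int[mu]_(x in F M) g t x)%E @[M --> \oo] --> (\int[mu]_(x in setT) g t x)%E.
    rewrite -FT; apply: ge0_nondecreasing_set_cvg_integral => [|M|M|M x _].
    - exact: ndF.
    - exact: measurable_itv.
    - exact: measurable_expRM.
    - exact: expRM_ge0.
  have c2 : (\int[mu]_(x in F M) g t x)%E @[M --> \oo] --> L%:E.
    have -> : (fun M => \int[mu]_(x in F M) g t x)%E =
        EFin \o (fun M => zsum M (fun k => m k * expR (k%:~R * nu * t))).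
      by apply/funext => M; exact: step_integral_block.
    by apply: cvg_EFin => //; near=> M.
  exact: (cvg_unique _ c1 c2).
split => //; apply/integrableP; split; first exact: measurable_expRM.
have -> : (fun x => `|(expR (x * t))%:E|)%E = g t.
  by apply/funext => x; rewrite abse_EFin ger0_norm // expR_ge0.
by rewrite IL ltry.
Unshelve. all: by end_near.
Qed.

End StepMeasure.

(** * Holomorphic square roots on a strip *)

Section SquareRoot.
Context {R : realType}.
Implicit Types (s z : R[i]) (a b : \bar R).

Lemma sderiv_sqr z : sderiv (fun x => x ^+ 2) z (2 * z).
Proof.
move=> e e0; have e2 : 0 < e / 2 by rewrite divr_gt0.
exists (e / 2) => // x y xz yz.
have -> : x ^+ 2 - y ^+ 2 - 2 * z * (x - y) = ((x - z) + (y - z)) * (x - y) by ring.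
rewrite normcM ler_wpM2r ?normc_ge0 // (le_trans (ler_normcD _ _)) //.
by rewrite (splitr e) ltW // ltrD.
Qed.

(** Lift phi through the squaring map of the nonzero numbers. *)
Lemma strip_sqrt a b (phi : R[i] -> R[i]) :
  (forall s, strip a b s -> phi s != 0) ->
  (forall s, strip a b s -> exists B, sderiv phi s B) ->
  exists H, forall s, strip a b s ->
    [/\ H s ^+ 2 = phi s, H s != 0 & exists B, sderiv H s B].
Proof.
move=> phi0 dphi.
have [[s0 S0]|ne] := pselect (exists s0, strip a b s0); last first.
  by exists id => s Ss; case: ne; exists s.
have cphi s : strip a b s -> phi @ nbhs s --> phi s.
  by move=> /dphi[B]; exact: sderiv_cvg.
have [u hu] := cexp_surjective (phi0 _ S0).
have z1 : cexp (u / 2) ^+ 2 = phi s0.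
  by rewrite expr2 -cexpD -splitr.
have [H [_ H0 H2 cH]] := star_lift (@sqr_uniform_covering R) (@open_strip R a b)
  (star_strip S0) S0 cphi phi0 (cexp_neq0 (u / 2)) z1.
exists H => s Ss; split; [exact: H2|exact: H0|].
have [B hB] := dphi _ Ss.
have n0 : 2 * H s != 0 by rewrite mulf_neq0 ?pnatr_eq0 //; exact: H0.
exists (B / (2 * H s)); apply: (sderiv_lift n0 (sderiv_sqr (H s)) hB (cH s Ss)).
have : \forall x \near s, strip a b x by move: (@open_strip R a b); rewrite openE; apply.
by apply: filterS => x; exact: H2.
Qed.

(** The translate of H by a period of phi is another square root of phi, hence a
   multiple of H by a constant of square 1. *)
Lemma strip_sqrt_period a b (phi H : R[i] -> R[i]) (P : R) :
  (forall s, strip a b s -> phi s != 0) ->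
  (forall s, strip a b s -> phi @ nbhs s --> phi s) ->
  (forall s, strip a b s -> H s ^+ 2 = phi s) ->
  (forall s, strip a b s -> H @ nbhs s --> H s) ->
  (forall s, strip a b s -> phi (vline s P) = phi s) ->
  forall s, strip a b s -> H (vline s (P + P)) = H s.
Proof.
move=> phi0 cphi H2 cH perphi s0 S0.
have H0 s : strip a b s -> H s != 0.
  by move=> Ss; have := phi0 s Ss; rewrite -H2 // expf_eq0.
pose eta := H (vline s0 P) / H s0.
have eta2 : eta ^+ 2 = 1.
  rewrite /eta expr_div_n !H2 ?perphi ?divff ?phi0 //; exact: strip_vline.
have SP s : strip a b s -> strip a b (vline s P) by exact: strip_vline.
have key s : strip a b s -> H (vline s P) = eta * H s.
  apply: (lift_unique_on (p := fun s => H (vline s P)) (q := fun s => eta * H s)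
    (@sqr_uniform_covering R) (star_strip S0) S0 phi0 cphi).
  - by move=> z Sz; apply: H0; exact: SP.
  - by move=> z Sz; rewrite H2 ?perphi //; exact: SP.
  - by move=> z Sz; rewrite exprMn eta2 mul1r H2.
  - move=> z Sz; have cv : (fun s => vline s P) @ nbhs z --> vline z P.
      by apply: cvg_cD; [exact: cvg_id|exact: cvg_cst].
    exact: (cvg_comp (fun s => vline s P) H cv (cH _ (SP _ Sz))).
  - by move=> z Sz; apply: cvg_cM; [exact: cvg_cst|exact: cH].
  - by rewrite /eta divfK // H0.
rewrite -vlineD key; last exact: SP.
by rewrite key // mulrA -expr2 eta2 mul1r.
Qed.

End SquareRoot.

(** * The exponential representation *)

Theorem corollary1 (R : realType) (D U : set R[i]) (f w : R[i] -> R[i])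
    (a b : \bar R) :
  lemniscate_region D U f a b ->
  regular_region U f ->
  analytic_on U w ->
  exists sigma : cumulative R R,
    forall t : R, ointerval a b t ->
      (lebesgue_stieltjes_measure sigma).-integrable setT
        (fun x : R => (expR (x * t))%:E) /\
      is_arclength_integral (level_set D f t `&` U)
        (fun z => normc (w z) ^+ 2)
        (\int[lebesgue_stieltjes_measure sigma]_(x in setT) (expR (x * t))%:E)%E.
Proof.
move=> lem reg aw.
have [oU cU _ hU prop] := lemniscate_proper lem reg.
have cov : uniform_covering f U (annulus a b).
  by apply: (@proper_uniform_covering _ f (derive1 f)) => // z /hU[].
have [psi [n [n0 hpsi dpsi surj hper]]] := lemniscate_uniformization lem reg.
pose f1 : R[i] -> R[i] := derive1 f.
have hf z : U z -> [/\ annulus a b (f z), sderiv f z (f1 z), f1 @ nbhs z --> f1 z & f1 z != 0].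
  move=> /hU[h1 h2 h3 h4]; split => //.
  by have [h5 _] := analytic_derive1 h3; exact: sderiv_cvg h5.
have UD z : U z -> D z.
  have [_ _ _ [z0 _ ->] _] := lem.
  by move=> /connected_component_sub[].
pose psi1 s : R[i] := cexp s / f1 (psi s).
pose P : R := @level_period R n.
have P0 : 0 < P by exact: level_period_gt0.
have n0R : 0 < n%:R :> R by rewrite ltr0n.
have psi10 s : strip a b s -> psi1 s != 0 by exact: (psi1_neq0 hf hpsi).
have dpsi1 s : strip a b s -> exists B, sderiv psi1 s B.
  move=> Ss; have [Us _] := hpsi _ Ss; have [_ _ af1 f10] := hU _ Us.
  have [df1 _] := analytic_derive1 af1.
  have dV := sderiv_comp (sderiv_comp (dpsi _ Ss) df1) (sderivV f10).
  by eexists; exact: (sderivM (sderiv_cexp s) dV).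
have cpsi1 s : strip a b s -> psi1 @ nbhs s --> psi1 s.
  by move=> /dpsi1[B]; exact: sderiv_cvg.
have [H hH] := strip_sqrt psi10 dpsi1.
have psiP s : strip a b s -> psi (vline s P) = psi s.
  move=> Ss; apply/hper => //; first exact: strip_vline.
  exists 1; rewrite mul1r int_two_pi_i; congr (s + _).
  by apply: complexP; rewrite ?complex_ReM ?complex_ImM /=; rewrite /P /level_period; ring.
have psi1P s : strip a b s -> psi1 (vline s P) = psi1 s.
  move=> Ss; have [_ h1] := hpsi _ Ss; have [_ h2] := hpsi _ (strip_vline P Ss).
  by rewrite /psi1 -h1 -h2 psiP.
(* the squared modulus of h is the density of the integral on a level curve *)
pose h s := w (psi s) * H s.
have dh s : strip a b s -> sderiv h s (derive1 h s).
  move=> Ss; have [Us _] := hpsi _ Ss; have [dw _] := analytic_derive1 (aw _ Us).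
  have [_ _ [B dH]] := hH s Ss.
  have dhs := sderivM (sderiv_comp (dpsi _ Ss) dw) dH.
  by rewrite (sderiv_derive1 dhs).
have HP : forall s, strip a b s -> H (vline s (P + P)) = H s.
  apply: (strip_sqrt_period psi10 cpsi1 _ _ psi1P).
  - by move=> s /hH[].
  - by move=> s /hH[_ _ [B]]; exact: sderiv_cvg.
have hP s : strip a b s -> h (vline s (P + P)) = h s.
  move=> Ss; rewrite /h HP // -vlineD psiP; last exact: strip_vline.
  by rewrite psiP.
(* P + P is a period of h, whereas H may change sign over P *)
pose omega : R := (2 * n%:R)^-1.
have om0 : 0 < omega by rewrite invr_gt0 mulr_gt0.
have omT : omega * (P + P) = pi *+ 2.
  by rewrite /omega /P /level_period; field; rewrite gt_eqF.
have [m m0 hm] := strip_parseval (addr_gt0 P0 P0) om0 omT dh hP.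
have m0' k : 0 <= P * m k by rewrite mulr_ge0 // ltW.
have nu0 : 0 < 2 * omega by rewrite mulr_gt0.
(* the jump at k * (2 * omega) = k / n is P * m k: energy is a mean over the
   length 2 P, which runs through the level curve twice *)
exists (step_cumulative m0' nu0) => t ht.
pose L := P * energy (P + P) (h \o vline t%:C).
have St : strip a b t%:C by [].
have cL : zsum M (fun k => P * m k * expR (k%:~R * (2 * omega) * t)) @[M --> \oo] --> L.
  have -> : (fun M => zsum M (fun k => P * m k * expR (k%:~R * (2 * omega) * t))) =
      fun M => P * zsum M (fun k => m k * expR (k%:~R * (2 * omega) * Re t%:C)).
    by apply/funext => M; rewrite -zsumZ; congr (zsum M _); apply/funext => k; exact: (esym (mulrA _ _ _)).
  by apply: cvgM; [exact: cvg_cst|exact: hm].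
have [hi ->] := step_stieltjes m0' nu0 cL; split => //.
have -> : level_set D f t `&` U = level_in_U U f t.
  apply/seteqP; split => z.
    move=> [[_ fz] Uz]; split => //; have [[fz0 _] _ _ _] := hU z Uz.
    move: fz; rewrite lnnormE // => -[<-]; rewrite lnK //.
    by rewrite posrE normc_gt0.
  move=> [Uz fz]; split => //; split; first exact: UD.
  by have [[fz0 _] _ _ _] := hU z Uz; rewrite lnnormE // fz expRK.
have cw z : U z -> normc (w u) ^+ 2 @[u --> z] --> normc (w z) ^+ 2.
  move=> Uz; have [dw _] := analytic_derive1 (aw _ Uz).
  have cn : normc (w u) @[u --> z] --> normc (w z).
    exact: (cvg_normc (sderiv_cvg dw)).
  rewrite expr2.
  exact: (@cvgM _ _ _ _ (fun y => normc (w y)) (fun y => normc (w y)) _ _ cn cn).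
have := level_arclength n0 ht cov hf hpsi dpsi surj hper cw.
set G := (fun x => _ * _).
have GE : G = fun x => normc ((h \o vline t%:C) x) ^+ 2.
  apply/funext => x; rewrite /G /h /= /level_curve.
  have Sx := strip_vline x St; have [H2 _ _] := hH _ Sx.
  by rewrite [in RHS]normcM exprMn -[normc (H _) ^+ 2]normcX H2.
have cG : continuous G.
  rewrite GE; apply: continuous_sqr_normc; exact: (continuous_vline dh St).
have perG x : G (x + P) = G x.
  have GG y : G y = normc (w (psi (vline t%:C y))) ^+ 2 * normc (psi1 (vline t%:C y)) by [].
  have Sx := strip_vline x St.
  by rewrite !GG -vlineD (psi1P _ Sx) (psiP _ Sx).
have -> : L = rint P G.
  rewrite /L /energy -GE (rint_double P0 cG perG).
  have Pn : P != 0 by rewrite gt_eqF.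
  have -> : P + P = 2 * P by ring.
  by field; exact: Pn.
by [].
Qed.
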